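(* Consider the Jacobi step-line forms $\mathcal B_N^{\mathrm J},\mathcal A_N^{\mathrm J}$ and the Laguerre I step-line forms $\mathcal B_N^{\mathrm L},\mathcal A_N^{\mathrm L}$ ($N\in\mathbb N_0$) of the context, and assume that the relevant step-line index pairs are normal and that the normalization constants $h_N^{\mathrm J},g_N^{\mathrm J},h_N^{\mathrm L},g_N^{\mathrm L}$ do not vanish. For $N,M\in\mathbb N_0$ put $$\mathscr P^{\mathrm J}_{N,M}=\frac1{h_N^{\mathrm J}g_M^{\mathrm J}}\sum_{\substack{1\le i\le p,\ 1\le j\le q\\ u,v\ge0}}\mathsf a^{\mathrm J}_{M;i,u}\,\mathsf b^{\mathrm J}_{N;j,v}\,\frac{\Gamma((\alpha_i+u+v+2)\mathbf 1_q+\boldsymbol a)}{\Gamma((\alpha_i+u+v+2)\mathbf 1_q+\boldsymbol b+\boldsymbol e_j)},$$ and, with $\zeta_{i,u,v}=\beta_i+u+v+2$, $$\mathscr P^{\mathrm L}_{N,M}=\frac1{h_N^{\mathrm L}g_M^{\mathrm L}}\sum_{\substack{1\le i\le p\\ u\ge0}}\mathsf a^{\mathrm L}_{M;i,u}\Biggl[\sum_{\substack{1\le h\le r\\ v\ge0}}\mathsf b^{\mathrm L}_{N;h,v}\frac{\Gamma(\zeta_{i,u,v}\mathbf 1_q+\boldsymbol a)}{\Gamma(\zeta_{i,u,v}\mathbf 1_r+\boldsymbol b+\boldsymbol e_h)}+\sum_{\substack{1\le\ell\le s\\ v\ge0}}\mathsf d^{\mathrm L}_{N;\ell,v}\,\zeta_{i,u,v}^{\ell-1}\frac{\Gamma(\zeta_{i,u,v}\mathbf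 1_q+\boldsymbol a)}{\Gamma(\zeta_{i,u,v}\mathbf 1_r+\boldsymbol b)}\Biggr],$$ where $\mathsf a,\mathsf b,\mathsf d$ are the coefficients of the unnormalized component polynomials (all sums are finite). For $\star\in\{\mathrm J,\mathrm L\}$, $k\in\{-p,\dots,q\}$ and $N+k\ge0$ set $b_N^{\star,k}=\mathscr P^\star_{N,N+k}$. Then for every $N\in\mathbb N_0$ $$x\mathcal B_N^\star(x)=\sum_{\substack{k=-p\\ N+k\ge0}}^qb_N^{\star,k}\mathcal B_{N+k}^\star(x),\qquad x\mathcal A_N^\star(x)=\sum_{\substack{k=-q\\ N+k\ge0}}^pb_{N+k}^{\star,-k}\mathcal A_{N+k}^\star(x),$$ and $b_N^{\mathrm J,q}=b_N^{\mathrm L,q}=1$.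
   Context: Conventions. $(c)_k=c(c+1)\cdots(c+k-1)$; for vectors, $\Gamma(\boldsymbol c)=\prod\Gamma(c_i)$, $(\boldsymbol c)_{\boldsymbol\nu}=\prod(c_i)_{\nu_i}$; $\mathbf 1_d=(1,\dots,1)$; $\boldsymbol e_j$ coordinate vector; $\mathbb P_N$ complex polynomials of degree $\le N$ ($\{0\}$ if $N<0$); $[x^d]P$ is the coefficient of $x^d$; $\mathcal M[f](s)=\int_0^\infty x^{s-1}f(x)dx$. $\boldsymbol\sigma_d(N)\in\mathbb N_0^d$ is the step-line multi-index: if $N=dm+j$, $0\le j<d$, its first $j$ entries are $m+1$ and the rest are $m$. $\chi_N=(N\bmod q)+1$. $\mathcal B_{a,b}(x)=x^a(1-x)^{b-a-1}/\Gamma(b-a)$ on $(0,1)$, $0$ elsewhere; $\mathcal G_a(x)=x^ae^{-x}$ on $(0,\infty)$; $(f*g)(x)=\int_0^\infty f(t)g(x/t)dt/t$. Jacobi setting. $p,q\ge1$, $-1<a_j<b_j$ ($1\le j\le q$), $\boldsymbol\alpha\in\mathbb R^p$ with $\alpha_i+a_\rho>-1$; $w_0(x;\boldsymbol a,\boldsymbol b)=\mathcal B_{a_1,b_1}*\cdots*\mathcal B_{a_q,b_q}$, $w_j=w_0(\cdot;\boldsymbol a,\boldsymbol b+\boldsymbol e_j)$. Nonresonance: $\alpha_i-\alpha_h\notin\mathbb Z$ ($i\ne h$), $b_j-b_h\notin\mathbb Z$ ($j\ne h$), $a_\rho-b_j\notin\mathbb N_0$. Unnormalized forms: with $\boldsymbol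 n=\boldsymbol\sigma_p(N+1)$, $\boldsymbol m=\boldsymbol\sigma_q(N)$, $$\widehat{\mathcal A}_N^{\mathrm J}(x)=\frac{(-1)^{N+1}}{2\pi\mathrm i}\int_\Sigma\frac{((t+1)\mathbf 1_q+\boldsymbol b)_{\boldsymbol m}}{((t+1)\mathbf 1_p-\boldsymbol\alpha-\boldsymbol n)_{\boldsymbol n}}\frac{\Gamma(t\mathbf 1_q+\boldsymbol b+\mathbf 1_q)}{\Gamma(t\mathbf 1_q+\boldsymbol a+\mathbf 1_q)}x^tdt=\sum_{i=1}^p\mathscr A_N^{\mathrm J,(i)}(x)x^{\alpha_i},$$ $\Sigma$ enclosing exactly the nodes $\alpha_i,\dots,\alpha_i+n_i-1$ ($n_i\ge1$) and no other pole, $\mathscr A_N^{\mathrm J,(i)}(x)=\sum_u\mathsf a^{\mathrm J}_{N;i,u}x^u\in\mathbb P_{n_i-1}$; and $\widehat{\mathcal B}_N^{\mathrm J}=\sum_{j=1}^q\mathscr B_N^{\mathrm J,(j)}w_j$, with $\mathscr B_N^{\mathrm J,(j)}(x)=\sum_v\mathsf b^{\mathrm J}_{N;j,v}x^v$ of degree at most $\boldsymbol\sigma_q(N+1)_j-1$, is the form with $\mathcal M[\widehat{\mathcal B}_N^{\mathrm J}](s)=-\frac{\Gamma(s\mathbf 1_q+\boldsymbol a)}{\Gamma(s\mathbf 1_q+\boldsymbol b+\boldsymbol\sigma_q(N+1))}(\boldsymbol\alpha+(1-s)\mathbf 1_p)_{\boldsymbol\sigma_p(N)}$. Constants: $h_N^{\mathrm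 J}=[x^{\boldsymbol\sigma_q(N+1)_{\chi_N}-1}]\mathscr B_N^{\mathrm J,(\chi_N)}$, $g_N^{\mathrm J}=\int_0^1x^{\boldsymbol\sigma_q(N)_{\chi_N}}\widehat{\mathcal A}_N^{\mathrm J}(x)w_{\chi_N}(x)dx$. Normalized: $\mathcal A_N^{\mathrm J}=\widehat{\mathcal A}_N^{\mathrm J}/g_N^{\mathrm J}$, $\mathcal B_N^{\mathrm J}=\widehat{\mathcal B}_N^{\mathrm J}/h_N^{\mathrm J}$. Laguerre I setting. $p\ge1$, $q=r+s$, $r\ge0$, $s\ge1$, $\boldsymbol a\in(-1,\infty)^q$, $\boldsymbol b\in(-1,\infty)^r$, $a_h<b_h$ ($h\le r$), $\boldsymbol\beta\in\mathbb R^p$ with $\beta_i+a_\rho>-1$; $w_0=\mathcal B_{a_1,b_1}*\cdots*\mathcal B_{a_r,b_r}*\mathcal G_{a_{r+1}}*\cdots*\mathcal G_{a_q}$, $w_h=w_0(\cdot;\boldsymbol a,\boldsymbol b+\boldsymbol e_h)$ ($h\le r$), $v_\ell=(-x\frac d{dx})^{\ell-1}w_0$ ($\ell\le s$), $(U_1,\dots,U_q)=(w_1,\dots,w_r,v_1,\dots,v_s)$. Nonresonance: $\beta_i-\beta_h\notin\mathbb Z$ ($i\ne h$), $b_h\ne b_j$ ($h\ne j$), $b_h+v\ne a_\rho$ for all integers $v\ge1$. Let $\boldsymbol n_N\in\mathbb N_0^r$ be the first $r$ entries of $\boldsymbol\sigma_q(N)$. Unnormalized forms: with $\boldsymbol m=\boldsymbol\sigma_p(N+1)$,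 $$\widehat{\mathcal A}_N^{\mathrm L}(x)=\frac1{2\pi\mathrm i}\int_\Sigma\frac{\Gamma(t\mathbf 1_r+\boldsymbol b+\boldsymbol n_N+\mathbf 1_r)}{\Gamma(t\mathbf 1_q+\boldsymbol a+\mathbf 1_q)}\frac{x^t}{\prod_i(\beta_i-t)_{m_i}}dt=\sum_{i=1}^p\mathscr A_N^{\mathrm L,(i)}(x)x^{\beta_i},\quad\mathscr A_N^{\mathrm L,(i)}(x)=\sum_u\mathsf a^{\mathrm L}_{N;i,u}x^u,$$ $\Sigma$ enclosing exactly the nodes $\beta_i,\dots,\beta_i+m_i-1$ and no other pole; and $\widehat{\mathcal B}_N^{\mathrm L}=\sum_{h\le r}\mathscr B_N^{\mathrm L,(h)}w_h+\sum_{\ell\le s}\mathscr D_N^{\mathrm L,(\ell)}v_\ell$, with $\mathscr B_N^{\mathrm L,(h)}=\sum_v\mathsf b^{\mathrm L}_{N;h,v}x^v$, $\mathscr D_N^{\mathrm L,(\ell)}=\sum_v\mathsf d^{\mathrm L}_{N;\ell,v}x^v$, the component multiplying $U_\rho$ having degree at most $\boldsymbol\sigma_q(N+1)_\rho-1$, is the form with $\mathcal M[\widehat{\mathcal B}_N^{\mathrm L}](z)=\frac{\Gamma(z\mathbf 1_q+\boldsymbol a)}{\Gamma(z\mathbf 1_r+\boldsymbol b+\boldsymbol n_{N+1})}(\boldsymbol\beta+(1-z)\mathbf 1_p)_{\boldsymbol\sigma_p(N)}$. Constants: $h_N^{\mathrm L}$ is the coefficient of $x^{\boldsymbol\sigma_q(N+1)_{\chi_N}-1}$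 in the component multiplying $U_{\chi_N}$, and $g_N^{\mathrm L}=\int_0^\infty x^{\boldsymbol\sigma_q(N)_{\chi_N}}\widehat{\mathcal A}_N^{\mathrm L}(x)U_{\chi_N}(x)dx$. Normalized: $\mathcal A_N^{\mathrm L}=\widehat{\mathcal A}_N^{\mathrm L}/g_N^{\mathrm L}$, $\mathcal B_N^{\mathrm L}=\widehat{\mathcal B}_N^{\mathrm L}/h_N^{\mathrm L}$. Normality of the step-line index pairs means that, for each $N$, the space of forms with the degree bounds of $\widehat{\mathcal A}_N$ orthogonal to $x^k$ times the $j$-th weight ($0\le k<\boldsymbol\sigma_q(N)_j$), and the space of forms with the degree bounds of $\widehat{\mathcal B}_N$ orthogonal to $x^k$ times the $i$-th power ($0\le k<\boldsymbol\sigma_p(N)_i$), are one-dimensional. *)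

(* Defs.v *)
From HB Require Import structures.
From mathcomp Require Import all_boot all_order all_algebra.
From mathcomp Require Import complex.
From mathcomp Require Import all_classical all_reals all_analysis.

Set Implicit Arguments.
Unset Strict Implicit.
Unset Printing Implicit Defensive.

Import Order.TTheory GRing.Theory Num.Theory.
Import numFieldNormedType.Exports.

Local Open Scope classical_set_scope.
Local Open Scope ring_scope.
Local Open Scope complex_scope.

(* The entries of multi-indices are numbered from 0. *)
Definition step_line (d N : nat) (i : 'I_d) : nat :=
  (N %/ d + (i < N %% d))%N.

(* 0-based counterpart of chi_N = (N mod q) + 1. *)
Definition chi (q : nat) (hq : (0 < q)%N) (N : nat) : 'I_q :=
  Ordinal (ltn_pmod N hq).

(* The integers -m, ..., n, in increasing order. *)
Definition int_range (m n : nat) : seq int :=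
  [seq k%:Z - m%:Z | k <- iota 0 (m + n).+1].

Section ComplexAnalysis.
Variable R : realType.
Local Notation C := (R[i]).
Local Notation mu := (@lebesgue_measure R).

Definition cintegral (D : set R) (f : R -> C) : C :=
  (\int[mu]_(x in D) complex.Re (f x)) +i*
  (\int[mu]_(x in D) complex.Im (f x)).

(* x ^ z = exp (z ln x), meant for 0 < x. *)
Definition cpow (x : R) (z : C) : C :=
  (x `^ complex.Re z)%:C *
  (cos (complex.Im z * ln x) +i* sin (complex.Im z * ln x)).

Definition mellin (f : R -> C) (s : C) : C :=
  cintegral `]0, +oo[ (fun x => cpow x (s - 1) * f x).

Definition poch (c : C) (k : nat) : C := \prod_(l < k) (c + l%:R).

Definition euler_integral (z : C) : C :=
  mellin (fun x => (expR (- x))%:C) z.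

(* Gamma (z) = Gamma (z + n) / (z)_n, where n is the least natural number with
   0 < Re z + n. At the poles 0, -1, -2, ... the value is 0 since x / 0 = 0;
   hence (Gamma z)^-1 is the entire function 1 / Gamma on all of C. *)
Definition Gamma (z : C) : C :=
  let n := Num.truncn (1 - complex.Re z) in
  euler_integral (z + n%:R) / poch z n.

Definition Gammav (d : nat) (c : 'I_d -> C) : C := \prod_(i < d) Gamma (c i).

Definition pochv (d : nat) (c : 'I_d -> C) (nu : 'I_d -> nat) : C :=
  \prod_(i < d) poch (c i) (nu i).

(* b + e_j *)
Definition add_unit (d : nat) (b : 'I_d -> R) (j : 'I_d) : 'I_d -> R :=
  fun k => b k + (k == j)%:R.

Definition two_pi_i : C := 0 +i* (2 * pi).

Definition re_part (g : R -> C) : R -> R := fun tau => complex.Re (g tau).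
Definition im_part (g : R -> C) : R -> R := fun tau => complex.Im (g tau).

Definition cderive (g : R -> C) (tau : R) : C :=
  derive1 (re_part g) tau +i* derive1 (im_part g) tau.

(* A contour is parametrized by [0, 1]. The derivative may vanish, so that
   piecewise C^1 curves are covered, after reparametrization; and a C^1 curve
   on [0, 1] always extends to a C^1 curve on R. *)
Definition closed_contour (g : R -> C) : Prop :=
  [/\ g 0 = g 1,
      forall tau, derivable (re_part g) tau 1,
      forall tau, derivable (im_part g) tau 1,
      continuous (derive1 (re_part g)) &
      continuous (derive1 (im_part g))].

Definition contour_integral (g : R -> C) (f : C -> C) : C :=
  cintegral `[0, 1] (fun tau => f (g tau) * cderive g tau).

Definition winding_number (g : R -> C) (c : C) : C :=
  two_pi_i^-1 * contour_integral g (fun t => (t - c)^-1).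

(* g is a closed contour, off all the listed points, going once and
   anticlockwise around each node and around none of the other points. *)
Definition encloses_exactly (g : R -> C) (nodes others : set C) : Prop :=
  [/\ closed_contour g,
      forall tau, 0 <= tau <= 1 -> ~ (nodes `|` others) (g tau),
      forall c, nodes c -> winding_number g c = 1 &
      forall c, others c -> winding_number g c = 0].

Definition node_set (p : nat) (e : 'I_p -> R) (n : 'I_p -> nat) : set C :=
  [set c | exists i : 'I_p, exists2 k : nat,
     (k < n i)%N & c = (e i + k%:R)%:C].

(* The poles of t |-> Gamma (t + b_j + 1), for all j. *)
Definition Gamma_pole_set (d : nat) (b : 'I_d -> R) : set C :=
  [set c | exists j : 'I_d, exists k : nat, c = (- b j - 1 - k%:R)%:C].

Definition power_form (p : nat) (e : 'I_p -> R) (P : 'I_p -> {poly C})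
    (x : R) : C :=
  \sum_(i < p) (P i).[x%:C] * (x `^ e i)%:C.

Definition weight_form (q : nat) (w : 'I_q -> R -> R) (Q : 'I_q -> {poly C})
    (x : R) : C :=
  \sum_(j < q) (Q j).[x%:C] * (w j x)%:C.

Definition power_form_space (p q : nat) (D : set R) (e : 'I_p -> R)
    (w : 'I_q -> R -> R) (n : 'I_p -> nat) (m : 'I_q -> nat) : set (R -> C) :=
  [set f | (exists2 P : 'I_p -> {poly C},
             (forall i, (size (P i) <= n i)%N) & f = power_form e P) /\
           forall (j : 'I_q) (k : nat), (k < m j)%N ->
             cintegral D (fun x => (x ^+ k * w j x)%:C * f x) = 0].

Definition weight_form_space (p q : nat) (D : set R) (e : 'I_p -> R)
    (w : 'I_q -> R -> R) (m : 'I_q -> nat) (n : 'I_p -> nat) : set (R -> C) :=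
  [set f | (exists2 Q : 'I_q -> {poly C},
             (forall j, (size (Q j) <= m j)%N) & f = weight_form w Q) /\
           forall (i : 'I_p) (k : nat), (k < n i)%N ->
             cintegral D (fun x => (x ^+ k * x `^ e i)%:C * f x) = 0].

(* Meant for linear spaces of functions on the positive half-line. *)
Definition one_dimensional (S : set (R -> C)) : Prop :=
  exists f0, [/\ S f0, exists2 x, 0 < x & f0 x != 0 &
    forall f, S f -> exists c : C, forall x, 0 < x -> f x = c * f0 x].

Definition step_line_normal (p q : nat) (D : set R) (e : 'I_p -> R)
    (w : 'I_q -> R -> R) : Prop :=
  forall N : nat,
    one_dimensional (power_form_space D e w
      (@step_line p N.+1) (@step_line q N)) /\
    one_dimensional (weight_form_space D e w
      (@step_line q N.+1) (@step_line p N)).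

Definition beta_fun (a b : R) (x : R) : R :=
  if 0 < x < 1
  then x `^ a * (1 - x) `^ (b - a - 1) / complex.Re (Gamma (b - a)%:C)
  else 0.

Definition gamma_fun (a : R) (x : R) : R :=
  if 0 < x then x `^ a * expR (- x) else 0.

Definition mconv (f g : R -> R) (x : R) : R :=
  \int[mu]_(t in `]0, +oo[) (f t * g (x / t) / t).

(* f_1 * (f_2 * (... * f_n)); the value on the empty sequence is irrelevant. *)
Fixpoint mconvs (fs : seq (R -> R)) : R -> R :=
  match fs with
  | [::] => fun=> 0
  | f :: fs' => if fs' is [::] then f else mconv f (mconvs fs')
  end.

Section Jacobi.
Variables (p q : nat) (hq : (0 < q)%N).
Variables (a b : 'I_q -> R) (alpha : 'I_p -> R).

Definition jacobi_w0 (b' : 'I_q -> R) : R -> R :=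
  mconvs [seq beta_fun (a j) (b' j) | j <- enum 'I_q].

Definition jacobi_w (j : 'I_q) : R -> R := jacobi_w0 (add_unit b j).

Definition jacobi_Ahat (Sigma : R -> C) (N : nat) (x : R) : C :=
  (-1) ^+ N.+1 / two_pi_i *
  contour_integral Sigma (fun t =>
    pochv (fun j => t + 1 + (b j)%:C) (@step_line q N)
    / pochv (fun i => t + 1 - (alpha i)%:C - (@step_line p N.+1 i)%:R)
            (@step_line p N.+1)
    * (Gammav (fun j => t + (b j)%:C + 1) / Gammav (fun j => t + (a j)%:C + 1))
    * cpow x t).

Definition jacobi_Bmellin (N : nat) (s : C) : C :=
  - (Gammav (fun j => s + (a j)%:C)
     / Gammav (fun j => s + (b j)%:C + (@step_line q N.+1 j)%:R)
     * pochv (fun i => (alpha i)%:C + (1 - s)) (@step_line p N)).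

(* A and B below are the component polynomials of the unnormalized forms. *)
Variables (Sigma : nat -> R -> C).
Variables (A : nat -> 'I_p -> {poly C}) (B : nat -> 'I_q -> {poly C}).

Definition is_jacobi_A : Prop :=
  forall N : nat,
    [/\ encloses_exactly (Sigma N) (node_set alpha (@step_line p N.+1))
          (Gamma_pole_set b),
        forall i, (size (A N i) <= @step_line p N.+1 i)%N &
        forall x, 0 < x ->
          jacobi_Ahat (Sigma N) N x = power_form alpha (A N) x].

Definition is_jacobi_B : Prop :=
  forall N : nat,
    (forall j, (size (B N j) <= @step_line q N.+1 j)%N) /\
    (forall s : C, (forall j, 0 < complex.Re s + a j) ->
       mellin (weight_form jacobi_w (B N)) s = jacobi_Bmellin N s).

Definition jacobi_h (N : nat) : C :=
  (B N (chi hq N))`_(step_line N.+1 (chi hq N)).-1.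

Definition jacobi_g (N : nat) : C :=
  cintegral `]0, 1[ (fun x =>
    (x ^+ step_line N (chi hq N))%:C * jacobi_Ahat (Sigma N) N x
    * (jacobi_w (chi hq N) x)%:C).

Definition jacobi_An (N : nat) (x : R) : C :=
  jacobi_Ahat (Sigma N) N x / jacobi_g N.

Definition jacobi_Bn (N : nat) (x : R) : C :=
  weight_form jacobi_w (B N) x / jacobi_h N.

Definition jacobi_P (N M : nat) : C :=
  (jacobi_h N * jacobi_g M)^-1 *
  \sum_(i < p) \sum_(j < q)
  \sum_(u < size (A M i)) \sum_(v < size (B N j))
    (A M i)`_u * (B N j)`_v *
    (Gammav (fun k => (alpha i + u%:R + v%:R + 2 + a k)%:C)
     / Gammav (fun k => (alpha i + u%:R + v%:R + 2 + add_unit b j k)%:C)).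

Definition jacobi_b (N : nat) (k : int) : C := jacobi_P N (absz (N%:Z + k)).

End Jacobi.

Section Laguerre.
Variables (p r s : nat) (hq : (0 < r + s)%N).
Variables (a : 'I_(r + s) -> R) (b : 'I_r -> R) (beta : 'I_p -> R).

Definition laguerre_w0 (b' : 'I_r -> R) : R -> R :=
  mconvs ([seq beta_fun (a (lshift s h)) (b' h) | h <- enum 'I_r] ++
          [seq gamma_fun (a (rshift r l)) | l <- enum 'I_s]).

Definition laguerre_w (h : 'I_r) : R -> R := laguerre_w0 (add_unit b h).

Definition laguerre_v (l : 'I_s) : R -> R :=
  iter l (fun (f : R -> R) x => - x * derive1 f x) (laguerre_w0 b).

Definition laguerre_U (rho : 'I_(r + s)) : R -> R :=
  match fintype.split rho with inl h => laguerre_w h | inr l => laguerre_v l end.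

(* The first r entries of the step-line multi-index of length r + s. *)
Definition laguerre_n (N : nat) (h : 'I_r) : nat :=
  step_line N (lshift s h).

Definition laguerre_Ahat (Sigma : R -> C) (N : nat) (x : R) : C :=
  two_pi_i^-1 *
  contour_integral Sigma (fun t =>
    Gammav (fun h => t + (b h)%:C + (laguerre_n N h)%:R + 1)
    / Gammav (fun rho => t + (a rho)%:C + 1)
    * (cpow x t / pochv (fun i => (beta i)%:C - t) (@step_line p N.+1))).

Definition laguerre_Bmellin (N : nat) (z : C) : C :=
  Gammav (fun rho => z + (a rho)%:C)
  / Gammav (fun h => z + (b h)%:C + (laguerre_n N.+1 h)%:R)
  * pochv (fun i => (beta i)%:C + (1 - z)) (@step_line p N).

(* A and B below are the component polynomials of the unnormalized forms;
   B N (lshift s h) multiplies w_h and B N (rshift r l) multiplies v_l. *)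
Variables (Sigma : nat -> R -> C).
Variables (A : nat -> 'I_p -> {poly C}) (B : nat -> 'I_(r + s) -> {poly C}).

Definition is_laguerre_A : Prop :=
  forall N : nat,
    [/\ encloses_exactly (Sigma N) (node_set beta (@step_line p N.+1))
          (Gamma_pole_set (fun h => b h + (laguerre_n N h)%:R)),
        forall i, (size (A N i) <= @step_line p N.+1 i)%N &
        forall x, 0 < x ->
          laguerre_Ahat (Sigma N) N x = power_form beta (A N) x].

Definition is_laguerre_B : Prop :=
  forall N : nat,
    (forall rho, (size (B N rho) <= @step_line (r + s) N.+1 rho)%N) /\
    (forall z : C, (forall rho, 0 < complex.Re z + a rho) ->
       mellin (weight_form laguerre_U (B N)) z = laguerre_Bmellin N z).

Definition laguerre_h (N : nat) : C :=
  (B N (chi hq N))`_(step_line N.+1 (chi hq N)).-1.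

Definition laguerre_g (N : nat) : C :=
  cintegral `]0, +oo[ (fun x =>
    (x ^+ step_line N (chi hq N))%:C * laguerre_Ahat (Sigma N) N x
    * (laguerre_U (chi hq N) x)%:C).

Definition laguerre_An (N : nat) (x : R) : C :=
  laguerre_Ahat (Sigma N) N x / laguerre_g N.

Definition laguerre_Bn (N : nat) (x : R) : C :=
  weight_form laguerre_U (B N) x / laguerre_h N.

Definition laguerre_zeta (i : 'I_p) (u v : nat) : R :=
  beta i + u%:R + v%:R + 2.

(* The exponent of zeta is l, since l runs from 0 to s - 1 here. *)
Definition laguerre_P (N M : nat) : C :=
  (laguerre_h N * laguerre_g M)^-1 *
  \sum_(i < p) \sum_(u < size (A M i)) (A M i)`_u *
  (\sum_(h < r) \sum_(v < size (B N (lshift s h)))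
     (B N (lshift s h))`_v *
     (Gammav (fun rho => (laguerre_zeta i u v + a rho)%:C)
      / Gammav (fun k => (laguerre_zeta i u v + add_unit b h k)%:C))
   + \sum_(l < s) \sum_(v < size (B N (rshift r l)))
     (B N (rshift r l))`_v * (laguerre_zeta i u v ^+ l)%:C *
     (Gammav (fun rho => (laguerre_zeta i u v + a rho)%:C)
      / Gammav (fun k => (laguerre_zeta i u v + b k)%:C))).

Definition laguerre_b (N : nat) (k : int) : C := laguerre_P N (absz (N%:Z + k)).

End Laguerre.

End ComplexAnalysis.

(* Main.v *)
(* The coefficients of the components of a step-line form of index N are the coefficients
   of one polynomial of degree at most N, and multiplication by x becomes multiplication
   by 'X^p or 'X^q. The moments define a bilinear pairing K on polynomials with
   K ('X^p F, G) = K (F, 'X^q G), for which the A_N and the B_N are biorthogonal; the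
   recurrences are the expansions of 'X^q B_N and 'X^p A_N, whose coefficients are the
   pairings of A_M with 'X^q B_N.

   The orthogonality of B_N holds because the Pochhammer factor of its Mellin transform
   vanishes at the relevant points. As to A_N, the contour integral is a sum of residues
   at N + 1 simple poles c; in the product of the residue at c with the moment at
   c + k + 1 the Gamma factors cancel to T (c) / prod_(c' != c) (c - c') for a polynomial
   T of degree less than N, and the sum over c vanishes by Lagrange interpolation. The
   residues are obtained by approximating the Gamma quotient, uniformly on the contour, by
   rational functions with poles at the points that the contour does not enclose. *)

Require Import Defs.
From HB Require Import structures.
From mathcomp Require Import all_boot all_order all_algebra.
From mathcomp Require Import complex.
From mathcomp Require Import all_classical all_reals all_analysis.
From mathcomp Require Import measurable_realfun.
From mathcomp Require Import zify ring lra.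

Set Implicit Arguments.
Unset Strict Implicit.
Unset Printing Implicit Defensive.

Import Order.TTheory GRing.Theory Num.Theory.
Import numFieldNormedType.Exports.

Local Open Scope classical_set_scope.
Local Open Scope ring_scope.
Local Open Scope complex_scope.
Import ComplexField.Normc.

(** * Biorthogonal sequences and recurrences *)

(** The degree of A_N is not part of the data. The constant h_N is the leading coefficient of the
    polynomial encoding B_N, and g_N = K (A_N, 'X^N), so K (A_N, B_N) = h_N g_N. As B_N is
    orthogonal to all lower degrees, h_N g_N <> 0 forces A_N to have degree exactly N. Both
    sequences are then bases, and the band -p, ..., q comes from using orthogonality on either side
    of the shift identity.

    The contour is known only through its winding numbers, so residues are first computed for
    rational functions. Gamma and 1 / Gamma are reached from there by Gauss's product limit, which
    must be uniform on the contour and hold at the node too.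

    The values of K are Mellin moments of the single weights, not of the forms. They come from
    Tonelli's theorem for multiplicative convolutions, in the extended reals, so that finiteness is
    a conclusion. The weights v_l need more: the operator -x d/dx has to pass under the convolution
    integral at every point, and it is made to act on a Gamma factor, which exists because s >=
    1. *)

Lemma sum_int_range (V : nmodType) (N p q : nat) (f : nat -> V) :
  (forall M, (M + p < N)%N -> f M = 0) ->
  \sum_(k <- int_range p q | 0 <= N%:Z + k) f (absz (N%:Z + k)) =
  \sum_(M < (N + q).+1) f M.
Proof.
move=> f0; rewrite /int_range big_map -(big_mkord xpredT f).
(* If p <= N, no k is discarded, and the terms M < N - p absent from the range are zero. Otherwise
   the condition 0 <= N + k discards the first p - N values of k and the sum starts at M = 0. *)
have [pN|Np] := leqP p N.
  rewrite (big_cat_nat (n := (N - p)%N)) //=; last by lia.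
  rewrite [X in _ = X + _]big_nat_cond [X in _ = X + _]big1 ?add0r; last first.
    by move=> M /andP[/andP[_ h] _]; apply: f0; lia.
  rewrite -[X in \sum_(X <= _ < _) _]add0n big_addn /index_iota.
  rewrite (_ : ((N + q).+1 - (N - p) - 0)%N = (p + q).+1); last by lia.
  rewrite big_mkcond; apply: eq_bigr => k _.
  rewrite ifT; last by lia.
  by congr f; lia.
have -> : (p + q).+1 = ((p - N) + (N + q).+1)%N by lia.
rewrite iotaD add0n big_cat.
rewrite [X in X + _ = _]big_seq_cond [X in X + _ = _]big1 ?add0r; last first.
  by move=> k; rewrite mem_iota; lia.
rewrite (_ : iota (p - N) _ = [seq k + (p - N) | k <- iota 0 (N + q).+1])%N; last first.
  rewrite -[X in iota X]addn0 iotaDl; apply: eq_map => k /=; exact: addnC.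
rewrite big_map big_mkcond /index_iota subn0; apply: eq_bigr => k _.
rewrite ifT; last by lia.
by congr f; lia.
Qed.

Section Biorthogonality.
Variables (C : fieldType) (K : nat -> nat -> C).

Definition pairing (F G : {poly C}) : C :=
  \sum_(i < size F) \sum_(j < size G) F`_i * G`_j * K i j.

Lemma pairing_widen (m n : nat) (F G : {poly C}) :
  (size F <= m)%N -> (size G <= n)%N ->
  pairing F G = \sum_(i < m) \sum_(j < n) F`_i * G`_j * K i j.
Proof.
move=> Fm Gn; rewrite /pairing.
rewrite (big_ord_widen m (fun i => \sum_(j < size G) F`_i * G`_j * K i j)) //.
rewrite big_mkcond /=; apply: eq_bigr => i _.
case: ltnP => [_|Fi]; last first.
  by rewrite big1 // => j _; rewrite (nth_default _ Fi) !mul0r.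
rewrite (big_ord_widen n (fun j => F`_i * G`_j * K i j)) //.
rewrite big_mkcond /=; apply: eq_bigr => j _.
by case: ltnP => // Gj; rewrite (nth_default _ Gj) mulr0 mul0r.
Qed.

Lemma pairing_is_linear_r (F : {poly C}) : linear_for *%R (pairing F).
Proof.
move=> a G H.
rewrite (@pairing_widen (size F) (maxn (size G) (size H)) F (a *: G + H)) //; last first.
  rewrite (leq_trans (size_polyD _ _)) // geq_max.
  by rewrite (leq_trans (size_scale_leq _ _)) ?leq_maxl ?leq_maxr.
rewrite (@pairing_widen (size F) (maxn (size G) (size H)) F G) ?leq_maxl //.
rewrite (@pairing_widen (size F) (maxn (size G) (size H)) F H) ?leq_maxr //.
rewrite mulr_sumr -big_split /=; apply: eq_bigr => i _.
rewrite mulr_sumr -big_split /=; apply: eq_bigr => j _.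
by rewrite coefD coefZ; ring.
Qed.

Lemma pairing_is_linear_l (G : {poly C}) : linear_for *%R (pairing^~ G).
Proof.
move=> a F H.
rewrite (@pairing_widen (maxn (size F) (size H)) (size G) (a *: F + H)) //; last first.
  rewrite (leq_trans (size_polyD _ _)) // geq_max.
  by rewrite (leq_trans (size_scale_leq _ _)) ?leq_maxl ?leq_maxr.
rewrite (@pairing_widen (maxn (size F) (size H)) (size G) F G) ?leq_maxl //.
rewrite (@pairing_widen (maxn (size F) (size H)) (size G) H G) ?leq_maxr //.
rewrite mulr_sumr -big_split /=; apply: eq_bigr => i _.
rewrite mulr_sumr -big_split /=; apply: eq_bigr => j _.
by rewrite coefD coefZ; ring.
Qed.

HB.instance Definition _ (F : {poly C}) :=
  GRing.isLinear.Build C {poly C} C _ (pairing F) (pairing_is_linear_r F).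

Lemma pairing_sumr I (r : seq I) (P : pred I) F (c : I -> C) (G : I -> {poly C}) :
  pairing F (\sum_(i <- r | P i) c i *: G i) =
  \sum_(i <- r | P i) c i * pairing F (G i).
Proof. by rewrite linear_sum; apply: eq_bigr => i _; rewrite linearZ. Qed.

Lemma pairing_suml I (r : seq I) (P : pred I) G (c : I -> C) (F : I -> {poly C}) :
  pairing (\sum_(i <- r | P i) c i *: F i) G =
  \sum_(i <- r | P i) c i * pairing (F i) G.
Proof.
have p0 : pairing 0 G = 0 by rewrite /pairing size_poly0 big_ord0.
have pD a F1 F2 : pairing (a *: F1 + F2) G = a * pairing F1 G + pairing F2 G.
  exact: pairing_is_linear_l.
by elim/big_rec2: _ => // i x y _ <-; rewrite pD.
Qed.

Lemma pairingXX (m n : nat) : pairing 'X^m 'X^n = K m n.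
Proof.
rewrite (@pairing_widen m.+1 n.+1) ?size_polyXn //.
rewrite big_ord_recr big1 ?add0r /=; last first.
  move=> i _; rewrite big1 // => j _.
  by rewrite !coefXn (ltn_eqF (ltn_ord i)) !mul0r.
rewrite big_ord_recr big1 ?add0r /=; last first.
  by move=> j _; rewrite !coefXn (ltn_eqF (ltn_ord j)) mulr0 mul0r.
by rewrite !coefXn !eqxx !mul1r add0r.
Qed.

Lemma poly_sumXn (n : nat) (F : {poly C}) :
  (size F <= n)%N -> F = \sum_(i < n) F`_i *: 'X^i.
Proof.
by move=> Fn; rewrite -poly_def; apply/polyP => k; rewrite coef_poly;
  case: ltnP => // nk; rewrite nth_default // (leq_trans Fn).
Qed.

Lemma poly_triangular_expansion (F : nat -> {poly C}) (n : nat) (G : {poly C}) :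
  (forall M, size (F M) = M.+1) -> (size G <= n)%N ->
  exists c : nat -> C, G = \sum_(M < n) c M *: F M.
Proof.
move=> sF; elim: n G => [|n IH] G Gn.
  by exists (fun=> 0); rewrite big_ord0; apply/eqP; rewrite -size_poly_eq0 -leqn0.
have Fn0 : (F n)`_n != 0.
  by have := lead_coef_eq0 (F n); rewrite lead_coefE sF /= -size_poly_eq0 sF => ->.
pose a := G`_n / (F n)`_n.
have /IH[c Hc] : (size (G - a *: F n)%R <= n)%N.
  apply/leq_sizeP => j; rewrite leq_eqVlt => /predU1P[<-|nj].
    by rewrite coefB coefZ /a divfK // subrr.
  rewrite coefB coefZ (nth_default _ (leq_trans Gn nj)).
  by rewrite (nth_default _ (_ : size (F n) <= j)%N) ?sF // mulr0 subr0.
exists (fun M => if (M < n)%N then c M else a).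
rewrite big_ord_recr /= ltnn -[G in LHS](subrK (a *: F n)) Hc; congr +%R.
by apply: eq_bigr => M _; rewrite ltn_ord.
Qed.

Variables (p q : nat).
Hypothesis K_shift : forall i j, K (i + p) j = K i (j + q).

Lemma pairing_shift (F G : {poly C}) : pairing ('X^p * F) G = pairing F ('X^q * G).
Proof.
have XE n (H : {poly C}) : 'X^n * H = \sum_(i < size H) H`_i *: 'X^(n + i).
  rewrite [in LHS](poly_sumXn (leqnn (size H))) mulr_sumr.
  by apply: eq_bigr => i _; rewrite -scalerAr exprD.
rewrite !XE [in LHS](poly_sumXn (leqnn (size G))) [in RHS](poly_sumXn (leqnn (size F))).
rewrite !pairing_suml; apply: eq_bigr => i _; congr *%R.
rewrite !pairing_sumr; apply: eq_bigr => j _; congr *%R.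
by rewrite !pairingXX addnC K_shift addnC.
Qed.

Variables (A B : nat -> {poly C}).
Hypothesis sA : forall N, (size (A N) <= N.+1)%N.
Hypothesis sB : forall N, (size (B N) <= N.+1)%N.
Hypothesis A_orth : forall N k, (k < N)%N -> pairing (A N) 'X^k = 0.
Hypothesis B_orth : forall N k, (k < N)%N -> pairing 'X^k (B N) = 0.

Local Notation h N := ((B N)`_N).
Local Notation g N := (pairing (A N) 'X^N).
Hypothesis h_neq0 : forall N, h N != 0.
Hypothesis g_neq0 : forall N, g N != 0.

Lemma pairing_lt_r (M : nat) (F : {poly C}) : (size F <= M)%N -> pairing (A M) F = 0.
Proof.
move=> sF; rewrite (poly_sumXn sF) pairing_sumr big1 // => i _.
by rewrite A_orth ?mulr0.
Qed.

Lemma pairing_lt_l (N : nat) (F : {poly C}) : (size F <= N)%N -> pairing F (B N) = 0.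
Proof.
move=> sF; rewrite (poly_sumXn sF) pairing_suml big1 // => i _.
by rewrite B_orth ?mulr0.
Qed.

(** Off the diagonal the factor of smaller degree is annihilated by the orthogonality of the other
    one. On the diagonal only the leading term of [B N] survives. *)
Lemma pairing_biorth (M N : nat) :
  pairing (A M) (B N) = if M == N then h N * g N else 0.
Proof.
case: eqP => [->|/eqP]; last first.
  rewrite neq_ltn => /orP[MN|NM].
    exact/pairing_lt_l/(leq_trans (sA M)).
  exact/pairing_lt_r/(leq_trans (sB N)).
rewrite {1}(poly_sumXn (sB N)) pairing_sumr big_ord_recr big1 /= ?add0r //.
by move=> i _; rewrite A_orth ?mulr0.
Qed.

Lemma size_B (N : nat) : size (B N) = N.+1.
Proof.
apply/eqP; rewrite eqn_leq sB /= ltnNge; apply/negP => sN.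
by have := h_neq0 N; rewrite nth_default ?eqxx.
Qed.

Lemma size_A (N : nat) : size (A N) = N.+1.
Proof.
apply/eqP; rewrite eqn_leq sA /= ltnNge; apply/negP => sN.
have := pairing_biorth N N; rewrite eqxx pairing_lt_l // => /esym/eqP.
by rewrite mulf_eq0 (negPf (h_neq0 N)) (negPf (g_neq0 N)).
Qed.

(** Both recurrences use this one matrix, the second through its transpose; [pairing_shift] makes
    the two expansions agree. *)
Definition recurrence_coef (N M : nat) : C :=
  (h N * g M)^-1 * pairing (A M) ('X^q * B N).

Let size_XnM (n m : nat) (F : {poly C}) :
  (size F <= m)%N -> (size ('X^n * F)%R <= m + n)%N.
Proof.
move=> sF; rewrite (leq_trans (size_polyMleq _ _)) // size_polyXn addSn /=.
by rewrite addnC leq_add2r.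
Qed.

(** By biorthogonality, pairing the expansion with [A M] isolates the coefficient of index M. *)
Lemma recurrence_B_sum (N : nat) :
  (h N)^-1 *: ('X^q * B N) =
  \sum_(M < (N + q).+1) recurrence_coef N M *: ((h M)^-1 *: B M).
Proof.
have [c Hc] := poly_triangular_expansion size_B (size_XnM q (sB N)).
rewrite addSn in Hc.
rewrite {1}Hc scaler_sumr; apply: eq_bigr => M _; rewrite !scalerA; congr (_ *: _).
rewrite /recurrence_coef Hc pairing_sumr.
rewrite (bigD1 M) //= big1 ?addr0; last first.
  by move=> i iM; rewrite pairing_biorth eq_sym (negPf iM : (i == M :> nat) = false) mulr0.
rewrite pairing_biorth eqxx.
by field; rewrite !h_neq0 g_neq0.
Qed.

Lemma recurrence_A_sum (N : nat) :
  (g N)^-1 *: ('X^p * A N) =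
  \sum_(M < (N + p).+1) recurrence_coef M N *: ((g M)^-1 *: A M).
Proof.
have [c Hc] := poly_triangular_expansion size_A (size_XnM p (sA N)).
rewrite addSn in Hc.
rewrite {1}Hc scaler_sumr; apply: eq_bigr => M _; rewrite !scalerA; congr (_ *: _).
rewrite /recurrence_coef -pairing_shift Hc pairing_suml.
rewrite (bigD1 M) //= big1 ?addr0; last first.
  by move=> i iM; rewrite pairing_biorth (negPf iM : (i == M :> nat) = false) mulr0.
rewrite pairing_biorth eqxx.
by field; rewrite h_neq0 !g_neq0.
Qed.

(** The terms with M + p < N vanish because their coefficient is also a multiple of K ('X^p A_M,
    B_N), whose left factor has degree below N. *)
Lemma recurrence_B (N : nat) :
  (h N)^-1 *: ('X^q * B N) =
  \sum_(k <- int_range p q | 0 <= N%:Z + k)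
    recurrence_coef N (absz (N%:Z + k)) *:
    ((h (absz (N%:Z + k)))^-1 *: B (absz (N%:Z + k))).
Proof.
rewrite (sum_int_range q (f := fun M => recurrence_coef N M *: ((h M)^-1 *: B M))).
  exact: recurrence_B_sum.
move=> M MN; rewrite /recurrence_coef -pairing_shift [X in _ * X]pairing_lt_l ?mulr0 ?scale0r //.
by rewrite (leq_trans (size_XnM p (sA M))) // addSn.
Qed.

(** Here the terms with M + q < N vanish without the shift: 'X^q B_M has degree below N and is
    orthogonal to A_N. *)
Lemma recurrence_A (N : nat) :
  (g N)^-1 *: ('X^p * A N) =
  \sum_(k <- int_range q p | 0 <= N%:Z + k)
    recurrence_coef (absz (N%:Z + k)) N *:
    ((g (absz (N%:Z + k)))^-1 *: A (absz (N%:Z + k))).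
Proof.
rewrite (sum_int_range p (f := fun M => recurrence_coef M N *: ((g M)^-1 *: A M))).
  exact: recurrence_A_sum.
move=> M MN; rewrite /recurrence_coef [X in _ * X]pairing_lt_r ?mulr0 ?scale0r //.
by rewrite (leq_trans (size_XnM q (sB M))) // addSn.
Qed.

(** The normalized B_M are monic of degree M, so in degree N + q only the last term of the expansion
    contributes. *)
Lemma recurrence_coef_lead (N : nat) : recurrence_coef N (N + q) = 1.
Proof.
have /(congr1 (fun F : {poly C} => F`_(N + q))) := recurrence_B_sum N.
rewrite coefZ coefXnM ltnNge leq_addl /= addnK mulVf // coef_sum big_ord_recr /=.
rewrite big1 ?add0r => [|M _]; first by rewrite !coefZ mulVf // mulr1.
by rewrite !coefZ (nth_default _ (_ : size (B M) <= N + q)%N) ?mulr0 // size_B.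
Qed.

End Biorthogonality.

(** * Step-line forms as single polynomials *)

Lemma step_lineS (d N : nat) (hd : (0 < d)%N) (i : 'I_d) :
  step_line N.+1 i = (step_line N i + (i == chi hd N))%N.
Proof.
rewrite /step_line divnS // modnS -val_eqE /=.
have idx := ltn_ord i; have mN := ltn_pmod N hd.
case: ifPn => dN /=.
  rewrite ?ltn0; have mE : (N %% d).+1 = d.
    apply/eqP; rewrite eqn_leq mN /=.
    by apply: dvdn_leq => //; rewrite /dvdn -addn1 modnDml addn1 (eqP dN).
  by case: (ltngtP (i : nat) (N %% d)) => h; lia.
by case: (ltngtP (i : nat) (N %% d)) => h; lia.
Qed.

Lemma step_line_chi (d N : nat) (hd : (0 < d)%N) :
  step_line N (chi hd N) = (N %/ d)%N.
Proof. by rewrite /step_line /= ltnn addn0. Qed.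

(** The pairs (i, u) below the step line are enumerated by u * d + i; this is the bijection behind
    [flat]. *)
Lemma ltn_step_line (d N u : nat) (i : 'I_d) :
  (u < step_line N i)%N = (u * d + i < N)%N.
Proof.
have hd : (0 < d)%N by case: d i => [[]|].
elim: N => [|N IH]; first by rewrite /step_line div0n mod0n !ltn0.
rewrite (step_lineS N hd) [in RHS]ltnS [in RHS]leq_eqVlt -IH -val_eqE /=.
case: eqP => [iN|iN].
  have -> : step_line N i = (N %/ d)%N by rewrite -(step_line_chi N hd); congr step_line; exact: val_inj.
  rewrite {2}(divn_eq N d) -iN eqn_add2r eqn_pmul2r // addn1 ltnS leq_eqVlt.
  by [].
rewrite addn0 (_ : (u * d + i == N)%N = false) //.
by apply/eqP => h; apply: iN; rewrite -h modnMDl modn_small.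
Qed.

Lemma big_step_line (V : Type) (idx : V) (op : Monoid.com_law idx) (d N : nat)
    (hd : (0 < d)%N) (F : 'I_d -> nat -> V) :
  \big[op/idx]_(i < d) \big[op/idx]_(k < step_line N i) F i k =
  \big[op/idx]_(l < N) F (chi hd l) (l %/ d)%N.
Proof.
elim: N => [|N IH].
  rewrite big_ord0 big1 // => i _.
  by rewrite /step_line div0n mod0n ltn0 big_ord0.
rewrite big_ord_recr -IH /= -(step_line_chi N hd).
rewrite (bigD1 (chi hd N)) //= [in RHS](bigD1 (chi hd N)) //=.
rewrite (step_lineS N hd) eqxx addn1 big_ord_recr /=.
rewrite [in RHS]Monoid.mulmAC; congr (op _ _).
apply: eq_bigr => i iN.
by rewrite (step_lineS N hd) (negPf iN) addn0.
Qed.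

(* Multiplication by x raises the index k = u * d + i of the coefficient of x ^ u in
   the i-th component by d, that is, it becomes multiplication by 'X^d. *)
Definition flat (C : nzRingType) (d N : nat) (hd : (0 < d)%N) (A : 'I_d -> {poly C}) : {poly C} :=
  \poly_(k < N.+1) (A (chi hd k))`_(k %/ d).

Lemma sum_size_widen (C : nzRingType) (V : nmodType) (n : nat) (P : {poly C}) (f : C -> nat -> V) :
  (size P <= n)%N -> (forall k, f 0 k = 0) ->
  \sum_(u < size P) f P`_u u = \sum_(u < n) f P`_u u.
Proof.
move=> sP f0; rewrite (big_ord_widen n (fun u => f P`_u u)) // big_mkcond.
by apply: eq_bigr => u _; case: ltnP => // h; rewrite nth_default.
Qed.

(** The general summand f serves power forms, weight forms and sums of moments alike. Since f
    vanishes at the coefficient 0, padding each component up to the step line changes nothing. *)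
Lemma sum_flat (C : nzRingType) (V : nmodType) (d N : nat) (hd : (0 < d)%N)
    (A : 'I_d -> {poly C}) (f : 'I_d -> C -> nat -> V) :
  (forall i, (size (A i) <= step_line N.+1 i)%N) ->
  (forall i k, f i 0 k = 0) ->
  \sum_(i < d) \sum_(u < size (A i)) f i (A i)`_u u =
  \sum_(k < N.+1) f (chi hd k) (flat N hd A)`_k (k %/ d)%N.
Proof.
move=> sA f0.
transitivity (\sum_(i < d) \sum_(u < step_line N.+1 i) f i (A i)`_u u).
  by apply: eq_bigr => i _; exact: sum_size_widen.
rewrite (big_step_line _ _ hd (fun i u => f i (A i)`_u u)).
by apply: eq_bigr => k _; rewrite coef_poly ltn_ord.
Qed.

Lemma chiD (d : nat) (hd : (0 < d)%N) (k : nat) : chi hd (k + d) = chi hd k.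
Proof. by apply: val_inj; rewrite /= modnDr. Qed.

(** The linear functional with value [psi k] at 'X^k, written as a pairing with 1 so that its
    linearity is inherited. *)
Definition poly_eval (C : fieldType) (psi : nat -> C) (F : {poly C}) : C :=
  pairing (fun _ j => psi j) 1 F.

Lemma poly_eval_widen (C : fieldType) (psi : nat -> C) n (F : {poly C}) :
  (size F <= n)%N -> poly_eval psi F = \sum_(k < n) F`_k * psi k.
Proof.
move=> sF; rewrite /poly_eval (@pairing_widen _ _ 1 n) ?size_poly1 // big_ord1.
by apply: eq_bigr => k _; rewrite coefC mul1r.
Qed.

Lemma poly_evalZ (C : fieldType) (psi : nat -> C) (c : C) (F : {poly C}) :
  poly_eval psi (c *: F) = c * poly_eval psi F.
Proof. by rewrite /poly_eval linearZ. Qed.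

Lemma poly_eval_sum (C : fieldType) (psi : nat -> C) I (r : seq I) (P : pred I)
    (F : I -> {poly C}) :
  poly_eval psi (\sum_(i <- r | P i) F i) = \sum_(i <- r | P i) poly_eval psi (F i).
Proof. exact: linear_sum. Qed.

Lemma poly_eval_shift (C : fieldType) (psi : nat -> C) (q : nat) (x : C) (F : {poly C}) :
  (forall k, psi (k + q)%N = x * psi k) ->
  poly_eval psi ('X^q * F) = x * poly_eval psi F.
Proof.
move=> psiq; rewrite (poly_eval_widen psi (leqnn (size F))).
rewrite (@poly_eval_widen _ _ (q + size F)); last first.
  by rewrite (leq_trans (size_polyMleq _ _)) // size_polyXn.
rewrite big_split_ord /= big1 ?add0r => [|i _]; last by rewrite coefXnM ltn_ord mul0r.
rewrite mulr_sumr; apply: eq_bigr => i _.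
by rewrite coefXnM ltnNge leq_addr /= addKn addnC psiq mulrCA.
Qed.

(** * The recurrence for forms with a prescribed moment matrix *)

Section StepLineForms.
Variables (R : realType) (p q : nat) (hp : (0 < p)%N) (hq : (0 < q)%N).
Local Notation C := (R[i]).
Variables (e : 'I_p -> R) (w : 'I_q -> R -> R) (m : 'I_q -> R -> R).

(** [m j s] stands for the integral of x ^ (s - 1) against the j-th weight, hence the final 1 in the
    argument. *)
Definition moment_matrix (i j : nat) : C :=
  (m (chi hq j) (e (chi hp i) + (i %/ p)%:R + (j %/ q)%:R + 1))%:C.

Lemma moment_matrix_shift i j : moment_matrix (i + p) j = moment_matrix i (j + q).
Proof.
rewrite /moment_matrix !chiD !divnDr ?dvdnn // !divnn hp hq !natrD.
by congr ((m _ _)%:C); ring.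
Qed.

Lemma power_form_flat (N : nat) (A : 'I_p -> {poly C}) (x : R) :
  (forall i, (size (A i) <= step_line N.+1 i)%N) ->
  power_form e A x =
  poly_eval (fun k => (x ^+ (k %/ p) * x `^ e (chi hp k))%:C) (flat N hp A).
Proof.
move=> sA; rewrite (@poly_eval_widen _ _ N.+1) ?size_poly //.
rewrite -(sum_flat hp sA (f := fun i c u => c * (x ^+ u * x `^ e i)%:C)); last first.
  by move=> i k; rewrite mul0r.
apply: eq_bigr => i _; rewrite horner_coef mulr_suml; apply: eq_bigr => u _.
by rewrite rmorphM rmorphXn mulrA.
Qed.

Lemma weight_form_flat (N : nat) (B : 'I_q -> {poly C}) (x : R) :
  (forall j, (size (B j) <= step_line N.+1 j)%N) ->
  weight_form w B x =
  poly_eval (fun k => (x ^+ (k %/ q) * w (chi hq k) x)%:C) (flat N hq B).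
Proof.
move=> sB; rewrite (@poly_eval_widen _ _ N.+1) ?size_poly //.
rewrite -(sum_flat hq sB (f := fun j c u => c * (x ^+ u * w j x)%:C)); last first.
  by move=> i k; rewrite mul0r.
apply: eq_bigr => i _; rewrite horner_coef mulr_suml; apply: eq_bigr => u _.
by rewrite rmorphM rmorphXn mulrA.
Qed.

Variables (A : nat -> 'I_p -> {poly C}) (B : nat -> 'I_q -> {poly C}).
Hypothesis sA : forall N i, (size (A N i) <= step_line N.+1 i)%N.
Hypothesis sB : forall N j, (size (B N j) <= step_line N.+1 j)%N.

Let FA N := flat N hp (A N).
Let FB N := flat N hq (B N).

(** Of the 2 in the argument, one unit is the Mellin normalization and the other is the factor x
    that 'X^q represents. *)
Lemma pairing_flat_shift (N M : nat) :
  pairing moment_matrix (FA M) ('X^q * FB N) =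
  \sum_(i < p) \sum_(j < q) \sum_(u < size (A M i)) \sum_(v < size (B N j))
    (A M i)`_u * (B N j)`_v * (m j (e i + u%:R + v%:R + 2))%:C.
Proof.
rewrite (@pairing_widen _ _ M.+1 (q + N.+1)%N) ?size_poly //; last first.
  rewrite (leq_trans (size_polyMleq _ _)) // size_polyXn addSn /= leq_add2l.
  exact: size_poly.
under [RHS]eq_bigr do rewrite exchange_big /=.
rewrite (sum_flat hp (sA M) (f := fun i c u => \sum_(j < q) \sum_(v < size (B N j))
    c * (B N j)`_v * (m j (e i + u%:R + v%:R + 2))%:C)); last first.
  by move=> i k; rewrite big1 // => j _; rewrite big1 // => v _; rewrite !mul0r.
apply: eq_bigr => k _.
rewrite (sum_flat hq (sB N) (f := fun j c v => (FA M)`_k * c *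
    (m j (e (chi hp k) + (k %/ p)%:R + v%:R + 2))%:C)); last first.
  by move=> i l; rewrite mulr0 mul0r.
rewrite big_split_ord /= big1 ?add0r => [|i _]; last first.
  by rewrite coefXnM ltn_ord mulr0 mul0r.
apply: eq_bigr => l _; rewrite coefXnM ltnNge leq_addr /= addKn; congr (_ * _).
rewrite /moment_matrix (addnC q l) chiD divnDr ?dvdnn // divnn hq natrD.
by congr ((m _ _)%:C); rewrite /=; ring.
Qed.

Lemma flat_lead (N : nat) :
  (FB N)`_N = (B N (chi hq N))`_(step_line N.+1 (chi hq N)).-1.
Proof. by rewrite coef_poly leqnn (step_lineS N hq) eqxx addn1 step_line_chi. Qed.

Hypothesis A_orth : forall N k, (k < N)%N -> pairing moment_matrix (FA N) 'X^k = 0.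
Hypothesis B_orth : forall N k, (k < N)%N -> pairing moment_matrix 'X^k (FB N) = 0.
Variables (h g : nat -> C) (P : nat -> nat -> C) (Af : nat -> R -> C)
  (b : nat -> int -> C).
Hypothesis hE : forall N, h N = (B N (chi hq N))`_(step_line N.+1 (chi hq N)).-1.
Hypothesis gE : forall N, g N = pairing moment_matrix (FA N) 'X^N.
Hypothesis h_neq0 : forall N, h N != 0.
Hypothesis g_neq0 : forall N, g N != 0.
Hypothesis PE : forall N M, P N M = (h N * g M)^-1 *
  \sum_(i < p) \sum_(j < q) \sum_(u < size (A M i)) \sum_(v < size (B N j))
    (A M i)`_u * (B N j)`_v * (m j (e i + u%:R + v%:R + 2))%:C.
Hypothesis bE : forall N k, b N k = P N (absz (N%:Z + k)).
Hypothesis AfE : forall N x, 0 < x -> Af N x = power_form e (A N) x.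

(** Common to both families, which differ in their moments and in the proofs of orthogonality. The
    polynomial recurrences are turned into identities of functions by [poly_eval] at each x. *)
Lemma step_line_recurrence (N : nat) :
  [/\ forall x : R, 0 < x ->
        x%:C * (weight_form w (B N) x / h N) =
        \sum_(k <- int_range p q | 0 <= N%:Z + k)
          b N k *
          (weight_form w (B (absz (N%:Z + k))) x / h (absz (N%:Z + k))),
      forall x : R, 0 < x ->
        x%:C * (Af N x / g N) =
        \sum_(k <- int_range q p | 0 <= N%:Z + k)
          b (absz (N%:Z + k)) (- k) *
          (Af (absz (N%:Z + k)) x / g (absz (N%:Z + k))) &
      b N q%:Z = 1].
Proof.
have sFA n : (size (FA n) <= n.+1)%N by exact: size_poly.
have sFB n : (size (FB n) <= n.+1)%N by exact: size_poly.
have hF n : h n = (FB n)`_n by rewrite hE flat_lead.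
have hF0 n : (FB n)`_n != 0 by rewrite -hF.
have gF0 n : pairing moment_matrix (FA n) 'X^n != 0 by rewrite -gE.
have PF n n' : P n n' = recurrence_coef moment_matrix q FA FB n n'.
  by rewrite PE /recurrence_coef pairing_flat_shift hF gE.
split=> [x x0|x x0|].
- have := recurrence_B moment_matrix_shift sFA sFB A_orth B_orth hF0 gF0 N.
  move/(congr1 (poly_eval (fun k => (x ^+ (k %/ q) * w (chi hq k) x)%:C))).
  rewrite poly_eval_sum poly_evalZ (poly_eval_shift (x := x%:C)); last first.
    move=> k; rewrite chiD divnDr ?dvdnn // divnn hq addn1 exprS -mulrA.
    by rewrite rmorphM.
  rewrite -weight_form_flat // -hF => E.
  transitivity ((h N)^-1 * (x%:C * weight_form w (B N) x)); first by rewrite mulrA mulrC.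
  rewrite E; apply: eq_bigr => k _.
  by rewrite !poly_evalZ -weight_form_flat // bE PF hF [_^-1 * _]mulrC.
- have := recurrence_A moment_matrix_shift sFA sFB A_orth B_orth hF0 gF0 N.
  move/(congr1 (poly_eval (fun k => (x ^+ (k %/ p) * x `^ e (chi hp k))%:C))).
  rewrite poly_eval_sum poly_evalZ (poly_eval_shift (x := x%:C)); last first.
    move=> k; rewrite chiD divnDr ?dvdnn // divnn hp addn1 exprS -mulrA.
    by rewrite rmorphM.
  rewrite -power_form_flat // -gE => E.
  transitivity ((g N)^-1 * (x%:C * Af N x)); first by rewrite mulrA mulrC.
  rewrite AfE // E; apply: eq_bigr => k k0.
  rewrite !poly_evalZ -power_form_flat // -AfE // bE PF gE [_^-1 * _]mulrC.
  (* The row index is N + k, so the column index N + k - k is N again; this needs 0 <= N + k. *)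
  by congr (recurrence_coef _ _ _ _ _ _ * _); lia.
- rewrite bE (_ : absz (N%:Z + q%:Z) = (N + q)%N) // PF.
  exact: (recurrence_coef_lead q sFA sFB A_orth B_orth hF0 gF0).
Qed.

End StepLineForms.

(** * Moments *)

Section ComplexIntegral.
Variable R : realType.
Local Notation C := (R[i]).
Local Notation mu := (@lebesgue_measure R).

Lemma ReD (x y : C) : complex.Re (x + y) = complex.Re x + complex.Re y.
Proof. by case: x y => [? ?] [? ?]. Qed.
Lemma ImD (x y : C) : complex.Im (x + y) = complex.Im x + complex.Im y.
Proof. by case: x y => [? ?] [? ?]. Qed.
Lemma ReMr (x : C) (r : R) : complex.Re (x * r%:C) = complex.Re x * r.
Proof. by case: x => [? ?] /=; rewrite mulr0 subr0. Qed.
Lemma ImMr (x : C) (r : R) : complex.Im (x * r%:C) = complex.Im x * r.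
Proof. by case: x => [? ?] /=; rewrite mulr0 add0r. Qed.

Lemma eq_cintegral (D : set R) (f g : R -> C) :
  (forall x, D x -> f x = g x) -> cintegral D f = cintegral D g.
Proof.
by move=> fg; rewrite /cintegral; congr (_ +i* _); apply: eq_Rintegral => x /set_mem Dx;
  rewrite fg.
Qed.

Lemma Rintegral_sum (D : set R) (I : Type) (r : seq I) (c : I -> R) (phi : I -> R -> R) :
  measurable (D : set (measurableTypeR R)) ->
  (forall i, mu.-integrable D (EFin \o phi i)) ->
  mu.-integrable D (EFin \o (fun x => \sum_(i <- r) c i * phi i x)) /\
  \int[mu]_(x in D) (\sum_(i <- r) c i * phi i x) =
  \sum_(i <- r) c i * \int[mu]_(x in D) phi i x.
Proof.
move=> mD iphi; elim: r => [|i r [IH1 IH2]].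
  rewrite big_nil; split.
    by apply: (eq_integrable mD (cst 0%E) _ _ (integrable0 mu D)) => x _; rewrite /= big_nil.
  under eq_Rintegral do rewrite big_nil.
  by rewrite Rintegral_cst // mul0r.
have i1 : mu.-integrable D (EFin \o (fun x => c i * phi i x)).
  by apply: (eq_integrable mD _ _ _ (integrableZl mD (c i) (iphi i))).
split.
  apply: (eq_integrable mD _ _ _ (integrableD mD i1 IH1)) => x _.
  by rewrite /= big_cons.
under eq_Rintegral do rewrite big_cons.
by rewrite RintegralD // IH2 big_cons RintegralZl.
Qed.

Lemma cintegral_lincomb (D : set R) (n : nat) (c : 'I_n -> C) (phi : 'I_n -> R -> R) :
  measurable (D : set (measurableTypeR R)) -> (forall i, mu.-integrable D (EFin \o phi i)) ->
  cintegral D (fun x => \sum_(i < n) c i * (phi i x)%:C) =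
  \sum_(i < n) c i * (\int[mu]_(x in D) phi i x)%:C.
Proof.
move=> mD iphi; apply/eqP; rewrite eq_complex /=.
have ReS r (F : 'I_n -> C) : complex.Re (\sum_(i <- r) F i) = \sum_(i <- r) complex.Re (F i).
  by elim: r => [|i r IH]; rewrite ?big_nil ?big_cons ?ReD ?IH.
have ImS r (F : 'I_n -> C) : complex.Im (\sum_(i <- r) F i) = \sum_(i <- r) complex.Im (F i).
  by elim: r => [|i r IH]; rewrite ?big_nil ?big_cons ?ImD ?IH.
rewrite ReS ImS.
under eq_bigr do rewrite ReMr.
under [X in _ && (_ == X)]eq_bigr do rewrite ImMr.
rewrite -!(Rintegral_sum _ _ mD iphi).2.
by apply/andP; split; apply/eqP; apply: eq_Rintegral => x _; rewrite ?ReS ?ImS;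
  apply: eq_bigr => i _; rewrite ?ReMr ?ImMr.
Qed.

Lemma cpow_real (x r : R) : cpow x r%:C = (x `^ r)%:C.
Proof. by rewrite /cpow /= mul0r cos0 sin0 mulr1. Qed.

End ComplexIntegral.

Section Moments.
Variables (R : realType) (p q : nat) (hp : (0 < p)%N) (hq : (0 < q)%N).
Local Notation C := (R[i]).
Local Notation mu := (@lebesgue_measure R).
Local Notation D := (`]0%R, +oo[%classic : set R).
Variables (e : 'I_p -> R) (w : 'I_q -> R -> R) (m : 'I_q -> R -> R).
Variable dom : R -> Prop.
Hypothesis e_dom : forall i (k : nat), dom (e i + k%:R + 1).
Hypothesis w_int : forall j s, dom s ->
  mu.-integrable D (EFin \o (fun x => x `^ (s - 1) * w j x)).
Hypothesis w_mom : forall j s, dom s ->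
  \int[mu]_(x in D) (x `^ (s - 1) * w j x) = m j s.

Lemma cintegral_powers_weight (n k : nat) (j : 'I_q) (c : 'I_n -> C) (t : 'I_n -> R) :
  (forall l, dom (t l + k%:R + 1)) ->
  cintegral D (fun x => (x ^+ k)%:C * (\sum_(l < n) c l * (x `^ t l)%:C) * (w j x)%:C) =
  \sum_(l < n) c l * (m j (t l + k%:R + 1))%:C.
Proof.
move=> ht.
under [RHS]eq_bigr => l _ do rewrite -(w_mom j (ht l)).
rewrite -cintegral_lincomb //; last by move=> l; exact: w_int.
apply: eq_cintegral => x /=; rewrite in_itv /= andbT => x0.
rewrite mulr_sumr mulr_suml; apply: eq_bigr => l _.
rewrite addrK powRD ?powR_mulrn ?(ltW x0) ?(gt_eqF x0) ?implybT // !rmorphM /=.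
by ring.
Qed.

Lemma pairing_A_integral (N n : nat) (A : 'I_p -> {poly C}) :
  (forall i, (size (A i) <= step_line N.+1 i)%N) ->
  pairing (moment_matrix hp hq e m) (flat N hp A) 'X^n =
  cintegral D (fun x => (x ^+ (n %/ q))%:C * power_form e A x * (w (chi hq n) x)%:C).
Proof.
move=> sA.
rewrite (@eq_cintegral _ _ _ (fun x => (x ^+ (n %/ q))%:C *
   (\sum_(l < N.+1) (flat N hp A)`_l * (x `^ (e (chi hp l) + (l %/ p)%:R))%:C) *
   (w (chi hq n) x)%:C)); last first.
  move=> x /=; rewrite in_itv /= andbT => x0.
  rewrite (power_form_flat hp _ _ sA) (@poly_eval_widen _ _ N.+1) ?size_poly //.
  congr (_ * _ * _); apply: eq_bigr => l _.
  by rewrite powRD ?powR_mulrn ?(ltW x0) ?(gt_eqF x0) ?implybT // [x `^ _ * _]mulrC.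
rewrite cintegral_powers_weight; last by move=> l; rewrite -(addrA (e _)) -natrD; exact: e_dom.
rewrite [in LHS](@poly_sumXn _ N.+1 (flat N hp A)) ?size_poly // pairing_suml.
by apply: eq_bigr => l _; rewrite pairingXX.
Qed.

(** This brings in the prescribed Mellin transform of the B-form, at a point where its Pochhammer
    factor vanishes as soon as n < N. *)
Lemma pairing_B_mellin (N n : nat) (B : 'I_q -> {poly C}) :
  (forall j, (size (B j) <= step_line N.+1 j)%N) ->
  pairing (moment_matrix hp hq e m) 'X^n (flat N hq B) =
  mellin (weight_form w B) (e (chi hp n) + (n %/ p)%:R + 1)%:C.
Proof.
move=> sB.
pose t (l : 'I_N.+1) := e (chi hp n) + (n %/ p)%:R + (l %/ q)%:R + 1.
have ht l : dom (t l) by rewrite /t -(addrA (e _)) -natrD; exact: e_dom.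
rewrite /mellin (@eq_cintegral _ _ _ (fun x =>
   \sum_(l < N.+1) (flat N hq B)`_l * (x `^ (t l - 1) * w (chi hq l) x)%:C)); last first.
  move=> x /=; rewrite in_itv /= andbT => x0.
  rewrite (weight_form_flat hq _ _ sB) (@poly_eval_widen _ _ N.+1) ?size_poly //.
  rewrite -(rmorphB (real_complex R) _ 1) cpow_real addrK mulr_sumr; apply: eq_bigr => l _.
  rewrite /t addrK.
  rewrite [in RHS]powRD ?powR_mulrn ?(ltW x0) ?(gt_eqF x0) ?implybT // !rmorphM /=.
  by ring.
rewrite cintegral_lincomb //; last by move=> l; exact: w_int.
rewrite [in LHS](@poly_sumXn _ N.+1 (flat N hq B)) ?size_poly // pairing_sumr.
by apply: eq_bigr => l _; rewrite pairingXX w_mom.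
Qed.

End Moments.

(** * Calculus of complex-valued functions *)

Import ComplexField.Normc.

Section ComplexNorm.
Variable R : realType.
Local Notation C := (R[i]).
Implicit Types x y z : C.

Lemma normcD_le x y : normc (x + y) <= normc x + normc y.
Proof. exact: (@le_normcD R). Qed.
Lemma normcNE x : normc (- x) = normc x.
Proof. exact: (@normcN R). Qed.
Lemma normcB_le x y : normc (x - y) <= normc x + normc y.
Proof. by rewrite -(normcNE y) normcD_le. Qed.
Lemma normc_distC x y : normc (x - y) = normc (y - x).
Proof. by rewrite -normcNE opprB. Qed.
Lemma normc_ge0 x : 0 <= normc x.
Proof. by case: x => a b /=; rewrite sqrtr_ge0. Qed.
Lemma normc_gt0 x : (0 < normc x) = (x != 0).
Proof.
rewrite lt_def normc_ge0 andbT; congr (~~ _); apply/eqP/eqP => [/eq0_normc//|->].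
exact: normc0.
Qed.
Lemma normc_real (r : R) : normc r%:C = `|r|.
Proof. by rewrite /= expr0n addr0 sqrtr_sqr. Qed.
Lemma ler_normc_Re x : `|complex.Re x| <= normc x.
Proof. by case: x => a b /=; rewrite -sqrtr_sqr ler_wsqrtr // lerDl sqr_ge0. Qed.
Lemma ler_normc_Im x : `|complex.Im x| <= normc x.
Proof. by case: x => a b /=; rewrite -sqrtr_sqr ler_wsqrtr // lerDr sqr_ge0. Qed.
Lemma normc_le_ReIm x : normc x <= `|complex.Re x| + `|complex.Im x|.
Proof.
case: x => a b; rewrite (_ : a +i* b = a%:C + (0 +i* 1) * b%:C); last first.
  by apply/eqP; rewrite eq_complex /=; apply/andP; split; apply/eqP; ring.
rewrite (le_trans (normcD_le _ _)) // normcM !normc_real /= lerD //.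
  by rewrite !(mulr0, mul0r, addr0, subr0).
by rewrite expr0n expr1n add0r sqrtr1 mul1r !(mulr0, mul0r, addr0, add0r, subr0, mul1r).
Qed.
Lemma normc_sum I (r : seq I) (P : pred I) (F : I -> C) :
  normc (\sum_(i <- r | P i) F i) <= \sum_(i <- r | P i) normc (F i).
Proof.
elim/big_rec2: _ => [|i x y _ h]; first by rewrite normc0.
by rewrite (le_trans (normcD_le _ _)) // lerD2l.
Qed.
Lemma normcX x n : normc (x ^+ n) = normc x ^+ n.
Proof. by elim: n => [|n IH]; rewrite ?expr0 ?normc1 // !exprS normcM IH. Qed.
Lemma ReN x : complex.Re (- x) = - complex.Re x. Proof. by case: x. Qed.
Lemma ImN x : complex.Im (- x) = - complex.Im x. Proof. by case: x. Qed.
Lemma ReM x y : complex.Re (x * y) = complex.Re x * complex.Re y - complex.Im x * complex.Im y.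
Proof. by case: x y => [? ?] [? ?]. Qed.
Lemma ImM x y : complex.Im (x * y) = complex.Re x * complex.Im y + complex.Im x * complex.Re y.
Proof. by case: x y => [? ?] [? ?]. Qed.
Lemma ReV x : complex.Re x^-1 = complex.Re x / (complex.Re x ^+ 2 + complex.Im x ^+ 2).
Proof. by case: x. Qed.
Lemma ImV x : complex.Im x^-1 = - complex.Im x / (complex.Re x ^+ 2 + complex.Im x ^+ 2).
Proof. by case: x => a b /=; rewrite mulNr. Qed.
Lemma sqr_ReIm_neq0 x : x != 0 -> complex.Re x ^+ 2 + complex.Im x ^+ 2 != 0.
Proof.
case: x => a b; rewrite eq_complex /= negb_and => ab.
by rewrite paddr_eq0 ?sqr_ge0 // !sqrf_eq0 negb_and.
Qed.
End ComplexNorm.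

Section ComplexDerivative.
Variable R : realType.
Local Notation C := (R[i]).
Local Notation mu := (@lebesgue_measure R).
Implicit Types (f g : R -> C) (t : R).

(** Derivatives are taken in a real variable only: contours, segments and the half-line are all
    parametrized by reals, so complex differentiability never enters. *)
Definition is_cderive f t (d : C) : Prop :=
  is_derive t (1 : R) (re_part f) (complex.Re d) /\
  is_derive t (1 : R) (im_part f) (complex.Im d).

Definition ccont f t : Prop :=
  {for t, continuous (re_part f)} /\ {for t, continuous (im_part f)}.

Lemma is_cderive_ccont f t d : is_cderive f t d -> ccont f t.
Proof.
by case=> [[h1 _] [h2 _]]; split; apply/differentiable_continuous;
  exact/derivable1_diffP.
Qed.

Lemma ccont_cst c t : ccont (fun=> c) t.
Proof. by split; apply: cst_continuous. Qed.
Lemma ccontD f g t : ccont f t -> ccont g t -> ccont (fun u => f u + g u) t.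
Proof.
move=> [f1 f2] [g1 g2]; split.
  rewrite (_ : re_part _ = re_part f \+ re_part g); first exact: continuousD.
  by apply/funext => u; rewrite /re_part /= ReD.
rewrite (_ : im_part _ = im_part f \+ im_part g); first exact: continuousD.
by apply/funext => u; rewrite /im_part /= ImD.
Qed.
Lemma ccontM f g t : ccont f t -> ccont g t -> ccont (fun u => f u * g u) t.
Proof.
move=> [f1 f2] [g1 g2]; split.
  rewrite (_ : re_part _ = (re_part f \* re_part g) \- (im_part f \* im_part g)).
    by apply: continuousB; apply: continuousM.
  by apply/funext => u; rewrite /re_part /im_part /= ReM.
rewrite (_ : im_part _ = (re_part f \* im_part g) \+ (im_part f \* re_part g)).
  by apply: continuousD; apply: continuousM.
by apply/funext => u; rewrite /re_part /im_part /= ImM.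
Qed.
Lemma ccontV f t : f t != 0 -> ccont f t -> ccont (fun u => (f u)^-1) t.
Proof.
move=> ft0 [f1 f2]; have n0 := sqr_ReIm_neq0 ft0.
have cn : {for t, continuous (fun u => (re_part f u ^+ 2 + im_part f u ^+ 2)^-1)}.
  apply: cvgV => //; apply: cvgD; rewrite expr2; under eq_fun do rewrite expr2;
    exact: cvgM.
split.
  rewrite (_ : re_part _ = re_part f \* (fun u => (re_part f u ^+ 2 + im_part f u ^+ 2)^-1)).
    exact: continuousM.
  by apply/funext => u; rewrite /re_part /im_part /= ReV.
rewrite (_ : im_part _ = (\- im_part f) \* (fun u => (re_part f u ^+ 2 + im_part f u ^+ 2)^-1)).
  by apply: continuousM => //; exact: continuousN.
by apply/funext => u; rewrite /re_part /im_part /= ImV.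
Qed.

Lemma is_cderive_eq f t d d' : is_cderive f t d -> d = d' -> is_cderive f t d'.
Proof. by move=> h <-. Qed.
Lemma is_cderive_cst c t : is_cderive (fun=> c) t 0.
Proof. by split; exact: is_derive_cst. Qed.
Lemma is_cderiveD f g t df dg : is_cderive f t df -> is_cderive g t dg ->
  is_cderive (fun u => f u + g u) t (df + dg).
Proof.
move=> [f1 f2] [g1 g2]; split.
  rewrite (_ : re_part _ = re_part f + re_part g) ?ReD; first exact: is_deriveD.
  by apply/funext => u; rewrite /re_part /= ReD.
rewrite (_ : im_part _ = im_part f + im_part g) ?ImD; first exact: is_deriveD.
by apply/funext => u; rewrite /im_part /= ImD.
Qed.
Lemma is_cderiveM f g t df dg : is_cderive f t df -> is_cderive g t dg ->
  is_cderive (fun u => f u * g u) t (df * g t + f t * dg).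
Proof.
move=> [f1 f2] [g1 g2]; split.
  rewrite (_ : re_part _ = re_part f * re_part g - im_part f * im_part g).
    apply: is_derive_eq; rewrite /re_part /im_part /= ReD !ReM /GRing.scale /=; ring.
  by apply/funext => u; rewrite /re_part /im_part /= ReM.
rewrite (_ : im_part _ = re_part f * im_part g + im_part f * re_part g).
  apply: (is_derive_eq (is_deriveD (is_deriveM f1 g2) (is_deriveM f2 g1))).
  rewrite /re_part /im_part /= ImD !ImM /GRing.scale /=; ring.
by apply/funext => u; rewrite /re_part /im_part /= ImM.
Qed.
Lemma is_cderive_real (n : R -> R) t (dn : R) : is_derive t (1 : R) n dn ->
  is_cderive (fun u => (n u)%:C) t dn%:C.
Proof. by move=> h; split => //; exact: is_derive_cst. Qed.

(** The inverse is the conjugate of f divided by the real function |f|^2, which reduces the claim to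
    the derivative of a real inverse. The identity also holds at zeros of f, where both sides are
    0. *)
Lemma is_cderiveV f t df : f t != 0 -> is_cderive f t df ->
  is_cderive (fun u => (f u)^-1) t (- df / f t ^+ 2).
Proof.
move=> ft0 [f1 f2].
pose n : R -> R := re_part f ^+ 2 + im_part f ^+ 2.
have nt0 : n t != 0 by exact: sqr_ReIm_neq0.
pose dn := 2 * re_part f t * complex.Re df + 2 * im_part f t * complex.Im df.
have dn' : is_derive t (1 : R) n dn.
  rewrite /n !expr2; apply: (is_derive_eq (is_deriveD (is_deriveM f1 f1) (is_deriveM f2 f2))).
  by rewrite /GRing.scale /= /dn; ring.
have dV : is_cderive (fun u => ((n u)^-1)%:C) t (- (n t) ^- 2 *: dn)%:C.
  by apply: is_cderive_real; exact: is_deriveV.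
have dconj : is_cderive (fun u => (f u)^*%C) t (df^*%C).
  have Rc (z : C) : complex.Re z^*%C = complex.Re z by case: z.
  have Ic (z : C) : complex.Im z^*%C = - complex.Im z by case: z.
  split; rewrite ?Rc ?Ic.
    by rewrite (_ : re_part _ = re_part f) //; apply/funext => u; exact: Rc.
  rewrite (_ : im_part _ = - im_part f); first exact: is_deriveN.
  by apply/funext => u; exact: Ic.
have nE u : (n u)%:C = f u * (f u)^*%C.
  rewrite /n; case E : (f u) => [x y] /=; apply/eqP; rewrite eq_complex /=.
  rewrite !fctE /re_part /im_part E /=.
  by apply/andP; split; apply/eqP; ring.
rewrite (_ : (fun u => (f u)^-1) = (fun u => (f u)^*%C * ((n u)^-1)%:C)); last first.
  apply/funext => u; have [fu0|fu0] := eqVneq (f u) 0.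
    by rewrite fu0 invr0 conjc0 mul0r.
  by rewrite fmorphV /= nE; field; rewrite conjc_eq0 fu0.
apply: (is_cderive_eq (is_cderiveM dconj dV)).
have dnE : dn%:C = df * (f t)^*%C + f t * df^*%C.
  rewrite /dn /re_part /im_part; case: (f t) => x y; case: (df) => dx dy /=.
  by apply/eqP; rewrite eq_complex /=; apply/andP; split; apply/eqP; ring.
rewrite /GRing.scale /= !(rmorphM, rmorphN, fmorphV, rmorphXn) /= dnE nE.
by field; rewrite ft0 conjc_eq0.
Qed.

Lemma is_cderiveX f t df n : is_cderive f t df ->
  is_cderive (fun u => f u ^+ n) t (n%:R * f t ^+ n.-1 * df).
Proof.
move=> df_; elim: n => [|n IH].
  by rewrite !mul0r; exact: is_cderive_cst.
rewrite (_ : (fun u => _) = (fun u => f u * f u ^+ n)); last first.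
  by apply/funext => u; rewrite exprS.
apply: (is_cderive_eq (is_cderiveM df_ IH)).
case: n {IH} => [|n] /=; first by rewrite !expr0; ring.
by rewrite exprS -(natr1 n.+1); ring.
Qed.

Lemma cintegral_FTC (F f : R -> C) (a b : R) : a < b ->
  (forall t, a <= t <= b -> is_cderive F t (f t)) ->
  (forall t, a <= t <= b -> ccont f t) ->
  cintegral `[a, b] f = F b - F a.
Proof.
move=> ab dF cf.
have key (G g : R -> R) : (forall t, a <= t <= b -> is_derive t (1 : R) G (g t)) ->
    (forall t, a <= t <= b -> {for t, continuous g}) ->
    \int[mu]_(x in `[a, b]) g x = G b - G a.
  move=> dG cg.
  have cG t : a <= t <= b -> {for t, continuous G}.
    move=> /dG[h _]; apply/differentiable_continuous; exact/derivable1_diffP.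
  rewrite /Rintegral (@continuous_FTC2 _ g G a b) //.
  - apply: continuous_in_subspaceT => x /set_mem /=.
    by rewrite in_itv /=; exact: cg.
  - split=> [x| |].
    + by rewrite in_itv /= => /andP[ax xb]; have [] := dG x; rewrite ?(ltW ax) ?(ltW xb).
    + by apply: cvg_at_right_filter; apply: cG; rewrite lexx ltW.
    + by apply: cvg_at_left_filter; apply: cG; rewrite lexx ltW.
  - move=> x; rewrite in_itv /= => /andP[ax xb].
    rewrite derive1E; have h := dG x; apply: derive_val; apply: h.
    by rewrite !ltW.
have kRe := key (re_part F) (re_part f) (fun t ht => (dF t ht).1) (fun t ht => (cf t ht).1).
have kIm := key (im_part F) (im_part f) (fun t ht => (dF t ht).2) (fun t ht => (cf t ht).2).
rewrite /cintegral -/(re_part f) -/(im_part f) kRe kIm.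
by rewrite /re_part /im_part; case: (F a) => ? ?; case: (F b).
Qed.

End ComplexDerivative.

(** * Contour integrals of rational functions *)

Section ComplexIntegrable.
Variable R : realType.
Local Notation C := (R[i]).
Local Notation mu := (@lebesgue_measure R).
Variable D : set R.
Hypothesis mD : measurable (D : set (measurableTypeR R)).
Implicit Types (f g : R -> C).

Definition cintegrable f : Prop :=
  mu.-integrable D (EFin \o re_part f) /\ mu.-integrable D (EFin \o im_part f).

Lemma eq_cintegrable f g : (forall x, D x -> f x = g x) -> cintegrable f -> cintegrable g.
Proof.
move=> fg [f1 f2]; split; [apply: eq_integrable f1|apply: eq_integrable f2] => // x /set_mem Dx;
  by rewrite /= /re_part /im_part fg.
Qed.

Lemma cintegrableD f g : cintegrable f -> cintegrable g -> cintegrable (fun x => f x + g x).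
Proof.
move=> [f1 f2] [g1 g2]; split.
  apply: eq_integrable (integrableD mD f1 g1) => // x _.
  by rewrite /= /re_part ReD.
apply: eq_integrable (integrableD mD f2 g2) => // x _.
by rewrite /= /im_part ImD.
Qed.

Lemma cintegrableZ c f : cintegrable f -> cintegrable (fun x => c * f x).
Proof.
move=> [f1 f2]; split.
  apply: eq_integrable (integrableB mD (integrableZl mD (complex.Re c) f1)
    (integrableZl mD (complex.Im c) f2)) => // x _.
  by rewrite /= /re_part ReM EFinB !EFinM.
apply: eq_integrable (integrableD mD (integrableZl mD (complex.Re c) f2)
  (integrableZl mD (complex.Im c) f1)) => // x _.
by rewrite /= /im_part ImM EFinD !EFinM.
Qed.

Lemma cintegralD f g : cintegrable f -> cintegrable g ->
  cintegral D (fun x => f x + g x) = cintegral D f + cintegral D g.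
Proof.
move=> [f1 f2] [g1 g2]; rewrite /cintegral.
under eq_Rintegral do rewrite ReD.
under [X in _ +i* X = _]eq_Rintegral do rewrite ImD.
by rewrite !RintegralD.
Qed.

Lemma cintegralZ c f : cintegrable f ->
  cintegral D (fun x => c * f x) = c * cintegral D f.
Proof.
move=> [f1 f2]; rewrite /cintegral.
under eq_Rintegral do rewrite ReM.
under [X in _ +i* X = _]eq_Rintegral do rewrite ImM.
have i1 (r : R) (h : R -> R) : mu.-integrable D (EFin \o h) ->
    mu.-integrable D (EFin \o (fun x => r * h x)).
  by move=> ih; apply: eq_integrable (integrableZl mD r ih).
rewrite RintegralB ?RintegralD ?RintegralZl //; try exact: i1.
by apply/eqP; rewrite eq_complex /= ReM ImM /=; apply/andP; split; apply/eqP; ring.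
Qed.

Lemma cintegralB f g : cintegrable f -> cintegrable g ->
  cintegral D (fun x => f x - g x) = cintegral D f - cintegral D g.
Proof.
move=> cf cg; rewrite -[in RHS]mulN1r -cintegralZ // -cintegralD //; last exact: cintegrableZ.
by apply: eq_cintegral => x _; rewrite mulN1r.
Qed.

Lemma cintegrableB f g : cintegrable f -> cintegrable g -> cintegrable (fun x => f x - g x).
Proof.
move=> cf cg; apply: eq_cintegrable (cintegrableD cf (cintegrableZ (-1) cg)) => x _.
by rewrite mulN1r.
Qed.

(** The factor 2 comes from bounding the real and the imaginary part separately; no estimate below
    needs the sharp constant. *)
Lemma normc_cintegral_le f (G : R -> R) : cintegrable f ->
  mu.-integrable D (EFin \o G) -> (forall x, D x -> normc (f x) <= G x) ->
  normc (cintegral D f) <= 2 * \int[mu]_(x in D) G x.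
Proof.
move=> [f1 f2] iG fG; rewrite (le_trans (normc_le_ReIm _)) //= mulr2n mulrDl mul1r.
have key h : mu.-integrable D (EFin \o h) -> (forall x, D x -> `|h x| <= G x) ->
    `|\int[mu]_(x in D) h x| <= \int[mu]_(x in D) G x.
  move=> ih hG; rewrite (le_trans (le_normr_Rintegral mD ih)) //.
  apply: le_Rintegral => //.
  by have := integrable_norm ih.
by rewrite lerD // key // => x Dx; rewrite (le_trans _ (fG x Dx)) // ?ler_normc_Re ?ler_normc_Im.
Qed.

Lemma cintegrable_dominated f (G : R -> R) :
  measurable_fun (D : set (measurableTypeR R)) (re_part f) ->
  measurable_fun (D : set (measurableTypeR R)) (im_part f) ->
  mu.-integrable D (EFin \o G) -> (forall x, D x -> normc (f x) <= G x) ->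
  cintegrable f.
Proof.
move=> mf1 mf2 iG fG; split.
  apply: (le_integrable mD _ _ iG); first exact/measurable_EFinP.
  move=> x Dx; rewrite /= lee_fin (le_trans (ler_normc_Re _)) // (le_trans (fG x Dx)) //.
  exact: ler_norm.
apply: (le_integrable mD _ _ iG); first exact/measurable_EFinP.
move=> x Dx; rewrite /= lee_fin (le_trans (ler_normc_Im _)) // (le_trans (fG x Dx)) //.
exact: ler_norm.
Qed.

End ComplexIntegrable.

Lemma ccont_cintegrable (R : realType) (f : R -> R[i]) (a b : R) :
  (forall t, a <= t <= b -> ccont f t) -> cintegrable `[a, b] f.
Proof.
move=> cf; split; apply: continuous_compact_integrable; try exact: segment_compact;
  apply: continuous_in_subspaceT => x /set_mem /=; rewrite in_itv /= => /cf[];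
  by [].
Qed.

Section ContourIntegral.
Variable R : realType.
Local Notation C := (R[i]).
Variable g : R -> C.
Hypothesis g_contour : closed_contour g.

Definition on_contour (t : C) : Prop := exists2 u : R, 0 <= u <= 1 & g u = t.

Definition contour_cont (f : C -> C) : Prop :=
  forall u : R, 0 <= u <= 1 -> ccont (f \o g) u.

Lemma contour_cderive u : is_cderive g u (cderive g u).
Proof.
have [_ dr di _ _] := g_contour.
by split; rewrite /cderive /=; apply: DeriveDef; rewrite ?derive1E.
Qed.

Lemma contour_cderive_cont u : ccont (cderive g) u.
Proof. by have [_ _ _ cr ci] := g_contour; split; [exact: cr|exact: ci]. Qed.

Lemma contour_cont_cst c : contour_cont (fun=> c).
Proof. by move=> u _; exact: ccont_cst. Qed.
Lemma contour_cont_id : contour_cont id.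
Proof. by move=> u _; apply: is_cderive_ccont (contour_cderive u). Qed.
Lemma contour_contD f1 f2 : contour_cont f1 -> contour_cont f2 -> contour_cont (fun t => f1 t + f2 t).
Proof. by move=> h1 h2 u hu; apply: ccontD; [exact: h1|exact: h2]. Qed.
Lemma contour_contM f1 f2 : contour_cont f1 -> contour_cont f2 -> contour_cont (fun t => f1 t * f2 t).
Proof. by move=> h1 h2 u hu; apply: ccontM; [exact: h1|exact: h2]. Qed.
Lemma contour_contV f1 : (forall t, on_contour t -> f1 t != 0) ->
  contour_cont f1 -> contour_cont (fun t => (f1 t)^-1).
Proof.
move=> h0 h1 u hu; apply: (ccontV (f := f1 \o g)); last exact: h1.
by apply: h0; exists u.
Qed.
Lemma contour_cont_prod (ds : seq C) : contour_cont (fun t => \prod_(d <- ds) (t - d)).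
Proof.
elim: ds => [|d ds IH].
  rewrite (_ : (fun t => _) = (fun=> 1)); first exact: contour_cont_cst.
  by apply/funext => t; rewrite big_nil.
rewrite (_ : (fun t => _) = (fun t => (t + (- d)) * \prod_(d <- ds) (t - d))).
  apply: contour_contM => //; apply: contour_contD; first exact: contour_cont_id.
  exact: contour_cont_cst.
by apply/funext => t; rewrite big_cons.
Qed.
Lemma contour_cont_poly (P : {poly C}) : contour_cont (fun t => P.[t]).
Proof.
elim/poly_ind: P => [|P c IH].
  rewrite (_ : (fun t => _) = (fun=> 0)); first exact: contour_cont_cst.
  by apply/funext => t; rewrite horner0.
rewrite (_ : (fun t => _) = (fun t => P.[t] * t + c)).
  by apply: contour_contD; [apply: contour_contM => //; exact: contour_cont_id|
    exact: contour_cont_cst].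
by apply/funext => t; rewrite hornerMXaddC.
Qed.

Lemma contour_cont_cintegrable f : contour_cont f ->
  cintegrable `[0, 1] (fun u => f (g u) * cderive g u).
Proof.
move=> cf; apply: ccont_cintegrable => u hu.
by apply: (ccontM (f := f \o g)); [exact: cf|exact: contour_cderive_cont].
Qed.

Let m01 : measurable (`[0, 1]%classic : set (measurableTypeR R)).
Proof. exact: measurable_itv. Qed.

Lemma contour_integralD f1 f2 : contour_cont f1 -> contour_cont f2 ->
  contour_integral g (fun t => f1 t + f2 t) = contour_integral g f1 + contour_integral g f2.
Proof.
move=> h1 h2; rewrite /contour_integral.
under eq_cintegral do rewrite mulrDl.
by rewrite cintegralD //; exact: contour_cont_cintegrable.
Qed.

Lemma contour_integralZ c f : contour_cont f ->
  contour_integral g (fun t => c * f t) = c * contour_integral g f.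
Proof.
move=> h; rewrite /contour_integral -cintegralZ //; last exact: contour_cont_cintegrable.
by apply: eq_cintegral => u _; rewrite mulrA.
Qed.

Lemma eq_contour_integral f1 f2 : (forall t, on_contour t -> f1 t = f2 t) ->
  contour_integral g f1 = contour_integral g f2.
Proof.
move=> h; apply: eq_cintegral => u /=; rewrite in_itv /= => hu.
by rewrite h //; exists u.
Qed.

(** The primitive takes the same value at both ends of a closed contour. *)
Lemma contour_integral_primitive (F f : C -> C) : contour_cont f ->
  (forall u, 0 <= u <= 1 -> is_cderive (F \o g) u (f (g u) * cderive g u)) ->
  contour_integral g f = 0.
Proof.
move=> cf dF; rewrite /contour_integral.
rewrite (cintegral_FTC (F := F \o g)) ?ltr01 //=.
  by have [-> _ _ _ _] := g_contour; rewrite subrr.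
by move=> u hu; apply: (ccontM (f := f \o g)); [exact: cf|exact: contour_cderive_cont].
Qed.

Lemma contour_integral_linear c f1 f2 : contour_cont f1 -> contour_cont f2 ->
  contour_integral g (fun t => c * f1 t + f2 t) =
  c * contour_integral g f1 + contour_integral g f2.
Proof.
move=> h1 h2; have h := contour_contM (contour_cont_cst c) h1.
by rewrite (contour_integralD h h2) (contour_integralZ c h1).
Qed.

Lemma contour_integral_sum (n : nat) (c : nat -> C) (f : nat -> C -> C) :
  (forall i, contour_cont (f i)) ->
  contour_integral g (fun t => \sum_(i < n) c i * f i t) =
  \sum_(i < n) c i * contour_integral g (f i).
Proof.
move=> cf.
have cs m : contour_cont (fun t => \sum_(i < m) c i * f i t).
  elim: m => [|m IH].
    rewrite (_ : (fun t => _) = (fun=> 0)); first exact: contour_cont_cst.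
    by apply/funext => t; rewrite big_ord0.
  rewrite (_ : (fun t => _) = (fun t => \sum_(i < m) c i * f i t + c m * f m t)).
    by apply: contour_contD => //; apply: contour_contM => //; exact: contour_cont_cst.
  by apply/funext => t; rewrite big_ord_recr.
elim: n => [|n IH].
  rewrite big_ord0 (eq_contour_integral (f2 := fun t => 0 * 1)) => [|t _].
    by rewrite contour_integralZ ?mul0r //; exact: contour_cont_cst.
  by rewrite big_ord0 mul0r.
rewrite big_ord_recr -IH /= -contour_integralZ // -contour_integralD //; first last.
- by apply: contour_contM => //; exact: contour_cont_cst.
- exact: cs.
by apply: eq_contour_integral => t _; rewrite big_ord_recr.
Qed.

Lemma contour_cont_pow n : contour_cont (fun t => t ^+ n).
Proof.
rewrite (_ : (fun t => _) = (fun t : C => ('X^n).[t])); first exact: contour_cont_poly.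
by apply/funext => t; rewrite hornerXn.
Qed.

Lemma contour_integral_poly (P : {poly C}) : contour_integral g (fun t => P.[t]) = 0.
Proof.
rewrite (eq_contour_integral (f2 := fun t => \sum_(i < size P) P`_i * t ^+ i)) => [|t _]; last first.
  by rewrite horner_coef.
rewrite (@contour_integral_sum _ (fun i => P`_i) (fun i t => t ^+ i)); last exact: contour_cont_pow.
rewrite big1 // => i _.
rewrite (contour_integral_primitive (F := fun t => i.+1%:R^-1 * t ^+ i.+1)) ?mulr0 //.
  exact: contour_cont_pow.
move=> u hu; apply: is_cderive_eq.
  apply: (is_cderiveM (f := fun=> i.+1%:R^-1)); first exact: is_cderive_cst.
  exact: is_cderiveX (contour_cderive u).
by rewrite /= mul0r add0r !mulrA mulVf ?mul1r // pnatr_eq0.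
Qed.

Variable others : set C.
Hypothesis others_off : forall d, others d -> forall t, on_contour t -> t != d.
Hypothesis others_winding : forall d, others d -> winding_number g d = 0.

Let others_prod_cont ds : (forall d, d \in ds -> others d) ->
  contour_cont (fun t => (\prod_(d <- ds) (t - d))^-1).
Proof.
move=> od; apply: contour_contV => [t ht|]; last exact: contour_cont_prod.
by rewrite prodf_seq_neq0; apply/allP => d /od h; rewrite /= subr_eq0 others_off.
Qed.

Let others_inv d : others d -> contour_integral g (fun t => (t - d)^-1) = 0.
Proof.
move=> od; have := others_winding od; rewrite /winding_number => /eqP.
rewrite mulf_eq0 invr_eq0 => /orP[|/eqP//].
by rewrite eq_complex /= eqxx /= mulf_eq0 pnatr_eq0 /= gt_eqF ?pi_gt0.
Qed.

(** Only the exponent 1 has no rational primitive, and that case is the vanishing winding number. *)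
Let others_inv_pow d n : others d ->
  contour_integral g (fun t => (t - d) ^- n.+1) = 0.
Proof.
move=> od; case: n => [|n]; first by rewrite -[RHS](others_inv od).
apply: (contour_integral_primitive (F := fun t => - n.+1%:R^-1 * (t - d)^-1 ^+ n.+1)).
  rewrite (_ : (fun t => _) = (fun t => (\prod_(d0 <- nseq n.+2 d) (t - d0))^-1)).
    by apply: others_prod_cont => x; rewrite mem_nseq => /eqP ->.
  by apply/funext => t; rewrite big_nseq iter_mulr_1.
move=> u hu.
have gd : g u - d != 0 by rewrite subr_eq0 others_off //; exists u.
apply: is_cderive_eq.
  apply: (is_cderiveM (f := fun=> - n.+1%:R^-1)); first exact: is_cderive_cst.
  apply: (is_cderiveX (f := fun v => (g v - d)^-1)).
  apply: (is_cderiveV (f := fun v => g v - d)) => //.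
  apply: (is_cderiveD (g := fun=> - d)); [exact: contour_cderive|exact: is_cderive_cst].
rewrite /= mul0r add0r addr0 -[in RHS]exprVn !exprS.
have h : n.+1%:R != 0 :> C by rewrite pnatr_eq0.
set y := (g u - d)^-1 ^+ n; rewrite expr0.
by field; rewrite gd -natr1 addrC in h * => //; rewrite h.
Qed.

(** Poles may be repeated, so the induction is on their number. If all are equal, the integrand is a
    pure power. Otherwise two distinct poles c and d are separated by partial fractions, and each
    resulting term has one factor fewer. *)
Let others_prod_inv ds : (0 < size ds)%N -> (forall d, d \in ds -> others d) ->
  contour_integral g (fun t => (\prod_(d <- ds) (t - d))^-1) = 0.
Proof.
move: {2}(size ds) (leqnn (size ds)) => n; elim: n ds => [|n IH] [|d ds] //= dsn _ od.
have odd : others d by apply: od; rewrite mem_head.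
have [/allP dd|] := boolP (all (pred1 d) ds).
  rewrite -[RHS](others_inv_pow (size ds) odd); apply: eq_contour_integral => t _.
  rewrite big_cons exprS (_ : \prod_(j <- ds) (t - j) = (t - d) ^+ size ds) //.
  elim: ds dd {dsn IH od} => [|x s IHs] dd; first by rewrite big_nil.
  rewrite big_cons IHs => [|y ys]; last by apply: dd; rewrite in_cons ys orbT.
  by rewrite exprS (eqP (dd x _)) ?mem_head.
case/allPn => c cds; rewrite /= => cd.
have oc : others c by apply: od; rewrite in_cons cds orbT.
have od' : forall x, x \in rem c ds -> others x.
  by move=> x /mem_rem xds; apply: od; rewrite in_cons xds orbT.
have IH' x : others x ->
    contour_integral g (fun t => (\prod_(j <- x :: rem c ds) (t - j))^-1) = 0.
  move=> ox; apply: IH => //=.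
    by rewrite size_rem // prednK //; case: (ds) cds.
  by move=> y; rewrite in_cons => /predU1P[->//|]; exact: od'.
have Cx x : others x -> contour_cont (fun t => (\prod_(j <- x :: rem c ds) (t - j))^-1).
  move=> ox; apply: others_prod_cont => y; rewrite in_cons => /predU1P[->//|]; exact: od'.
rewrite (eq_contour_integral (f2 := fun t =>
    (d - c)^-1 * (\prod_(j <- d :: rem c ds) (t - j))^-1 +
    (c - d)^-1 * (\prod_(j <- c :: rem c ds) (t - j))^-1)); last first.
  move=> t ht; rewrite !big_cons (perm_big _ (perm_to_rem cds)) /= big_cons.
  have td : t - d != 0 by rewrite subr_eq0 others_off.
  have tc : t - c != 0 by rewrite subr_eq0 others_off.
  have tp : \prod_(j <- rem c ds) (t - j) != 0.
    by rewrite prodf_seq_neq0; apply/allP => y /od' h; rewrite /= subr_eq0 others_off.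
  have dc : d - c != 0 by rewrite subr_eq0 eq_sym.
  rewrite -[c - d]opprB.
  by field; rewrite dc tp tc td.
have h := contour_contM (contour_cont_cst (c - d)^-1) (Cx c oc).
by rewrite (contour_integral_linear _ (Cx d odd) h) (contour_integralZ _ (Cx c oc))
  (IH' d odd) (IH' c oc) !mulr0 addr0.
Qed.

(** Writing P = P.[d] + Q ('X - d) for one pole d leaves a term with constant numerator and a term
    with one pole fewer. *)
Lemma contour_integral_rational (P : {poly C}) ds : (forall d, d \in ds -> others d) ->
  contour_integral g (fun t => P.[t] / \prod_(d <- ds) (t - d)) = 0.
Proof.
elim: ds P => [|d ds IH] P od.
  rewrite -[RHS](contour_integral_poly P); apply: eq_contour_integral => t _.
  by rewrite big_nil divr1.
have odd : others d by apply: od; rewrite mem_head.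
have od' x : x \in ds -> others x by move=> h; apply: od; rewrite in_cons h orbT.
have /factor_theorem[Q HQ] : root (P - P.[d]%:P) d.
  by rewrite /root hornerD hornerN hornerC subrr.
rewrite (eq_contour_integral (f2 := fun t =>
  P.[d] * (\prod_(j <- d :: ds) (t - j))^-1 + Q.[t] / \prod_(j <- ds) (t - j))).
  have h := contour_contM (contour_cont_poly Q) (others_prod_cont od').
  rewrite (contour_integral_linear _ (others_prod_cont od) h).
  by rewrite (others_prod_inv _ od) // (IH Q od') mulr0 addr0.
move=> t ht; rewrite big_cons.
have td : t - d != 0 by rewrite subr_eq0 others_off.
have tp : \prod_(j <- ds) (t - j) != 0.
  by rewrite prodf_seq_neq0; apply/allP => y /od' h; rewrite /= subr_eq0 others_off.
have -> : P.[t] = P.[d] + Q.[t] * (t - d).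
  have := congr1 (horner^~ t) HQ; rewrite !hornerE => <-.
  by rewrite addrC subrK.
by field; rewrite td tp.
Qed.

(** With r the value at c of the rational factor and D its denominator, P - r D is divisible by 'X -
    c. Hence the integrand is r / (t - c) plus a function whose poles all have winding number 0. *)
Lemma contour_integral_rational_node (P : {poly C}) ds c : (forall d, d \in ds -> others d) ->
  (forall t, on_contour t -> t != c) -> winding_number g c = 1 ->
  contour_integral g (fun t => P.[t] / \prod_(d <- ds) (t - d) / (t - c)) =
  two_pi_i R * (P.[c] / \prod_(d <- ds) (c - d)).
Proof.
move=> od coff cw.
have pi0 : two_pi_i R != 0.
  by rewrite eq_complex /= eqxx /= mulf_eq0 pnatr_eq0 /= gt_eqF ?pi_gt0.
have cE : contour_integral g (fun t => (t - c)^-1) = two_pi_i R.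
  by apply: (mulfI (invr_neq0 pi0)); rewrite mulVf // -[LHS]cw.
(* The node is not one of the poles, since its winding number is 1 and theirs is 0. *)
have cds : \prod_(d <- ds) (c - d) != 0.
  rewrite prodf_seq_neq0; apply/allP => d /od h; rewrite /= subr_eq0.
  apply/eqP => cd; move: cw; rewrite cd others_winding // => /esym/eqP.
  by rewrite oner_eq0.
set r := P.[c] / _.
pose D := \prod_(d <- ds) ('X - d%:P).
have DE t : D.[t] = \prod_(d <- ds) (t - d).
  by rewrite /D horner_prod; apply: eq_bigr => d _; rewrite !hornerE.
have /factor_theorem[Q HQ] : root (P - r *: D) c.
  by rewrite /root hornerD hornerN hornerZ DE /r divfK // subrr.
have Cc : contour_cont (fun t => (t - c)^-1).
  apply: contour_contV => [t ht|]; first by rewrite subr_eq0 coff.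
  by apply: contour_contD; [exact: contour_cont_id|exact: contour_cont_cst].
rewrite (eq_contour_integral (f2 := fun t =>
  r * (t - c)^-1 + Q.[t] / \prod_(j <- ds) (t - j))).
  have h := contour_contM (contour_cont_poly Q) (others_prod_cont od).
  by rewrite (contour_integral_linear _ Cc h) (contour_integral_rational Q od) addr0 cE mulrC.
move=> t ht.
have tc : t - c != 0 by rewrite subr_eq0 coff.
have tp : \prod_(j <- ds) (t - j) != 0.
  by rewrite prodf_seq_neq0; apply/allP => y /od h; rewrite /= subr_eq0 others_off.
have -> : P.[t] = r * \prod_(d <- ds) (t - d) + Q.[t] * (t - c).
  have := congr1 (horner^~ t) HQ; rewrite !hornerE DE => <-.
  by rewrite addrC subrK.
by field; rewrite tc tp.
Qed.

End ContourIntegral.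

(** * Uniform rational approximation and the Cauchy formula *)

Section ComplexExponential.
Variable R : realType.
Local Notation C := (R[i]).
Local Notation mu := (@lebesgue_measure R).

Definition cexp (w : C) : C :=
  (expR (complex.Re w))%:C * (cos (complex.Im w) +i* sin (complex.Im w)).

Lemma cpow_cexp (x : R) (z : C) : 0 < x -> cpow x z = cexp (z * (ln x)%:C).
Proof.
by move=> x0; rewrite /cpow /cexp /powR gt_eqF // ReMr ImMr.
Qed.

Lemma cexp0 : cexp 0 = 1.
Proof. by rewrite /cexp expR0 cos0 sin0 mul1r. Qed.

Lemma normc_cexp w : normc (cexp w) = expR (complex.Re w).
Proof.
rewrite /cexp normcM normc_real ger0_norm ?expR_ge0 //=.
by rewrite cos2Dsin2 sqrtr1 mulr1.
Qed.

(** Lines through 0 suffice, both for the Taylor remainder and for the derivative of [cpow] in its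
    base, where the parameter is ln x. *)
Lemma is_cderive_cexp (w : C) (t : R) :
  is_cderive (fun u => cexp (u%:C * w)) t (w * cexp (t%:C * w)).
Proof.
have sc (u r : R) : is_derive u (1 : R) (fun v => v * r) r.
  by apply: is_derive_eq; rewrite /GRing.scale /=; ring.
have e1 : is_derive t (1 : R) (fun u => expR (u * complex.Re w))
    (expR (t * complex.Re w) * complex.Re w).
  exact: (is_derive1_comp (f := expR)).
have e2 : is_derive t (1 : R) (fun u => cos (u * complex.Im w))
    (- sin (t * complex.Im w) * complex.Im w).
  exact: (is_derive1_comp (f := @cos R)).
have e3 : is_derive t (1 : R) (fun u => sin (u * complex.Im w))
    (cos (t * complex.Im w) * complex.Im w).
  exact: (is_derive1_comp (f := @sin R)).
have Rw (u : R) : complex.Re (u%:C * w) = u * complex.Re w.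
  by rewrite ReM /= mul0r subr0.
have Iw (u : R) : complex.Im (u%:C * w) = u * complex.Im w.
  by rewrite ImM /= mul0r addr0.
split.
  rewrite (_ : re_part _ = (fun u => expR (u * complex.Re w)) * (fun u => cos (u * complex.Im w))).
    apply: is_derive_eq; rewrite /cexp Rw Iw ReM /=.
    by rewrite /GRing.scale /=; ring.
  apply/funext => u; rewrite /re_part /cexp Rw Iw /= !fctE.
  by rewrite mul0r subr0.
rewrite (_ : im_part _ = (fun u => expR (u * complex.Re w)) * (fun u => sin (u * complex.Im w))).
  apply: is_derive_eq; rewrite /cexp Rw Iw ImM /=.
  by rewrite /GRing.scale /=; ring.
apply/funext => u; rewrite /im_part /cexp Rw Iw /= !fctE.
by rewrite mul0r addr0.
Qed.

Lemma normc_primitive_le (F f : R -> C) (n : nat) (c t : R) : 0 <= t ->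
  (forall u, is_cderive F u (f u)) -> (forall u, ccont f u) -> F 0 = 0 ->
  (forall u, 0 <= u <= t -> normc (f u) <= c * u ^+ n) ->
  normc (F t) <= 2 * (c * t ^+ n.+1 / n.+1%:R).
Proof.
rewrite le_eqVlt => /predU1P[<-|t0] dF cf F0 fc.
  by rewrite F0 normc0 expr0n /= mulr0 mul0r mulr0.
rewrite -[F t]subr0 -F0 -(cintegral_FTC (f := f)) //.
have dG (u : R) : is_derive u (1 : R) (fun v => c / n.+1%:R * v ^+ n.+1) (c * u ^+ n).
  rewrite (_ : (fun v => _) = (c / n.+1%:R) *: ((@id R) ^+ n.+1)); last first.
    by apply/funext => v; rewrite !fctE.
  have n0 : n.+1%:R != 0 :> R by rewrite pnatr_eq0.
  apply: is_derive_eq; rewrite /GRing.scale /= mulr1 !mulrA divfK //.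
have cG (u : R) : {for u, continuous (fun v : R => c * v ^+ n)}.
  by apply: cvgM; [exact: cvg_cst|exact: exprn_continuous].
have iG : mu.-integrable `[0, t] (EFin \o (fun u => c * u ^+ n)).
  apply: continuous_compact_integrable; first exact: segment_compact.
  by apply: continuous_in_subspaceT => u _; exact: cG.
have IG : \int[mu]_(u in `[0, t]) (c * u ^+ n) = c * t ^+ n.+1 / n.+1%:R.
  have h := @cintegral_FTC R (fun v => (c / n.+1%:R * v ^+ n.+1)%:C)
    (fun u => (c * u ^+ n)%:C) 0 t t0.
  have {}h := h (fun u _ => is_cderive_real (dG u))
    (fun u _ => conj (cG u) (@cst_continuous _ _ 0 u)).
  have := congr1 (@complex.Re R) h; rewrite /= expr0n /= mulr0 subr0 => ->.
  by ring.
rewrite -IG; apply: normc_cintegral_le => //.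
by apply: ccont_cintegrable.
Qed.

(** On the segment from 0 to w the remainder of order m + 1 vanishes at 0 and has derivative w times
    the remainder of order m. Each of the n integrations costs a factor 2, whence the power of 2 in
    the bound. *)
Lemma cexp_taylor_le (w : C) (n : nat) :
  normc (cexp w - \sum_(k < n) w ^+ k / k`!%:R) <=
  expR (normc w) * (2 * normc w) ^+ n / n`!%:R.
Proof.
pose r n (u : R) := cexp (u%:C * w) - \sum_(k < n) (u%:C * w) ^+ k / k`!%:R.
suff H m (u : R) : 0 <= u <= 1 ->
    normc (r m u) <= expR (normc w) * (2 * normc w) ^+ m / m`!%:R * u ^+ m.
  have := H n 1; rewrite lexx ler01 expr1n mulr1 /r mul1r; exact.
have dr m' u' : is_cderive (r m'.+1) u' (w * r m' u').
  rewrite /r; elim: m' => [|m' IH].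
    rewrite big_ord0 subr0 (_ : (fun u => _) = (fun u => cexp (u%:C * w) + (- 1))); last first.
      by apply/funext => v; rewrite big_ord1 expr0 divr1.
    apply: is_cderive_eq; first exact: is_cderiveD (is_cderive_cexp w u') (is_cderive_cst (-1) u').
    by rewrite addr0.
  rewrite (_ : (fun u => _) = (fun u =>
     (cexp (u%:C * w) - \sum_(k < m'.+1) (u%:C * w) ^+ k / k`!%:R) +
     (- (w ^+ m'.+1 / (m'.+1)`!%:R)) * u%:C ^+ m'.+1)); last first.
    apply/funext => v; rewrite big_ord_recr /= opprD addrA; congr (_ + _).
    by rewrite exprMn; ring.
  apply: is_cderive_eq.
    apply: is_cderiveD IH _; apply: is_cderiveM; first exact: is_cderive_cst.
    by apply: (is_cderiveX (f := fun u => u%:C)); apply: is_cderive_real; exact: is_derive_id.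
  rewrite mul0r add0r mulr1 /= [in RHS]big_ord_recr /= opprD addrA [in RHS]mulrDr; congr (_ + _).
  rewrite exprMn factS natrM exprS.
  have h1 : m'.+1%:R != 0 :> C by rewrite pnatr_eq0.
  have h2 : m'`!%:R != 0 :> C by rewrite pnatr_eq0 -lt0n fact_gt0.
  by field; rewrite h2; move: h1; rewrite -natr1 addrC.
elim: m u => [|m IH] u /andP[u0 u1].
  rewrite /r big_ord0 subr0 normc_cexp !expr0 mulr1 divr1 mulr1 ler_expR.
  apply: (le_trans (ler_norm _)); apply: (le_trans (ler_normc_Re _)).
  by rewrite normcM normc_real ger0_norm // ler_piMl // normc_ge0.
have h0 : r m.+1 0 = 0.
  rewrite /r mul0r cexp0 big_ord_recl expr0 divr1 big1 ?addr0 ?subrr // => k _.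
  by rewrite expr0n mul0r.
pose c := normc w * (expR (normc w) * (2 * normc w) ^+ m / m`!%:R).
have := @normc_primitive_le (r m.+1) (fun u => w * r m u) m c u u0 (dr m) _ h0.
have cr v : ccont (fun u => w * r m u) v.
  apply: ccontM; first exact: ccont_cst.
  case: (m) => [|m']; last exact: is_cderive_ccont (dr m' v).
  rewrite (_ : r 0 = fun u => cexp (u%:C * w)).
    exact: is_cderive_ccont (is_cderive_cexp w v).
  by apply/funext => v'; rewrite /r big_ord0 subr0.
move=> /(_ cr) h; apply: le_trans (h _) _.
  move=> v /andP[v0 vu]; rewrite normcM /c -(mulrA (normc w)) ler_wpM2l ?normc_ge0 // IH //.
  by rewrite v0 (le_trans vu).
rewrite le_eqVlt; apply/orP; left; apply/eqP.
rewrite /c factS natrM !exprS.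
have h1 : m.+1%:R != 0 :> R by rewrite pnatr_eq0.
have h2 : m`!%:R != 0 :> R by rewrite pnatr_eq0 -lt0n fact_gt0.
by field; rewrite h2; move: h1; rewrite -natr1 addrC.
Qed.

End ComplexExponential.

(** * Functions that are uniform limits of rational functions with prescribed poles *)

Section RationalApproximation.
Variable R : realType.
Local Notation C := (R[i]).
Variables (K others : set C).

(* For such f the residue formula follows from partial fractions and winding numbers;
   no holomorphic Cauchy theory is involved. *)
Definition rational_approx (f : C -> C) : Prop :=
  forall eps : R, 0 < eps -> exists (P : {poly C}) (ds : seq C),
    (forall d, d \in ds -> others d) /\
    forall t, K t -> normc (f t - P.[t] / \prod_(d <- ds) (t - d)) <= eps.

Hypothesis K_bounded : exists M : R, forall t, K t -> normc t <= M.
Hypothesis K_away : forall d, others d ->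
  exists2 e : R, 0 < e & forall t, K t -> e <= normc (t - d).

Lemma rational_bounded (P : {poly C}) (ds : seq C) : (forall d, d \in ds -> others d) ->
  exists2 M : R, 0 < M & forall t, K t -> normc (P.[t] / \prod_(d <- ds) (t - d)) <= M.
Proof.
move=> od.
have [M1 M10 H1] : exists2 M : R, 0 < M & forall t, K t -> normc P.[t] <= M.
  have [M KM] := K_bounded.
  exists (1 + \sum_(i < size P) normc P`_i * `|M| ^+ i).
    by rewrite ltr_pwDl // sumr_ge0 // => i _; rewrite mulr_ge0 ?normc_ge0 ?exprn_ge0.
  move=> t Kt; rewrite horner_coef (le_trans (normc_sum _ _ _)) // ler_wpDl //.
  apply: ler_sum => i _; rewrite normcM normcX ler_wpM2l ?normc_ge0 //.
  by rewrite lerXn2r ?nnegrE ?normc_ge0 // (le_trans (KM t Kt)) // ler_norm.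
have [M2 M20 H2] : exists2 M : R, 0 < M &
    forall t, K t -> normc (\prod_(d <- ds) (t - d))^-1 <= M.
  elim: ds od => [|d ds IH] od.
    by exists 1 => // t _; rewrite big_nil invr1 normc1.
  have [|M M0 HM] := IH; first by move=> x xs; apply: od; rewrite in_cons xs orbT.
  have [|e e0 He] := K_away (d := d); first by apply: od; rewrite mem_head.
  exists (e^-1 * M) => [|t Kt]; first by rewrite mulr_gt0 ?invr_gt0.
  rewrite big_cons invfM normcM normcV ler_pM ?invr_ge0 ?normc_ge0 ?HM //.
  by rewrite lef_pV2 ?posrE // ?He // (lt_le_trans e0) ?He.
exists (M1 * M2) => [|t Kt]; first by rewrite mulr_gt0.
by rewrite normcM ler_pM ?normc_ge0 ?H1 ?H2.
Qed.

Lemma rational_approx_bounded f : rational_approx f ->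
  exists2 M : R, 0 < M & forall t, K t -> normc (f t) <= M.
Proof.
move=> /(_ 1 ltr01)[P [ds [od H]]]; have [M M0 HM] := rational_bounded P od.
exists (1 + M) => [|t Kt]; first by rewrite addr_gt0.
rewrite -[f t](subrK (P.[t] / \prod_(d <- ds) (t - d))) (le_trans (normcD_le _ _)) //.
by rewrite lerD ?H ?HM.
Qed.

Lemma eq_rational_approx f f' : (forall t, K t -> f t = f' t) ->
  rational_approx f -> rational_approx f'.
Proof.
move=> ff' h e e0; have [P [ds [od H]]] := h e e0; exists P, ds; split=> // t Kt.
by rewrite -ff' ?H.
Qed.

Lemma rational_approx_poly (P : {poly C}) : rational_approx (fun t => P.[t]).
Proof.
move=> e e0; exists P, [::]; split=> // t _.
by rewrite big_nil divr1 subrr normc0 ltW.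
Qed.

Lemma rational_approx_cst c : rational_approx (fun=> c).
Proof.
by apply: eq_rational_approx (rational_approx_poly c%:P) => t _; rewrite hornerC.
Qed.

Lemma rational_approx_inv d : others d -> rational_approx (fun t => (t - d)^-1).
Proof.
move=> od e e0; exists 1, [:: d]; split=> [x|t _]; first by rewrite inE => /eqP ->.
by rewrite big_seq1 hornerC div1r subrr normc0 ltW.
Qed.

Lemma rational_approxM f g : rational_approx f -> rational_approx g ->
  rational_approx (fun t => f t * g t).
Proof.
move=> hf hg; have [Mf Mf0 HMf] := rational_approx_bounded hf.
move=> e e0; pose e1 := e / 2 / Mf.
have e10 : 0 < e1 by rewrite !divr_gt0.
(* The approximant q of g is fixed first: in f g - r q = f (g - q) + (f - r) q the precision
   required of r depends on the bound for q. *)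
have [Q [dg [og Hg]]] := hg e1 e10.
have [Mg Mg0 HMg] := rational_bounded Q og.
have [|P [df [of_ Hf]]] := hf (e / 2 / Mg); first by rewrite !divr_gt0.
exists (P * Q), (df ++ dg); split=> [d|t Kt].
  by rewrite mem_cat => /orP[/of_|/og].
rewrite hornerM big_cat /= invfM.
pose q := Q.[t] / \prod_(d <- dg) (t - d); pose r := P.[t] / \prod_(d <- df) (t - d).
rewrite (_ : f t * g t - _ = f t * (g t - q) + (f t - r) * q); last first.
  by rewrite /q /r; ring.
rewrite (le_trans (normcD_le _ _)) // (normcM (f t)) (normcM (f t - r)) (splitr e) lerD //.
  rewrite (_ : e / 2 = Mf * e1); last by rewrite /e1; field; rewrite gt_eqF.
  by rewrite ler_pM ?normc_ge0 //; [exact: HMf|exact: Hg].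
rewrite (_ : e / 2 = e / 2 / Mg * Mg); last by rewrite divfK // gt_eqF.
by rewrite ler_pM ?normc_ge0 //; [exact: Hf|exact: HMg].
Qed.

Lemma rational_approx_prod (I : Type) (s : seq I) (P : pred I) (f : I -> C -> C) :
  (forall i, P i -> rational_approx (f i)) ->
  rational_approx (fun t => \prod_(i <- s | P i) f i t).
Proof.
move=> hf; elim: s => [|i s IH].
  by apply: eq_rational_approx (rational_approx_cst 1) => t _; rewrite big_nil.
have [Pi|nPi] := boolP (P i).
  by apply: eq_rational_approx (rational_approxM (hf i Pi) IH) => t _; rewrite big_cons Pi.
by apply: eq_rational_approx IH => t _; rewrite big_cons (negPf nPi).
Qed.

Lemma rational_approx_lim f :
  (forall eps : R, 0 < eps -> exists2 h, rational_approx h &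
     forall t, K t -> normc (f t - h t) <= eps) -> rational_approx f.
Proof.
move=> hf e e0; have e20 : 0 < e / 2 by rewrite divr_gt0.
have [h ah Hh] := hf _ e20; have [P [ds [od H]]] := ah _ e20.
exists P, ds; split=> // t Kt.
rewrite -(subrKA (h t)) (le_trans (normcD_le _ _)) // (splitr e).
by rewrite lerD ?Hh ?H.
Qed.

(** The Taylor polynomials of the exponential converge uniformly on the bounded set K, so no pole is
    used. *)
Lemma rational_approx_cpow (x : R) : 0 < x -> rational_approx (fun t => cpow x t).
Proof.
move=> x0 e e0; have [M KM] := K_bounded.
pose L := (ln x)%:C; pose M' := `|M| * `|ln x|.
have cv : (expR M' * (2 * M') ^+ n / n`!%:R) @[n --> \oo] --> (0 : R).
  rewrite -(mulr0 (expR M')); under eq_fun do rewrite -mulrA.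
  apply: cvgM; first exact: cvg_cst.
  have := cvg_series_cvg_0 (@is_cvg_series_exp_coeff R (2 * M')).
  by rewrite /exp_coeff.
have /cvgrPdist_le /(_ e e0)[n _ /(_ n (leqnn n)) /= Hn] := cv.
exists (\poly_(k < n) (L ^+ k / k`!%:R)), [::]; split=> // t Kt.
rewrite big_nil divr1 horner_poly cpow_cexp //.
rewrite (eq_bigr (fun k : 'I_n => (t * L) ^+ k / k`!%:R)); last first.
  by move=> k _; rewrite exprMn; ring.
rewrite (le_trans (cexp_taylor_le _ _)) // (le_trans _ Hn) // sub0r normrN.
have tM : normc (t * L) <= M'.
  rewrite normcM /L normc_real ler_wpM2r //.
  exact: le_trans (KM t Kt) (ler_norm M).
rewrite ger0_norm; last first.
  by rewrite !mulr_ge0 ?expR_ge0 ?invr_ge0 ?exprn_ge0 // !mulr_ge0.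
rewrite ler_wpM2r ?invr_ge0 // ler_pM ?expR_ge0 ?exprn_ge0 ?mulr_ge0 ?normc_ge0 //.
  by rewrite ler_expR.
by rewrite lerXn2r ?nnegrE ?mulr_ge0 ?normc_ge0 // ler_wpM2l.
Qed.

End RationalApproximation.

(** * The Cauchy formula at a simple pole *)

Section CauchyFormula.
Variable R : realType.
Local Notation C := (R[i]).
Variables (g : R -> C) (nodes others : set C).
Hypothesis g_encl : encloses_exactly g nodes others.

Let g_contour : closed_contour g. Proof. by have [] := g_encl. Qed.

Let others_off d : others d -> forall t, on_contour g t -> t != d.
Proof.
have [_ off _ _] := g_encl.
move=> od t [u u01 <-]; apply/eqP => gd; apply: (off u u01); right.
by rewrite gd.
Qed.

Let nodes_off c : nodes c -> forall t, on_contour g t -> t != c.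
Proof.
have [_ off _ _] := g_encl.
move=> od t [u u01 <-]; apply/eqP => gd; apply: (off u u01); left.
by rewrite gd.
Qed.

Let others_winding d : others d -> winding_number g d = 0.
Proof. by have [_ _ _ +] := g_encl; apply. Qed.

(** The approximants have to converge at the node as well, because the residue involves the value of
    the function there. *)
Definition contour_node (c t : C) : Prop := on_contour g t \/ t = c.

Let continuous_bounded (f : R -> R) : (forall u : R, 0 <= u <= 1 -> {for u, continuous f}) ->
  exists M : R, forall u, 0 <= u <= 1 -> f u <= M.
Proof.
move=> cf; have [|c _ Hc] := @EVT_max R f 0 1 ler01.
  by apply: continuous_in_subspaceT => x /set_mem /=; rewrite in_itv /=; exact: cf.
by exists (f c) => u hu; apply: Hc; rewrite in_itv.
Qed.

Let contour_cont_bounded (f : C -> C) : contour_cont g f ->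
  exists M : R, forall t, on_contour g t -> normc (f t) <= M.
Proof.
move=> cf.
have [|M HM] := @continuous_bounded
    (fun u => (`|re_part (f \o g) u| + `|im_part (f \o g) u|)).
  move=> u /cf[c1 c2]; apply: cvgD; apply: cvg_norm; [exact: c1|exact: c2].
exists M => t [u hu <-]; apply: le_trans (normc_le_ReIm _) _.
exact: HM.
Qed.

Lemma contour_node_bounded c : exists M : R, forall t, contour_node c t -> normc t <= M.
Proof.
have [M HM] := contour_cont_bounded (contour_cont_id g_contour).
exists (Num.max M (normc c)) => t [/HM h|->]; rewrite le_max ?h ?lexx ?orbT //.
Qed.

(** The contour keeps its distance because the continuous function 1 / (t - d) is bounded on it; the
    node differs from d because their winding numbers differ. *)
Lemma contour_node_away c d : nodes c -> others d ->
  exists2 e : R, 0 < e & forall t, contour_node c t -> e <= normc (t - d).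
Proof.
move=> nc od.
have cd : c - d != 0.
  rewrite subr_eq0; apply/eqP => cd; have [_ _ + _] := g_encl.
  by move=> /(_ c nc); rewrite cd others_winding // => /esym/eqP; rewrite oner_eq0.
have [|M HM] := @contour_cont_bounded (fun t => (t - d)^-1).
  apply: contour_contV => [t ht|]; first by rewrite subr_eq0 others_off.
  by apply: contour_contD; [exact: contour_cont_id|exact: contour_cont_cst].
exists (Num.min (`|M| + 1)^-1 (normc (c - d))).
  by rewrite lt_min invr_gt0 normc_gt0 cd andbT ltr_wpDl.
move=> t [ht|->]; rewrite ge_min ?lexx ?orbT //.
apply/orP; left; have td : t - d != 0 by rewrite subr_eq0 others_off.
have n0 : 0 < normc (t - d) by rewrite normc_gt0.
rewrite -[leRHS]invrK lef_pV2 ?posrE ?invr_gt0 ?ltr_wpDl // -normcV.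
by rewrite (le_trans (HM t ht)) // (le_trans (ler_norm M)) // lerDl.
Qed.

(** Both sides are continuous under uniform approximation of f, and the formula is known for
    rational functions. Integrability is part of the conclusion because f is not assumed continuous,
    and later sums over nodes need it. *)
Lemma cauchy_formula (f : C -> C) c : nodes c ->
  rational_approx (contour_node c) others f ->
  cintegrable `[0, 1] (fun u => f (g u) / (g u - c) * cderive g u) /\
  contour_integral g (fun t => f t / (t - c)) = two_pi_i R * f c.
Proof.
move=> nc hf.
have m01 : measurable (`[0, 1]%classic : set (measurableTypeR R)) by exact: measurable_itv.
have Cc : contour_cont g (fun t => (t - c)^-1).
  apply: contour_contV => [t ht|]; first by rewrite subr_eq0 nodes_off.
  by apply: contour_contD; [exact: contour_cont_id|exact: contour_cont_cst].
have [Mg HMg] : exists M : R, forall u, 0 <= u <= 1 -> normc ((g u - c)^-1 * cderive g u) <= M.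
  have [|M HM] := @continuous_bounded (fun u =>
    `|re_part (fun u => (g u - c)^-1 * cderive g u) u| +
    `|im_part (fun u => (g u - c)^-1 * cderive g u) u|).
    move=> u hu.
    have [c1 c2] : ccont (fun u => (g u - c)^-1 * cderive g u) u.
      by apply: (ccontM (f := (fun t => (t - c)^-1) \o g)); [exact: Cc|
        exact: contour_cderive_cont].
    by apply: cvgD; apply: cvg_norm; [exact: c1|exact: c2].
  by exists M => u hu; rewrite (le_trans (normc_le_ReIm _)) //; exact: HM.
have Mg0 : 0 <= Mg by rewrite (le_trans (normc_ge0 _) (HMg 0 _)) // lexx ler01.
have iC (r : R) : lebesgue_measure.-integrable `[0, 1] (EFin \o (fun=> r : R)).
  by apply: continuous_compact_integrable; [exact: segment_compact|move=> ?; exact: cvg_cst].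
have IC (r : R) : \int[lebesgue_measure]_(u in `[0, 1]) r = r.
  by rewrite Rintegral_cst //= lebesgue_measure_itv /= lte_fin ltr01 /= subr0 mulr1.
have gK u : 0 <= u <= 1 -> contour_node c (g u) by move=> hu; left; exists u.
have rat_c P ds : (forall d, d \in ds -> others d) ->
    contour_cont g (fun t => P.[t] / \prod_(d <- ds) (t - d) / (t - c)).
  move=> od; apply: contour_contM => //; apply: contour_contM; first exact: contour_cont_poly.
  apply: contour_contV => [t ht|]; last exact: contour_cont_prod.
  by rewrite prodf_seq_neq0; apply/allP => d /od h; rewrite /= subr_eq0 others_off.
(* Measurability comes from the pointwise convergence of the continuous integrands of the rational
   approximants; a constant dominates. *)
have int_f : cintegrable `[0, 1] (fun u => f (g u) / (g u - c) * cderive g u).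
  have [Mf _ HMf] := rational_approx_bounded (contour_node_bounded c)
     (fun d => @contour_node_away c d nc) hf.
  have /choice[P /choice[ds Hn]] : forall n : nat, exists P ds,
      (forall d, d \in ds -> others d) /\ forall t, contour_node c t ->
      normc (f t - P.[t] / \prod_(d <- ds) (t - d)) <= n.+1%:R^-1.
    by move=> n; apply: hf; rewrite invr_gt0.
  pose h n u := (P n).[g u] / \prod_(d <- ds n) (g u - d) / (g u - c) * cderive g u.
  have ih n : cintegrable `[0, 1] (h n).
    exact: (contour_cont_cintegrable g_contour (rat_c _ _ (Hn n).1)).
  have hcv u : 0 <= u <= 1 -> forall eps : R, 0 < eps -> \forall n \near \oo,
      normc (f (g u) / (g u - c) * cderive g u - h n u) <= eps.
    move=> hu eps eps0; near=> n.
    have -> : f (g u) / (g u - c) * cderive g u - h n u =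
       (f (g u) - (P n).[g u] / \prod_(d <- ds n) (g u - d)) * ((g u - c)^-1 * cderive g u).
      by rewrite /h; ring.
    rewrite normcM; apply: (@le_trans _ _ (n.+1%:R^-1 * (Mg + 1))).
      rewrite ler_pM ?normc_ge0 // ?(Hn n).2 //; first exact: gK.
      by rewrite (le_trans (HMg u hu)) // lerDl.
    rewrite mulrC ler_pdivrMr ?ltr0n // mulrC -ler_pdivrMr //.
    apply: (@le_trans _ _ n%:R); last by rewrite ler_nat.
    by near: n; exact: nbhs_infty_ger.
  apply: (@cintegrable_dominated _ _ m01 _ (fun=> Mf * Mg)) => //.
  - apply: (@measurable_fun_cvg _ _ _ _ (fun n u => re_part (h n) u)).
      by move=> n; have [/measurable_int/measurable_EFinP] := ih n.
    move=> u /=; rewrite in_itv /= => hu.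
    apply/cvgrPdist_le => eps eps0; near=> n; rewrite /re_part -ReN -ReD.
    by rewrite (le_trans (ler_normc_Re _)) //; near: n; exact: hcv.
  - apply: (@measurable_fun_cvg _ _ _ _ (fun n u => im_part (h n) u)).
      by move=> n; have [_ /measurable_int/measurable_EFinP] := ih n.
    move=> u /=; rewrite in_itv /= => hu.
    apply/cvgrPdist_le => eps eps0; near=> n; rewrite /im_part -ImN -ImD.
    by rewrite (le_trans (ler_normc_Im _)) //; near: n; exact: hcv.
  - move=> u /=; rewrite in_itv /= => hu.
    by rewrite -mulrA normcM ler_pM ?normc_ge0 ?HMf ?HMg //; exact: gK.
split=> //.
apply/eqP; rewrite -subr_eq0 -[_ == 0]negbK -normc_gt0 -leNgt.
apply/ler_addgt0Pl => eps eps0; rewrite addr0.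
(* An error eps / B in f costs at most 2 Mg eps / B in the integral and |2 pi i| eps / B at the
   node; the 1 makes B positive. *)
pose B := 2 * Mg + normc (two_pi_i R) + 1.
have B0 : 0 < B.
  by rewrite ltr_wpDl // addr_ge0 ?normc_ge0 // mulr_ge0.
have [P [ds [od H]]] := hf (eps / B) (divr_gt0 eps0 B0).
have [_ _ wn _] := g_encl.
have E := contour_integral_rational_node g_contour others_off others_winding P od
  (nodes_off nc) (wn c nc).
set r := fun t : C => P.[t] / \prod_(d <- ds) (t - d).
have -> : contour_integral g (fun t => f t / (t - c)) - two_pi_i R * f c =
  cintegral `[0, 1] (fun u => f (g u) / (g u - c) * cderive g u -
      r (g u) / (g u - c) * cderive g u) - two_pi_i R * (f c - r c).
  rewrite cintegralB //; last exact: (contour_cont_cintegrable g_contour (rat_c _ _ od)).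
  rewrite mulrBr [in RHS]opprB -/(contour_integral g (fun t => f t / (t - c))).
  rewrite -/(contour_integral g (fun t => r t / (t - c))) E /r.
  by ring.
rewrite (le_trans (normcB_le _ _)) //.
apply: (@le_trans _ _ (2 * (eps / B * Mg) + normc (two_pi_i R) * (eps / B))).
  rewrite lerD //; last by rewrite normcM ler_wpM2l ?normc_ge0 //; apply: H; right.
  rewrite -(IC (eps / B * Mg)); apply: normc_cintegral_le => //.
    by apply: cintegrableB => //; exact: (contour_cont_cintegrable g_contour (rat_c _ _ od)).
  move=> u /=; rewrite in_itv /= => hu.
  rewrite -mulrBl -mulrBl -mulrA normcM ler_pM ?normc_ge0 ?HMg //.
  by apply: H; exact: gK.
have -> : 2 * (eps / B * Mg) + normc (two_pi_i R) * (eps / B) =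
   eps * ((2 * Mg + normc (two_pi_i R)) / B) by field; rewrite gt_eqF.
by rewrite ler_piMr ?(ltW eps0) // ler_pdivrMr // mul1r /B lerDl.
Unshelve. all: by end_near. Qed.

End CauchyFormula.

(** * The Gamma function *)

Section HalfLine.
Variable R : realType.
Local Notation C := (R[i]).
Local Notation mu := (@lebesgue_measure R).
Local Notation D := (`]0%R, +oo[%classic : set R).
Local Notation mR := (measurableTypeR R).

(** Starting at 2 keeps the interval nondegenerate for n = 0, as the fundamental theorem of calculus
    is applied on each of them. *)
Definition exhaust (n : nat) : set R := `[n.+2%:R^-1, n.+2%:R]%classic.

Lemma exhaust_lt (n : nat) : n.+2%:R^-1 < n.+2%:R :> R.
Proof.
rewrite (@lt_trans _ _ 1) ?invf_lt1 ?ltr1n //.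
Qed.

Lemma exhaust_gt0 (n : nat) (x : R) : exhaust n x -> 0 < x.
Proof. by rewrite /exhaust /= in_itv /= => /andP[h _]; rewrite (lt_le_trans _ h) // invr_gt0. Qed.

Lemma exhaust_near (x : R) : 0 < x -> \forall n \near \oo, exhaust n x.
Proof.
move=> x0; near=> n; rewrite /exhaust /= in_itv /=; apply/andP; split.
  rewrite invf_ple ?posrE // (@le_trans _ _ n%:R) ?ler_nat //; last by rewrite -addn2 leq_addr.
  by near: n; exact: nbhs_infty_ger.
rewrite (@le_trans _ _ n%:R) ?ler_nat //; last by rewrite -addn2 leq_addr.
by near: n; exact: nbhs_infty_ger.
Unshelve. all: by end_near. Qed.

Lemma measurable_exhaust n : measurable (exhaust n : set mR).
Proof. exact: measurable_itv. Qed.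

Lemma measurable_half_line : measurable (D : set mR).
Proof. exact: measurable_itv. Qed.

Lemma exhaust_sub n : exhaust n `<=` D.
Proof. by move=> x /exhaust_gt0 x0; rewrite /= in_itv /= x0. Qed.

Lemma exhaust_bigcup : D = \bigcup_n exhaust n.
Proof.
apply/seteqP; split=> x.
  rewrite /= in_itv /= andbT => /exhaust_near[n _ /(_ n (leqnn n)) h].
  by exists n.
by case=> n _ /exhaust_sub.
Qed.

Lemma exhaust_nondecreasing : nondecreasing_seq exhaust.
Proof.
move=> m n mn; apply/subsetPset => x; rewrite /exhaust /= !in_itv /= => /andP[h1 h2].
rewrite (le_trans _ h1) ?(le_trans h2) ?ler_nat //.
by rewrite lef_pV2 ?posrE // ler_nat.
Qed.

Lemma Rintegral_exhaust_cvg (f : R -> R) : mu.-integrable D (EFin \o f) ->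
  (\int[mu]_(x in exhaust n) f x) @[n --> \oo] --> \int[mu]_(x in D) f x.
Proof.
move=> intf; have mD := measurable_half_line.
have mf : measurable_fun (D : set mR) f by apply/measurable_EFinP; exact: measurable_int intf.
have h1 n : measurable_fun (D : set mR) (EFin \o (f \_ (exhaust n))).
  apply/measurable_EFinP/measurable_restrict => //; first exact: measurable_exhaust.
  by apply: measurable_funS mf => //; apply: subIsetl.
have h2 : measurable_fun (D : set mR) (EFin \o f) by exact/measurable_EFinP.
have h3 : {ae mu, forall x, D x -> (EFin \o (f \_ (exhaust n))) x @[n --> \oo] --> (EFin \o f) x}.
  apply: aeW => x; rewrite /= in_itv /= andbT => x0.
  apply: cvg_near_cst; near=> n; rewrite /= patchE mem_set //.
  by near: n; exact: exhaust_near.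
have h4 := integrable_abse intf.
have h5 : {ae mu, forall x n, D x ->
    (`|(EFin \o (f \_ (exhaust n))) x| <= (abse \o (EFin \o f)) x)%E}.
  apply: aeW => x n _; rewrite /= lee_fin patchE; case: ifP => _ //.
  by rewrite normr0.
have [_ _ h] := dominated_convergence mD h1 h2 h3 h4 h5.
move: h; rewrite -(fineK (integrable_fin_num mD intf)) => /fine_cvg h.
apply: cvg_trans h; apply: near_eq_cvg; near=> n => /=.
rewrite /Rintegral; congr fine; rewrite [LHS]integral_mkcond.
rewrite [RHS]integral_mkcond; apply: eq_integral => x _ /=.
rewrite !patchE; have [hx|hx] := boolP (x \in exhaust n); last by case: ifP.
by rewrite mem_set //; exact: (exhaust_sub (set_mem hx)).
Unshelve. all: by end_near. Qed.

(** Integration by parts on the half-line with vanishing boundary terms, in the form needed for the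
    functional equation of Gamma. *)
Lemma cintegral_derivative_eq0 (F f : R -> C) :
  (forall x, 0 < x -> is_cderive F x (f x)) -> (forall x, 0 < x -> ccont f x) ->
  cintegrable D f ->
  normc (F n.+2%:R) @[n --> \oo] --> (0 : R) ->
  normc (F n.+2%:R^-1) @[n --> \oo] --> (0 : R) ->
  cintegral D f = 0.
Proof.
move=> dF cf [if1 if2] Foo F0.
have E n : cintegral (exhaust n) f = F n.+2%:R - F n.+2%:R^-1.
  apply: cintegral_FTC; first exact: exhaust_lt.
    by move=> x hx; apply: dF; apply: (@exhaust_gt0 n); rewrite /exhaust /= in_itv.
  by move=> x hx; apply: cf; apply: (@exhaust_gt0 n); rewrite /exhaust /= in_itv.
have Z : (normc (F n.+2%:R) + normc (F n.+2%:R^-1)) @[n --> \oo] --> (0 : R).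
  by rewrite -[X in _ --> X]addr0; exact: cvgD.
have key (r : R^nat) (l : R) : r @ \oo --> l ->
    (forall n, `|r n| <= normc (F n.+2%:R) + normc (F n.+2%:R^-1)) -> l = 0.
  move=> rl rb; apply: (@cvg_unique _ _ (r @ \oo)) => //.
  apply: norm_cvg0; apply: (squeeze_cvgr _ (cvg_cst 0) Z).
  by apply: nearW => n; rewrite normr_ge0 rb.
rewrite /cintegral; congr (_ +i* _).
  apply: (key _ _ (Rintegral_exhaust_cvg if1)) => n.
  have -> : \int[mu]_(x in exhaust n) re_part f x = complex.Re (cintegral (exhaust n) f) by [].
  by rewrite (le_trans (ler_normc_Re _)) // E normcB_le.
apply: (key _ _ (Rintegral_exhaust_cvg if2)) => n.
have -> : \int[mu]_(x in exhaust n) im_part f x = complex.Im (cintegral (exhaust n) f) by [].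
by rewrite (le_trans (ler_normc_Im _)) // E normcB_le.
Qed.

Lemma ge0_integrable_exhaust (f : R -> R) (c : R) :
  (forall x, 0 < x -> 0 <= f x) -> (forall x, 0 < x -> {for x, continuous f}) ->
  (forall n, \int[mu]_(x in exhaust n) f x <= c) -> mu.-integrable D (EFin \o f).
Proof.
move=> f0 cf fc.
have intn n : mu.-integrable (exhaust n) (EFin \o f).
  apply: continuous_compact_integrable; first exact: segment_compact.
  apply: continuous_in_subspaceT => x /set_mem /exhaust_gt0; exact: cf.
have mf : measurable_fun (D : set mR) f.
  apply: open_continuous_measurable_fun; first exact: interval_open.
  by move=> x /set_mem; rewrite /= in_itv /= andbT; exact: cf.
apply/integrableP; split; first exact/measurable_EFinP.
have -> : (\int[mu]_(x in D) `|(EFin \o f) x| = \int[mu]_(x in D) (EFin \o f) x)%E.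
  apply: eq_integral => x /set_mem; rewrite /= in_itv /= andbT => /f0 h.
  by rewrite ger0_norm.
rewrite exhaust_bigcup.
have h : (\int[mu]_(x in exhaust n) (EFin \o f) x @[n --> \oo] -->
    \int[mu]_(x in \bigcup_n exhaust n) (EFin \o f) x)%E.
  apply: ge0_nondecreasing_set_cvg_integral => //.
  - exact: exhaust_nondecreasing.
  - exact: measurable_exhaust.
  - by move=> n; exact: measurable_int (intn n).
  - by move=> n x /exhaust_gt0 /f0; rewrite lee_fin.
apply: (@le_lt_trans _ _ c%:E); last exact: ltry.
rewrite -(cvg_lim _ h) //; apply: lime_le.
  exact: cvgP h.
apply: nearW => n; rewrite -(fineK (integrable_fin_num (measurable_exhaust n) (intn n))).
by rewrite lee_fin; exact: fc.
Qed.

End HalfLine.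

(** * Convergence of Euler's integral *)

Section EulerIntegral.
Variable R : realType.
Local Notation C := (R[i]).
Local Notation mu := (@lebesgue_measure R).
Local Notation D := (`]0%R, +oo[%classic : set R).
Local Notation mR := (measurableTypeR R).

(** With c = 2 (s + 1), the inequality ln (x / c) <= x / c gives s ln x <= s ln c + s x / c, and s /
    c <= 1 / 2. Using s + 1 rather than s keeps c positive at s = 0. *)
Lemma powR_le_expR (s x : R) : 0 <= s -> 0 < x ->
  x `^ s <= (2 * (s + 1)) `^ s * expR (x / 2).
Proof.
move=> s0 x0; have c0 : 0 < 2 * (s + 1) by rewrite mulr_gt0 // ltr_wpDl.
rewrite /powR !gt_eqF // -expRD ler_expR.
have y0 : 0 < x / (2 * (s + 1)) by rewrite divr_gt0.
have -> : ln x = ln (x / (2 * (s + 1))) + ln (2 * (s + 1)).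
  by rewrite -lnM ?posrE // divfK // gt_eqF.
rewrite mulrDr addrC lerD2l.
apply: (@le_trans _ _ (s * (x / (2 * (s + 1))))).
  by rewrite ler_wpM2l // ltW // ln_sublinear.
have -> : s * (x / (2 * (s + 1))) = x / 2 * (s / (s + 1)).
  by field; rewrite gt_eqF // ltr_wpDl.
apply: ler_piMr; first by rewrite divr_ge0 // ltW.
by rewrite ler_pdivrMr ?ltr_wpDl // mul1r lerDl.
Qed.

Definition gam (s x : R) : R := x `^ s * expR (- x).

Lemma gam_le (s x : R) : 0 <= s -> 0 < x -> gam s x <= (2 * (s + 1)) `^ s * expR (- (x / 2)).
Proof.
move=> s0 x0; rewrite /gam (_ : - x = - (x / 2) - x / 2); last by field.
rewrite expRD mulrCA [leRHS]mulrC ler_wpM2l ?expR_ge0 //.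
rewrite expRN ler_pdivrMr ?expR_gt0 //; exact: powR_le_expR.
Qed.

Lemma gam_ge0 (s x : R) : 0 <= gam s x.
Proof. by rewrite mulr_ge0 ?powR_ge0 ?expR_ge0. Qed.

Lemma continuous_gam (s x : R) : 0 < x -> {for x, continuous (gam s)}.
Proof.
move=> x0.
have c1 : {for x, continuous (fun y : R => y `^ s)}.
  apply: differentiable_continuous; apply/derivable1_diffP.
  by apply: derivable_powR; rewrite in_itv /= andbT.
apply: cvgM; first exact: c1.
by apply: continuous_comp; [exact: opp_continuous|exact: continuous_expR].
Qed.

Lemma is_derive_gam (s x : R) : 0 < x -> is_derive x (1 : R) (gam s) (s * gam (s - 1) x - gam s x).
Proof.
move=> x0.
have e1 : is_derive x (1 : R) (fun y => expR (- y)) (- expR (- x)).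
  have := @is_derive1_comp R expR -%R x (expR (- x)) (-1) _ _.
  by rewrite mulrN1; exact.
have e0 : is_derive x (1 : R) (fun y => y `^ s) (s * x `^ (s - 1)) by exact: is_derive1_powR.
rewrite (_ : gam s = (fun y => y `^ s) * (fun y => expR (- y))) //.
by apply: is_derive_eq; rewrite /GRing.scale /gam /= ?fctE; ring.
Qed.

Lemma gam_cvg_pinfty (s : R) : 0 <= s -> gam s n.+2%:R @[n --> \oo] --> (0 : R).
Proof.
move=> s0; pose c := (2 * (s + 1)) `^ s.
have c0 : 0 <= c by exact: powR_ge0.
have Z : (c * 2 * n.+1%:R^-1) @[n --> \oo] --> (0 : R).
  by rewrite -[X in _ --> X](mulr0 (c * 2)); apply: cvgM; [exact: cvg_cst|exact: cvg_harmonic].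
apply: (squeeze_cvgr _ (cvg_cst 0) Z); apply: nearW => n; rewrite gam_ge0 /=.
rewrite (le_trans (gam_le s0 _)) // -mulrA ler_wpM2l // expRN.
rewrite -[leRHS]invrK lef_pV2 ?posrE ?expR_gt0 ?invr_gt0 ?mulr_gt0 ?invr_gt0 //.
rewrite invfM invrK mulrC; apply: le_trans (expR_ge1Dx _).
by rewrite ler_wpDl // ler_wpM2r // ler_nat.
Qed.

Lemma gam_cvg_0 (s : R) : 0 < s -> gam s n.+2%:R^-1 @[n --> \oo] --> (0 : R).
Proof.
move=> s0.
have h : (n.+2%:R^-1 `^ s : R) @[n --> \oo] --> (0 : R).
  have /cvg_at_rightP := powR_cvg0 s0; apply; split=> [n|]; first by rewrite invr_gt0.
  apply: (squeeze_cvgr _ (cvg_cst 0) (@cvg_harmonic R)); apply: nearW => n.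
  by rewrite invr_ge0 ler0n /= lef_pV2 ?posrE // ler_nat.
apply: (squeeze_cvgr _ (cvg_cst 0) h); apply: nearW => n; rewrite gam_ge0 /=.
by rewrite ler_piMr ?powR_ge0 // -expR0 ler_expR oppr_le0 invr_ge0.
Qed.
(** Integration by parts on a truncated half-line, used to carry integrability from the exponent s
    down to s - 1. *)
Lemma Rintegral_gam_le (s : R) n : 0 < s ->
  \int[mu]_(x in exhaust n) (s * gam (s - 1) x) =
  gam s n.+2%:R - gam s n.+2%:R^-1 + \int[mu]_(x in exhaust n) gam s x.
Proof.
move=> s0.
have ie r : mu.-integrable (exhaust n) (EFin \o gam r).
  apply: continuous_compact_integrable; first exact: segment_compact.
  by apply: continuous_in_subspaceT => x /set_mem /exhaust_gt0; exact: continuous_gam.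
have ie' : mu.-integrable (exhaust n) (EFin \o (fun x => s * gam (s - 1) x)).
  have mE := @measurable_exhaust R n.
  by apply: (eq_integrable mE _ _ _ (integrableZl mE s (ie (s - 1)))) => x _.
have h := @cintegral_FTC R (fun x => (gam s x)%:C)
  (fun x => (s * gam (s - 1) x - gam s x)%:C) _ _ (exhaust_lt R n) _ _.
have /(congr1 (@complex.Re R)) : cintegral (exhaust n) (fun x => (s * gam (s - 1) x - gam s x)%:C)
    = (gam s n.+2%:R)%:C - (gam s n.+2%:R^-1)%:C.
  apply: h => x hx; have x0 : 0 < x by apply: (@exhaust_gt0 R n); rewrite /exhaust /= in_itv.
    by apply: is_cderive_real; exact: is_derive_gam.
  split; last exact: cst_continuous.
  apply: cvgB; last exact: continuous_gam.
  by apply: cvgM; [exact: cvg_cst|exact: continuous_gam].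
rewrite /= RintegralB //; last exact: measurable_exhaust.
by move=> <-; rewrite subrK.
Qed.

(** For nonnegative exponents half of the exponential absorbs the power. The remaining ones follow
    from the exponent s + 1 > 0, since integration by parts bounds the truncated integrals
    uniformly. *)
Lemma integrable_gam (s : R) : -1 < s -> mu.-integrable D (EFin \o gam s).
Proof.
have pos (r : R) : 0 <= r -> mu.-integrable D (EFin \o gam r).
  move=> r0; pose c := (2 * (r + 1)) `^ r.
  apply: (@ge0_integrable_exhaust R (gam r) (c * 2)).
  - by move=> x _; exact: gam_ge0.
  - by move=> x; exact: continuous_gam.
  move=> n.
  have ie : mu.-integrable (exhaust n) (EFin \o gam r).
    apply: continuous_compact_integrable; first exact: segment_compact.
    by apply: continuous_in_subspaceT => x /set_mem /exhaust_gt0; exact: continuous_gam.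
  have dE x : is_derive x (1 : R) (fun y => - (c * 2) * expR (- (y / 2))) (c * expR (- (x / 2))).
    have e0 : is_derive x (1 : R) (fun y => - (y / 2)) (- 2^-1).
      rewrite (_ : (fun y => _) = (- 2^-1) *: (@id R)).
        by apply: is_derive_eq; rewrite /GRing.scale /= mulr1.
      by apply/funext => y; rewrite fctE /GRing.scale /= mulNr mulrC.
    have e1 : is_derive x (1 : R) (fun y => expR (- (y / 2))) (expR (- (x / 2)) * - 2^-1).
      exact: (is_derive1_comp (f := expR)).
    rewrite (_ : (fun y => _) = (- (c * 2)) *: (fun y => expR (- (y / 2)))) //.
    by apply: is_derive_eq; rewrite /GRing.scale /=; field.
  have cE x : {for x, continuous (fun y : R => c * expR (- (y / 2)))}.
    apply: cvgM; first exact: cvg_cst.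
    apply: continuous_comp; last exact: continuous_expR.
    by apply: cvgN; apply: cvgM; [exact: cvg_id|exact: cvg_cst].
  have h := @cintegral_FTC R (fun x => (- (c * 2) * expR (- (x / 2)))%:C)
    (fun x => (c * expR (- (x / 2)))%:C) _ _ (exhaust_lt R n)
    (fun x _ => is_cderive_real (dE x)) (fun x _ => conj (cE x) (@cst_continuous _ _ 0 x)).
  have {}h := congr1 (@complex.Re R) h.
  have iE : mu.-integrable (exhaust n) (EFin \o (fun x => c * expR (- (x / 2)))).
    apply: continuous_compact_integrable; first exact: segment_compact.
    by apply: continuous_in_subspaceT => x _; exact: cE.
  apply: le_trans (_ : \int[mu]_(x in exhaust n) (c * expR (- (x / 2))) <= _).
    apply: le_Rintegral => //; first exact: measurable_exhaust.
    by move=> x /exhaust_gt0; exact: gam_le.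
  rewrite [leLHS]h /= mulNr addrC mulNr opprK.
  have c0 : 0 <= c * 2 by rewrite mulr_ge0 ?powR_ge0.
  rewrite lerBlDr (@le_trans _ _ (c * 2)) //.
    by rewrite ler_piMr // -expR0 ler_expR oppr_le0 divr_ge0 ?invr_ge0.
  by rewrite lerDl mulr_ge0 ?expR_ge0.
move=> s1; have s10 : 0 < s + 1 by rewrite -ltrBlDr sub0r.
have i1 := pos (s + 1) (ltW s10).
have mD := @measurable_half_line R.
pose c := (2 * (s + 1 + 1)) `^ (s + 1).
apply: (@ge0_integrable_exhaust R (gam s) ((s + 1)^-1 * (c + \int[mu]_(x in D) gam (s + 1) x))).
- by move=> x _; exact: gam_ge0.
- by move=> x; exact: continuous_gam.
move=> n.
have ie r : mu.-integrable (exhaust n) (EFin \o gam r).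
  apply: continuous_compact_integrable; first exact: segment_compact.
  by apply: continuous_in_subspaceT => x /set_mem /exhaust_gt0; exact: continuous_gam.
rewrite mulrC ler_pdivlMr // -RintegralZr //; last exact: measurable_exhaust.
have := Rintegral_gam_le n s10; rewrite addrK => E.
under eq_Rintegral do rewrite mulrC.
rewrite E lerD //.
  rewrite (@le_trans _ _ (gam (s + 1) n.+2%:R)) // ?gerBl ?gam_ge0 //.
  apply: le_trans (gam_le (ltW s10) _) _ => //; apply: ler_piMr; first exact: powR_ge0.
  by rewrite -expR0 ler_expR oppr_le0 divr_ge0.
rewrite -lee_fin /Rintegral !fineK ?integrable_fin_num //; try exact: measurable_exhaust.
apply: ge0_subset_integral => //.
- exact: measurable_exhaust.
- exact: measurable_int i1.
- by move=> x _; rewrite lee_fin gam_ge0.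
- exact: exhaust_sub.
- exact: ie.
Qed.

End EulerIntegral.

(** * The functional equation and the continuation of Gamma *)

Section EulerFunctionalEquation.
Variable R : realType.
Local Notation C := (R[i]).
Local Notation mu := (@lebesgue_measure R).
Local Notation D := (`]0%R, +oo[%classic : set R).
Local Notation mR := (measurableTypeR R).

Lemma cexpD (v w : C) : cexp (v + w) = cexp v * cexp w.
Proof.
rewrite /cexp ReD ImD expRD cosD sinD; apply/eqP; rewrite eq_complex /=.
by apply/andP; split; apply/eqP; ring.
Qed.

Lemma cpowD (x : R) (v w : C) : 0 < x -> cpow x (v + w) = cpow x v * cpow x w.
Proof. by move=> x0; rewrite !cpow_cexp // mulrDl cexpD. Qed.

Lemma cpowM (x y : R) (w : C) : 0 < x -> 0 < y -> cpow (x * y) w = cpow x w * cpow y w.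
Proof.
by move=> x0 y0; rewrite !cpow_cexp ?mulr_gt0 // lnM ?posrE // rmorphD mulrDr cexpD.
Qed.

Lemma cpow1 (x : R) : 0 < x -> cpow x 1 = x%:C.
Proof. by move=> x0; rewrite -[1]/(1%:C) cpow_real powRr1 // ltW. Qed.

Lemma cpow_one (w : C) : cpow 1 w = 1 :> C.
Proof. by rewrite cpow_cexp // ln1 mulr0 cexp0. Qed.

Lemma normc_cpow (x : R) (w : C) : 0 < x -> normc (cpow x w) = x `^ complex.Re w.
Proof. by move=> x0; rewrite cpow_cexp // normc_cexp ReMr /powR gt_eqF. Qed.

Lemma cpow_neq0 (x : R) (w : C) : 0 < x -> cpow x w != 0.
Proof. by move=> x0; rewrite -normc_gt0 normc_cpow // powR_gt0. Qed.

Lemma near_eq_is_cderive (f g : R -> C) (t : R) d :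
  (\forall u \near t, f u = g u) -> is_cderive f t d -> is_cderive g t d.
Proof.
move=> fg [f1 f2]; split.
  by apply: near_eq_is_derive f1; near=> u; rewrite /re_part; congr complex.Re; near: u.
by apply: near_eq_is_derive f2; near=> u; rewrite /im_part; congr complex.Im; near: u.
Unshelve. all: by end_near. Qed.

Lemma is_cderive_cpow (x : R) (w : C) : 0 < x ->
  is_cderive (fun y => cpow y w) x (w * cpow x (w - 1)).
Proof.
move=> x0.
apply: (near_eq_is_cderive (f := fun y => cexp ((ln y)%:C * w))).
  near=> y; rewrite cpow_cexp 1?mulrC //.
  by near: y; exact: lt_nbhsr.
have [h1 h2] := is_cderive_cexp w (ln x).
have e : is_derive x (1 : R) (@ln R) x^-1 by exact: is_derive1_ln.
have -> : w * cpow x (w - 1) = w * cexp ((ln x)%:C * w) * (x^-1)%:C.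
  rewrite -mulrA; congr (_ * _).
  have : cpow x (w - 1) * x%:C = cexp ((ln x)%:C * w).
    by rewrite -(cpow1 x0) -cpowD // subrK cpow_cexp // mulrC.
  by move=> <-; rewrite -mulrA -rmorphM /= divff ?gt_eqF // mulr1.
split; rewrite ?ReMr ?ImMr.
  exact: (is_derive1_comp (f := re_part (fun u => cexp (u%:C * w)))).
exact: (is_derive1_comp (f := im_part (fun u => cexp (u%:C * w)))).
Unshelve. all: by end_near. Qed.

Lemma ccont_cpow (x : R) (w : C) : 0 < x -> ccont (fun y => cpow y w) x.
Proof. by move=> x0; exact: is_cderive_ccont (is_cderive_cpow w x0). Qed.

Let ker (w : C) (x : R) : C := cpow x w * (expR (- x))%:C.

Lemma is_cderive_ker (w : C) (x : R) : 0 < x ->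
  is_cderive (ker w) x (w * ker (w - 1) x - ker w x).
Proof.
move=> x0.
have e1 : is_derive x (1 : R) (fun y => expR (- y)) (- expR (- x)).
  have := @is_derive1_comp R expR -%R x (expR (- x)) (-1) _ _.
  by rewrite mulrN1; exact.
apply: is_cderive_eq; first exact: is_cderiveM (is_cderive_cpow w x0) (is_cderive_real e1).
by rewrite /ker rmorphN /=; ring.
Qed.

Lemma normc_ker (w : C) (x : R) : 0 < x -> normc (ker w x) = gam (complex.Re w) x.
Proof. by move=> x0; rewrite normcM normc_cpow // normc_real ger0_norm ?expR_ge0. Qed.

Lemma ccont_half_line_integrable (f : R -> C) (G : R -> R) :
  (forall x, 0 < x -> ccont f x) -> mu.-integrable D (EFin \o G) ->
  (forall x, 0 < x -> normc (f x) <= G x) -> cintegrable D f.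
Proof.
move=> cf iG fG; have mD := @measurable_half_line R.
have op : open (D : set R) by exact: interval_open.
apply: (@cintegrable_dominated R D mD f G) => //.
- apply: open_continuous_measurable_fun => // x /set_mem.
  by rewrite /= in_itv /= andbT => /cf[].
- apply: open_continuous_measurable_fun => // x /set_mem.
  by rewrite /= in_itv /= andbT => /cf[].
- by move=> x /=; rewrite in_itv /= andbT; exact: fG.
Qed.

Lemma cintegrable_ker (w : C) : -1 < complex.Re w -> cintegrable D (ker w).
Proof.
move=> w1; apply: (@ccont_half_line_integrable _ (gam (complex.Re w))).
- move=> x x0; exact: is_cderive_ccont (is_cderive_ker w x0).
- exact: integrable_gam.
- by move=> x x0; rewrite normc_ker.
Qed.

Lemma euler_integralE (w : C) : euler_integral w = cintegral D (ker (w - 1)).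
Proof. by []. Qed.

(** The difference of the two integrands is, up to sign, the derivative of x ^ w e ^ (-x), which
    tends to 0 at both ends. *)
Lemma euler_integralS (w : C) : 0 < complex.Re w ->
  euler_integral (w + 1) = w * euler_integral w.
Proof.
move=> w0; rewrite !euler_integralE addrK; have mD := @measurable_half_line R.
have w1 : -1 < complex.Re w by rewrite (lt_trans _ w0) // oppr_lt0.
have w2 : -1 < complex.Re (w - 1) by rewrite ReD ReN /= ltrBrDl subrr.
have i1 := cintegrable_ker w1; have i2 := cintegrable_ker w2.
apply/eqP; rewrite eq_sym -subr_eq0 -cintegralZ // -cintegralB //; last exact: cintegrableZ.
apply/eqP; apply: (@cintegral_derivative_eq0 _ (ker w)).
- by move=> x x0; exact: is_cderive_ker.
- move=> x x0; apply: ccontD.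
    apply: ccontM; first exact: ccont_cst.
    exact: is_cderive_ccont (is_cderive_ker (w - 1) x0).
  have [h1 h2] := is_cderive_ccont (is_cderive_ker w x0).
  have [k1 k2] := ccontM (ccont_cst (-1) x) (conj h1 h2).
  by split; [move: k1|move: k2]; rewrite (_ : (fun u => -1 * ker w u) = fun u => - ker w u) //;
    apply/funext => u; rewrite mulN1r.
- by apply: cintegrableB => //; exact: cintegrableZ.
- under eq_cvg do rewrite normc_ker //.
  exact/gam_cvg_pinfty/ltW.
- under eq_cvg do rewrite normc_ker ?invr_gt0 //.
  exact: gam_cvg_0.
Qed.

Lemma euler_integral_shift (w : C) (n : nat) : 0 < complex.Re w ->
  euler_integral (w + n%:R) = poch w n * euler_integral w.
Proof.
move=> w0; elim: n => [|n IH]; first by rewrite addr0 /poch big_ord0 mul1r.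
rewrite -natr1 addrA euler_integralS; last first.
  by rewrite ReD -(rmorph_nat (real_complex R)) /= ltr_wpDr.
by rewrite IH /poch big_ord_recr /=; ring.
Qed.

Lemma poch_neq0 (w : C) (n : nat) : 0 < complex.Re w -> poch w n != 0.
Proof.
move=> w0; apply/prodf_neq0 => i _; apply/eqP => /(congr1 (@complex.Re R)).
by rewrite ReD -(rmorph_nat (real_complex R)) /= => /eqP; rewrite gt_eqF // ltr_wpDr.
Qed.

Lemma poch_add (w : C) (m n : nat) : poch w (m + n) = poch w m * poch (w + m%:R) n.
Proof.
rewrite /poch big_split_ord; congr (_ * _); apply: eq_bigr => i _.
by rewrite /= natrD addrA.
Qed.

(** The continuation does not depend on the number of steps, so a single m can serve a whole bounded
    set. At the poles both sides are 0 by the convention 1 / 0 = 0. *)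
Lemma GammaE (w : C) (m : nat) : 0 < complex.Re w + m%:R ->
  Gamma w = euler_integral (w + m%:R) / poch w m.
Proof.
move=> w0; rewrite /Gamma; set n := Num.truncn _.
have nm : (n <= m)%N by rewrite /n truncn_le_nat -natr1 addrC; lra.
have Rn : 0 < complex.Re (w + n%:R).
  rewrite ReD -(rmorph_nat (real_complex R)) /=.
  have := truncnS_gt (1 - complex.Re w); rewrite -/n -natr1.
  by lra.
rewrite -{1 2}(subnKC nm) natrD addrA (euler_integral_shift (m - n) Rn) poch_add.
have p0 : poch (w + n%:R) (m - n) != 0 by exact: poch_neq0.
have [->|q0] := eqVneq (poch w n) 0; first by rewrite mul0r !invr0 !mulr0.
by field; rewrite p0 q0.
Qed.

End EulerFunctionalEquation.

(** * Gauss's limit formula, uniformly on bounded sets *)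

Section GammaAsymptotics.
Variable R : realType.
Local Notation C := (R[i]).
Local Notation mu := (@lebesgue_measure R).
Local Notation D := (`]0%R, +oo[%classic : set R).
Local Notation mR := (measurableTypeR R).
Let mD : measurable (D : set mR) := @measurable_half_line R.

Lemma powR_ge1 (x s : R) : 1 <= x -> 0 <= s -> 1 <= x `^ s.
Proof. by move=> x1 s0; rewrite -[leLHS](powRr0 x) ler_powR. Qed.

Lemma powR_le1 (x s : R) : 0 < x <= 1 -> 0 <= s -> x `^ s <= 1.
Proof. by move=> x1 s0; rewrite -[leRHS](powRr0 x) ger_powR. Qed.

Definition rgamma (s : R) : R := \int[mu]_(x in D) gam (s - 1) x.

Lemma rgammaE (s : R) : rgamma s = \int[mu]_(x in D) gam (s - 1) x.
Proof. by []. Qed.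

Lemma euler_integral_real (s : R) : euler_integral s%:C = (rgamma s)%:C.
Proof.
have E x : D x -> cpow x (s%:C - 1) * (expR (- x))%:C = (gam (s - 1) x)%:C.
  by move=> Dx; rewrite -(rmorphB (real_complex R) _ 1) cpow_real /gam rmorphM.
rewrite /euler_integral /mellin (eq_cintegral E) /cintegral /rgamma /=.
by congr (_ +i* _); rewrite Rintegral_cst // mul0r.
Qed.

Lemma Gamma_real (s : R) : 0 < s -> Gamma s%:C = (rgamma s)%:C.
Proof.
move=> s0; rewrite (@GammaE _ _ 0) /= ?addr0 // /poch big_ord0 divr1.
exact: euler_integral_real.
Qed.

Lemma poch_real (s : R) (n : nat) : poch s%:C n = (\prod_(i < n) (s + i%:R))%:C.
Proof.
rewrite /poch rmorph_prod; apply: eq_bigr => i _.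
by rewrite rmorphD rmorph_nat.
Qed.

Lemma rgamma_shift (s : R) (n : nat) : 0 < s ->
  rgamma (s + n%:R) = (\prod_(i < n) (s + i%:R)) * rgamma s.
Proof.
move=> s0; apply: (@complexI R); rewrite rmorphM /= -!euler_integral_real -poch_real.
by rewrite -euler_integral_shift // rmorphD rmorph_nat.
Qed.

Lemma rgamma_gt0 (s : R) : 0 < s -> 0 < rgamma s.
Proof.
(* A lower bound of the integrand on [1, 2]: the power is least at 1 or at 2 according to the sign
   of s - 1. *)
move=> s0; pose m := Num.min 1 (2 `^ (s - 1)) * expR (- 2).
have m0 : 0 < m by rewrite mulr_gt0 ?expR_gt0 // lt_min ltr01 powR_gt0.
have is1 : mu.-integrable D (EFin \o gam (s - 1)).
  by apply: integrable_gam; rewrite ltrBrDl subrr.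
have sub : (`[1, 2]%classic : set R) `<=` D.
  by move=> x /=; rewrite !in_itv /= andbT => /andP[h _]; rewrite (lt_le_trans _ h).
have m12 : measurable (`[1, 2]%classic : set mR) by exact: measurable_itv.
have is2 : mu.-integrable (`[1, 2]%classic : set R) (EFin \o gam (s - 1)).
  exact: integrableS is1.
have im : mu.-integrable (`[1, 2]%classic : set R) (EFin \o (fun=> m)).
  by apply: continuous_compact_integrable; [exact: segment_compact|move=> ?; exact: cvg_cst].
apply: (@lt_le_trans _ _ (\int[mu]_(x in `[1, 2]) m)).
  rewrite Rintegral_cst //= lebesgue_measure_itv /= lte_fin ltr1n /=.
  by rewrite (_ : 2 - 1 = 1 :> R) ?mulr1 //; ring.
apply: (@le_trans _ _ (\int[mu]_(x in `[1, 2]) gam (s - 1) x)).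
  apply: le_Rintegral => // x; rewrite /= in_itv /= => /andP[x1 x2].
  have x0 : 0 < x by rewrite (lt_le_trans _ x1).
  rewrite /m /gam ler_pM ?expR_ge0 ?le_min ?ler01 ?powR_ge0 //; last by rewrite ler_expR lerN2.
  rewrite ge_min; have [h|h] := leP 1 s.
    by rewrite powR_ge1 // subr_ge0.
  apply/orP; right; rewrite -[s - 1]opprK !(powRN _ (- (s - 1))) lef_pV2 ?posrE ?powR_gt0 //.
  by rewrite ge0_ler_powR ?opprB ?subr_ge0 ?(ltW h) ?nnegrE // ltW.
rewrite -lee_fin /Rintegral !fineK ?integrable_fin_num //.
apply: ge0_subset_integral => //; first exact: measurable_int is1.
by move=> x _; rewrite lee_fin gam_ge0.
Qed.

Let gamMX (n k : nat) (x : R) : 0 < x ->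
  gam n%:R x * x ^+ k = gam (n + k)%:R x.
Proof. by move=> x0; rewrite /gam !powR_mulrn ?ltW // exprD; ring. Qed.

(** Rescaled by n + 1, the normalized density x ^ n e ^ (-x) has k-th moment \prod_(i < k) (1 + i /
    (n + 1)), which tends to 1. Against polynomials it therefore tends to the unit mass at 1. *)
Lemma gamma_moment_cvg (p : {poly R}) :
  (rgamma n.+1%:R)^-1 * (\int[mu]_(x in D) (gam n%:R x * p.[x / n.+1%:R])) @[n --> \oo]
    --> p.[1].
Proof.
have gn0 n : rgamma n.+1%:R != 0 by rewrite gt_eqF // rgamma_gt0.
have E n : (rgamma n.+1%:R)^-1 * (\int[mu]_(x in D) (gam n%:R x * p.[x / n.+1%:R])) =
    \sum_(k < size p) p`_k * \prod_(i < k) (1 + i%:R / n.+1%:R).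
  have -> : \int[mu]_(x in D) (gam n%:R x * p.[x / n.+1%:R]) =
      \int[mu]_(x in D) (\sum_(k < size p) (p`_k / n.+1%:R ^+ k) * gam (n + k)%:R x).
    apply: eq_Rintegral => x /set_mem /=; rewrite in_itv /= andbT => x0.
    rewrite horner_coef mulr_sumr; apply: eq_bigr => k _.
    by rewrite -gamMX // expr_div_n; ring.
  rewrite (Rintegral_sum _ _ mD _).2; last first.
    by move=> k; apply: integrable_gam; rewrite (lt_le_trans _ (ler0n _ _)) // oppr_lt0.
  rewrite mulr_sumr; apply: eq_bigr => k _.
  have -> : \int[mu]_(x in D) gam (n + k)%:R x = rgamma (n.+1%:R + k%:R).
    by rewrite /rgamma; congr Rintegral; apply/funext => x; rewrite -natrD addSn -natr1 addrK.
  rewrite rgamma_shift //.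
  have -> : \prod_(i < k) (1 + i%:R / n.+1%:R) = (\prod_(i < k) (n.+1%:R + i%:R)) / n.+1%:R ^+ k :> R.
    have -> : n.+1%:R ^+ k = \prod_(i < k) n.+1%:R :> R by rewrite prodr_const card_ord.
    rewrite -prodf_div; apply: eq_bigr => i _.
    by rewrite mulrDl divff.
  by field; rewrite expf_neq0 // gn0.
under eq_cvg do rewrite E.
rewrite horner_coef.
have cprod k : \prod_(i < k) (1 + i%:R / n.+1%:R) @[n --> \oo] --> (1 : R).
  elim: k => [|k IH].
    by under eq_cvg do rewrite big_ord0; exact: cvg_cst.
  have L : (1 + k%:R / n.+1%:R) @[n --> \oo] --> (1 : R).
    have h1 : (k%:R / n.+1%:R) @[n --> \oo] --> (k%:R * 0 : R).
      by apply: cvgM; [exact: cvg_cst|exact: cvg_harmonic].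
    have h2 : (1 + k%:R / n.+1%:R) @[n --> \oo] --> (1 + k%:R * 0 : R).
      by apply: cvgD => //; exact: cvg_cst.
    by rewrite mulr0 addr0 in h2.
  have h : (\prod_(i < k) (1 + i%:R / n.+1%:R) * (1 + k%:R / n.+1%:R)) @[n --> \oo]
      --> (1 * 1 : R) by apply: cvgM.
  by under eq_cvg do rewrite big_ord_recr /=; rewrite mulr1 in h.
have csum m : (\sum_(k < m) p`_k * \prod_(i < k) (1 + i%:R / n.+1%:R)) @[n --> \oo]
    --> (\sum_(k < m) p`_k * 1 : R).
  elim: m => [|m IH].
    rewrite big_ord0 (_ : (fun n => _) = (fun=> 0)); first exact: cvg_cst.
    by apply/funext => n; rewrite big_ord0.
  rewrite big_ord_recr (_ : (fun n => _) = (fun n =>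
    \sum_(k < m) p`_k * \prod_(i < k) (1 + i%:R / n.+1%:R) +
    p`_m * \prod_(i < m) (1 + i%:R / n.+1%:R))); last first.
    by apply/funext => n; rewrite big_ord_recr.
  by apply: cvgD => //; apply: cvgM; [exact: cvg_cst|exact: cprod].
have -> : \sum_(i < size p) p`_i * 1 ^+ i = \sum_(k < size p) p`_k * 1 :> R.
  by apply: eq_bigr => k _; rewrite expr1n.
exact: csum.
Qed.

(** The derivative w u ^ (w - 1) is integrated along the segment from 1 to y. There |u ^ (w - 1)| is
    at most 1 if u <= 1 and at most y ^ M otherwise, because 0 <= Re w - 1 <= M. *)
Lemma cpow_sub1_le (y : R) (w : C) (M : nat) : 0 < y ->
  1 <= complex.Re w <= M%:R ->
  normc (cpow y w - 1) <= 2 * (normc w * (1 + y ^+ M) * `|y - 1|).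
Proof.
move=> y0 /andP[w1 wM].
pose u (v : R) := v * (y - 1) + 1.
have u0 (v : R) : 0 <= v <= 1 -> 0 < u v by rewrite /u => /andP[v0 v1]; nra.
have uy (v : R) : 0 <= v <= 1 -> u v <= Num.max 1 y.
  rewrite /u => /andP[v0 v1]; rewrite le_max; have [h|h] := leP 1 y.
    by apply/orP; right; nra.
  by apply/orP; left; nra.
have du v : is_derive v (1 : R) u (y - 1).
  rewrite /u (_ : (fun v => _) = (y - 1) *: (@id R) + cst 1).
    by apply: is_derive_eq; rewrite /GRing.scale /= mulr1 addr0.
  by apply/funext => z; rewrite !fctE /GRing.scale /= mulrC.
pose F v := cpow (u v) w.
have dF v : 0 <= v <= 1 -> is_cderive F v (w * cpow (u v) (w - 1) * (y - 1)%:C).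
  move=> hv; have [h1 h2] := is_cderive_cpow w (u0 v hv).
  split; rewrite ?ReMr ?ImMr.
    exact: (is_derive1_comp (f := re_part (fun z => cpow z w))).
  exact: (is_derive1_comp (f := im_part (fun z => cpow z w))).
have cF v : 0 <= v <= 1 -> ccont (fun v => w * cpow (u v) (w - 1) * (y - 1)%:C) v.
  move=> hv; apply: ccontM; last exact: ccont_cst.
  apply: ccontM; first exact: ccont_cst.
  have [h1 h2] := ccont_cpow (w - 1) (u0 v hv).
  have cu : {for v, continuous u}.
    by apply: differentiable_continuous; apply/derivable1_diffP; have [] := du v.
  split.
    exact: (@continuous_comp _ _ _ u (re_part (fun z => cpow z (w - 1)))).
  exact: (@continuous_comp _ _ _ u (im_part (fun z => cpow z (w - 1)))).
have := cintegral_FTC ltr01 dF cF.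
rewrite /F /u mul1r subrK mul0r add0r cpow_one => <-.
set c := normc w * _ * _.
have <- : \int[mu]_(v in `[0, 1]) c = c.
  by rewrite Rintegral_cst //= lebesgue_measure_itv /= lte_fin ltr01 /= subr0 mulr1.
apply: normc_cintegral_le.
- exact: measurable_itv.
- exact: ccont_cintegrable.
- by apply: continuous_compact_integrable; [exact: segment_compact|move=> ?; exact: cvg_cst].
move=> v /=; rewrite in_itv /= => hv.
rewrite (normcM (w * _)) (normcM w) normc_real normc_cpow ?u0 // ler_wpM2r // ler_wpM2l ?normc_ge0 //.
rewrite ReD ReN /=; have := uy v hv; rewrite le_max => /orP[h|h].
  rewrite (@le_trans _ _ 1) ?lerDl ?exprn_ge0 ?(ltW y0) //.
  by rewrite powR_le1 ?subr_ge0 ?u0 //.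
have [u1|u1] := leP (u v) 1.
  rewrite (@le_trans _ _ 1) ?lerDl ?exprn_ge0 ?(ltW y0) //.
  by rewrite powR_le1 ?subr_ge0 ?u0 //.
rewrite (@le_trans _ _ (y ^+ M)) ?lerDr //.
have s1 : u v `^ (complex.Re w - 1) <= u v `^ M%:R.
  by rewrite ler_powR ?(ltW u1) // lerBlDr (le_trans wM) // lerDl.
rewrite (le_trans s1) // -powR_mulrn ?(ltW y0) // ge0_ler_powR // nnegrE ltW //.
exact: u0.
Qed.

(* Gauss's limit Gamma (w + n) ~ Gamma (n) n ^ w: rescaled by n, the Gamma density
   concentrates at 1. *)
Lemma euler_integral_ratio_cvg (M : nat) (delta : R) : 0 < delta ->
  exists n : nat, forall w : C, 1 <= complex.Re w -> normc w <= M%:R ->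
    normc (euler_integral (w + n.+1%:R) / ((rgamma n.+1%:R)%:C * cpow n.+1%:R w) - 1) <= delta.
Proof.
(* The final estimate is 2 M times 3 eps: the 2 stems from [normc_cintegral_le], and 3 eps is the
   limit 2 eps plus the tolerance eps. The 1 keeps the denominator positive for M = 0. *)
move=> d0; pose eps := delta / (6 * M%:R + 1).
have c0 : 0 < 6 * M%:R + 1 :> R by rewrite ltr_wpDl ?mulr_ge0.
have eps0 : 0 < eps by rewrite divr_gt0.
(* The bound of [cpow_sub1_le] contains |y - 1|; the inequality 2 |y - 1| <= eps + (y - 1) ^ 2 / eps
   replaces it by a polynomial, so that moments suffice. At 1 this polynomial is only 2 eps. *)
pose p : {poly R} := (1 + 'X^M) * (eps%:P + (eps^-1)%:P * ('X - 1) ^+ 2).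
have pE y : p.[y] = (1 + y ^+ M) * (eps + eps^-1 * (y - 1) ^+ 2).
  by rewrite /p !(hornerM, hornerD, hornerXn, hornerC, horner_exp, hornerN, hornerX).
have := @gamma_moment_cvg p.
have -> : p.[1] = 2 * eps by rewrite pE expr1n subrr; ring.
move=> /cvgrPdist_le /(_ _ eps0)[n _ /(_ n (leqnn n))].
set I := \int[mu]_(x in D) _ => hI.
have {}hI : (rgamma n.+1%:R)^-1 * I <= 3 * eps.
  by move: hI; rewrite ler_norml => /andP[]; lra.
exists n => w w1 wM.
have wRe : complex.Re w <= M%:R.
  by rewrite (le_trans _ wM) // (le_trans (ler_norm _)) // ler_normc_Re.
have n0 : 0 < n.+1%:R :> R by [].
have g0 := rgamma_gt0 n0.
have Cg0 : (rgamma n.+1%:R)%:C != 0 by rewrite eq_complex /= negb_and gt_eqF.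
have Cp0 : cpow n.+1%:R w != 0 by exact: cpow_neq0.
have ig k : mu.-integrable D (EFin \o gam k%:R).
  by apply: integrable_gam; rewrite (lt_le_trans _ (ler0n _ _)) // oppr_lt0.
have y0 (x : R) : 0 < x -> 0 < x / n.+1%:R by move=> x0; rewrite divr_gt0.
pose f (x : R) : C := (gam n%:R x)%:C * (cpow (x / n.+1%:R) w - 1).
have f_le (x : R) : 0 < x -> normc (f x) <= M%:R * (gam n%:R x * p.[x / n.+1%:R]).
  move=> x0; rewrite /f normcM normc_real ger0_norm ?gam_ge0 // mulrCA ler_wpM2l ?gam_ge0 //.
  have hw : 1 <= complex.Re w <= M%:R by rewrite w1.
  have B := cpow_sub1_le (y0 x x0) hw; rewrite (le_trans B) // {B}.
  set y := x / _; have yM : 0 <= y ^+ M by rewrite exprn_ge0 // ltW // y0.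
  rewrite pE.
  have amgm : 2 * `|y - 1| <= eps + eps^-1 * (y - 1) ^+ 2.
    rewrite -[(y - 1) ^+ 2]real_normK ?num_real // -(ler_pM2l eps0).
    have -> : eps * (eps + eps^-1 * `|y - 1| ^+ 2) = eps ^+ 2 + `|y - 1| ^+ 2.
      by field; rewrite gt_eqF.
    by have := sqr_ge0 (eps - `|y - 1|); nra.
  rewrite (_ : 2 * _ = normc w * ((1 + y ^+ M) * (2 * `|y - 1|))); last by ring.
  rewrite ler_pM ?normc_ge0 ?mulr_ge0 ?addr_ge0 //.
  by rewrite ler_wpM2l // addr_ge0.
have ip : mu.-integrable D (EFin \o (fun x => M%:R * (gam n%:R x * p.[x / n.+1%:R]))).
  have := (Rintegral_sum (index_enum 'I_(size p))
    (fun k : 'I_(size p) => M%:R * (p`_k / n.+1%:R ^+ k)) mD (fun k : 'I_(size p) => ig (n + k)%N)).1.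
  apply: eq_integrable => // x /set_mem; rewrite /= in_itv /= andbT => x0.
  congr EFin; rewrite horner_coef !mulr_sumr; apply: eq_bigr => k _.
  by rewrite -gamMX // expr_div_n; ring.
have cintf : cintegrable D f.
  apply: (ccont_half_line_integrable _ ip f_le) => x x0.
  pose c := cpow n.+1%:R^-1 w.
  have cx : ccont (fun x => (gam n%:R x)%:C * (cpow x w * c + (- 1))) x.
    apply: ccontM; first by split; [exact: continuous_gam|exact: cst_continuous].
    apply: ccontD; last exact: ccont_cst.
    by apply: ccontM; [exact: ccont_cpow|exact: ccont_cst].
  have nE : \forall u \near x, f u = (gam n%:R u)%:C * (cpow u w * c + (- 1)).
    near=> u; have u0 : 0 < u by near: u; exact: lt_nbhsr.
    by rewrite /f cpowM // invr_gt0.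
  have [k1 k2] := cx.
  split.
    apply: (cvg_trans _ (_ : re_part (fun x => (gam n%:R x)%:C * (cpow x w * c + (- 1))) u @[u --> x] --> re_part f x)).
      by apply: near_eq_cvg; near=> u; rewrite /re_part; congr complex.Re; apply/esym; near: u.
    by rewrite {2}/re_part (nbhs_singleton nE).
  apply: (cvg_trans _ (_ : im_part (fun x => (gam n%:R x)%:C * (cpow x w * c + (- 1))) u @[u --> x] --> im_part f x)).
    by apply: near_eq_cvg; near=> u; rewrite /im_part; congr complex.Im; apply/esym; near: u.
  by rewrite {2}/im_part (nbhs_singleton nE).
have cintg : cintegrable D (fun x => (gam n%:R x)%:C).
  apply: (ccont_half_line_integrable _ (ig n)) => x x0.
    by split; [exact: continuous_gam|exact: cst_continuous].
  by rewrite normc_real ger0_norm ?gam_ge0.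
have gE : cintegral D (fun x => (gam n%:R x)%:C) = (rgamma n.+1%:R)%:C.
  rewrite /cintegral /rgamma -natr1 addrK /=; congr (_ +i* _).
  by rewrite Rintegral_cst // mul0r.
have EI : euler_integral (w + n.+1%:R) =
    cpow n.+1%:R w * (cintegral D f + (rgamma n.+1%:R)%:C).
  rewrite -gE -cintegralD // -cintegralZ //; last exact: cintegrableD.
  rewrite euler_integralE; apply: eq_cintegral => x /=; rewrite in_itv /= andbT => x0.
  rewrite -natr1 addrA addrK cpowD // -(rmorph_nat (real_complex R)) cpow_real.
  rewrite -{1}(divfK (_ : n.+1%:R != 0) x) ?gt_eqF // cpowM ?y0 //.
  by rewrite /f /gam rmorphM /=; ring.
have -> : euler_integral (w + n.+1%:R) / ((rgamma n.+1%:R)%:C * cpow n.+1%:R w) - 1 =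
  (rgamma n.+1%:R)%:C^-1 * cintegral D f.
  by rewrite EI; field; rewrite Cg0 Cp0.
rewrite normcM normcV normc_real ger0_norm ?(ltW g0) //.
apply: (@le_trans _ _ ((rgamma n.+1%:R)^-1 * (2 * (M%:R * I)))).
  rewrite ler_wpM2l ?invr_ge0 ?(ltW g0) // /I -RintegralZl //; last first.
    have := (Rintegral_sum (index_enum 'I_(size p))
      (fun k : 'I_(size p) => p`_k / n.+1%:R ^+ k) mD (fun k : 'I_(size p) => ig (n + k)%N)).1.
    apply: eq_integrable => // x /set_mem; rewrite /= in_itv /= andbT => x0.
    congr EFin; rewrite horner_coef !mulr_sumr; apply: eq_bigr => k _.
    by rewrite -gamMX // expr_div_n; ring.
  apply: normc_cintegral_le => // x /=; rewrite in_itv /= andbT; exact: f_le.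
rewrite mulrCA [X in 2 * X]mulrCA.
apply: (@le_trans _ _ (2 * (M%:R * (3 * eps)))).
  by rewrite ler_wpM2l // ler_wpM2l.
rewrite /eps; have -> : 2 * (M%:R * (3 * (delta / (6 * M%:R + 1)))) =
  delta * (6 * M%:R / (6 * M%:R + 1)) by field; rewrite gt_eqF.
by rewrite ler_piMr ?(ltW d0) // ler_pdivrMr // mul1r lerDl.
Unshelve. all: by end_near. Qed.

End GammaAsymptotics.

Opaque rgamma.

(** * Rational approximation of the Gamma function *)

Section GammaApproximation.
Variable R : realType.
Local Notation C := (R[i]).
Variables (K others : set C).
Hypothesis K_bounded : exists M : R, forall t, K t -> normc t <= M.
Hypothesis K_away : forall d, others d ->
  exists2 e : R, 0 < e & forall t, K t -> e <= normc (t - d).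

Let approx := rational_approx K others.

(** A relative error suffices once F is bounded, and F is bounded by the hypothesis for delta =
    1. *)
Lemma rational_approx_ratio (F : C -> C) :
  (forall delta : R, 0 < delta -> exists2 phi, approx phi &
     forall t, K t -> normc (F t - phi t) <= delta * normc (phi t)) ->
  approx F.
Proof.
move=> hF.
have [phi1 a1 H1] := hF 1 ltr01.
have [B1 B10 HB1] := rational_approx_bounded K_bounded K_away a1.
have HF t : K t -> normc (F t) <= 2 * B1.
  move=> Kt; rewrite -(subrK (phi1 t) (F t)) (le_trans (normcD_le _ _)) //.
  rewrite mulr2n mulrDl mul1r lerD ?HB1 // (le_trans (H1 t Kt)) // mul1r.
  exact: HB1.
apply: rational_approx_lim => e e0.
(* With d <= 1 / 2, |phi| <= |F| + |phi| / 2 and |F| <= 2 B1 give |phi| <= 4 B1, so the error d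
   |phi| is at most e. *)
pose d := Num.min (2^-1) (e / (4 * B1)).
have d0 : 0 < d by rewrite lt_min invr_gt0 ltr0n /= divr_gt0 // mulr_gt0.
have [phi a H] := hF d d0; exists phi => // t Kt.
have d1 : d <= 2^-1 by rewrite ge_min lexx.
have d2 : d * (4 * B1) <= e.
  by rewrite -ler_pdivlMr ?mulr_gt0 // ge_min lexx orbT.
have hp : normc (phi t) <= 4 * B1.
  have h1 := H t Kt; have h2 := HF t Kt.
  have h3 : normc (phi t) <= normc (F t) + normc (F t - phi t).
    rewrite -{1}(subKr (F t) (phi t)); exact: normcB_le.
  have h4 := normc_ge0 (phi t).
  by nra.
rewrite (le_trans (H t Kt)) // (le_trans _ d2) // ler_wpM2l //.
exact: ltW.
Qed.

Lemma rational_approx_poch (c : C) (n : nat) : approx (fun t => poch (t + c) n).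
Proof.
apply: rational_approx_prod => // i _.
apply: eq_rational_approx (rational_approx_poly K others ('X + (c + i%:R)%:P)) => t _.
by rewrite hornerD hornerX hornerC addrA.
Qed.

Lemma rational_approx_pochV (c : C) (n : nat) : (forall k : nat, others (- c - k%:R)) ->
  approx (fun t => (poch (t + c) n)^-1).
Proof.
move=> oc.
apply: eq_rational_approx (rational_approx_prod K_bounded K_away (index_enum 'I_n)
  (P := xpredT) (fun i _ => rational_approx_inv K (oc i))) => t _.
rewrite /poch prodfV; congr (_^-1); apply: eq_bigr => i _.
by rewrite opprB opprK; ring.
Qed.

(** An integer shift moves the bounded set K into the region 1 <= Re w, |w| <= M, where Gauss's
    limit is uniform. *)
Let shift_bound (c : C) : exists (m M : nat), forall t, K t ->
  1 <= complex.Re (t + (c + m%:R)) /\ normc (t + (c + m%:R)) <= M%:R.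
Proof.
have [B HB] := K_bounded.
pose m := (Num.truncn (`|B| + normc c + 1)).+1.
have hm : `|B| + normc c + 1 <= m%:R by rewrite ltW // truncnS_gt.
pose M := (Num.truncn (`|B| + normc c + m%:R)).+1.
have hM : `|B| + normc c + m%:R <= M%:R by rewrite ltW // truncnS_gt.
exists m, M => t Kt; have tB : normc t <= `|B| by rewrite (le_trans (HB t Kt)) // ler_norm.
have mc : normc (m%:R : C) = m%:R.
  by rewrite -(rmorph_nat (real_complex R)) normc_real ger0_norm.
split.
  rewrite !ReD -(rmorph_nat (real_complex R)) /=.
  have := ler_normc_Re t; have := ler_normc_Re c; rewrite !ler_norml.
  by move=> /andP[h1 _] /andP[h2 _]; lra.
rewrite (le_trans (normcD_le _ _)) // (le_trans _ hM) // -addrA lerD //.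
by rewrite (le_trans (normcD_le _ _)) // mc.
Qed.

Let cpowV (x : R) (w : C) : 0 < x -> (cpow x w)^-1 = cpow x^-1 w.
Proof.
move=> x0; apply: (mulfI (cpow_neq0 w x0)); rewrite mulfV ?cpow_neq0 //.
by rewrite -cpowM ?invr_gt0 // divff ?gt_eqF // cpow_one.
Qed.

Let approx_cpow_shift (x : R) (c : C) : 0 < x -> approx (fun t => cpow x (t + c)).
Proof.
move=> x0.
apply: eq_rational_approx (rational_approxM K_bounded K_away
  (rational_approx_cpow others K_bounded x0) (rational_approx_cst K others (cpow x c))) => t _.
by rewrite cpowD.
Qed.

Let euler_ratio (c : C) (M : nat) (delta : R) : 0 < delta ->
  (forall t, K t -> 1 <= complex.Re (t + c) /\ normc (t + c) <= M%:R) ->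
  exists n : nat, forall t, K t -> exists2 h : C, normc (h - 1) <= delta &
    euler_integral (t + c) =
    (rgamma n.+1%:R)%:C * cpow n.+1%:R (t + c) / poch (t + c) n.+1 * h.
Proof.
move=> d0 hK; have [n Hn] := euler_integral_ratio_cvg M d0.
exists n => t Kt; have [h1 h2] := hK t Kt.
have R0 : 0 < complex.Re (t + c) by rewrite (lt_le_trans ltr01).
have n0 : 0 < n.+1%:R :> R by [].
have g0 := rgamma_gt0 n0.
have Cg0 : (rgamma n.+1%:R)%:C != 0 :> C by rewrite fmorph_eq0 gt_eqF.
have Cp0 : cpow n.+1%:R (t + c) != 0 by exact: cpow_neq0.
eexists; first exact: (Hn (t + c) h1 h2).
have p0 := poch_neq0 n.+1 R0.
rewrite euler_integral_shift //.
by field; rewrite p0 Cg0 Cp0.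
Qed.

(** In Gauss's limit the only denominator is a Pochhammer product, whose zeros are among the poles
    of Gamma; the power factor is approximated by polynomials. *)
Lemma rational_approx_Gamma (c : C) : (forall k : nat, others (- c - k%:R)) ->
  approx (fun t => Gamma (t + c)).
Proof.
move=> oc; have [m [M hK]] := shift_bound c.
pose c' := c + m%:R.
have oc' k : others (- c' - k%:R).
  by rewrite /c' (_ : _ - _ = - c - (m + k)%:R) // natrD; ring.
have aE : approx (fun t => euler_integral (t + c')).
  apply: rational_approx_ratio => delta d0.
  have [n Hn] := euler_ratio d0 hK.
  exists (fun t => (rgamma n.+1%:R)%:C * cpow n.+1%:R (t + c') / poch (t + c') n.+1).
    apply: rational_approxM => //; last exact: rational_approx_pochV.
    apply: rational_approxM => //; first exact: rational_approx_cst.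
    exact: approx_cpow_shift.
  move=> t Kt; have [h h1 ->] := Hn t Kt.
  set phi := _ / _; rewrite (_ : phi * h - phi = (h - 1) * phi); last by ring.
  by rewrite normcM ler_wpM2r // normc_ge0.
apply: eq_rational_approx (rational_approxM K_bounded K_away aE
  (rational_approx_pochV m oc)) => t Kt.
rewrite (@GammaE _ _ m) ?addrA //.
have [h _] := hK t Kt; move: h.
by rewrite !ReD -(rmorph_nat (real_complex R)) /=; lra.
Qed.

(** The reciprocals of Gauss's approximants are entire, hence no condition on the poles. *)
Lemma rational_approx_GammaV (c : C) : approx (fun t => (Gamma (t + c))^-1).
Proof.
have [m [M hK]] := shift_bound c.
pose c' := c + m%:R.
have aE : approx (fun t => (euler_integral (t + c'))^-1).
  apply: rational_approx_ratio => delta d0.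
  (* If |h - 1| is at most 1 / 2 and at most delta / 2, then |h| >= 1 / 2 and |1 / h - 1| <=
     delta. *)
  have d20 : 0 < Num.min (2^-1) (delta / 2) by rewrite lt_min invr_gt0 ltr0n /= divr_gt0.
  have [n Hn] := euler_ratio d20 hK.
  exists (fun t => (rgamma n.+1%:R)%:C^-1 * cpow n.+1%:R^-1 (t + c') * poch (t + c') n.+1).
    apply: rational_approxM => //; last exact: rational_approx_poch.
    apply: rational_approxM => //; first exact: rational_approx_cst.
    by apply: approx_cpow_shift; rewrite invr_gt0.
  move=> t Kt; have [h h1 ->] := Hn t Kt.
  move: h1; rewrite le_min => /andP[h1 h2].
  have hh : 2^-1 <= normc h.
    have : normc (1 : C) <= normc h + normc (h - 1).
      by rewrite -{1}(subKr h 1) normcB_le.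
    by rewrite normc1; lra.
  have h0 : h != 0 by rewrite -normc_gt0 (lt_le_trans _ hh) // invr_gt0.
  rewrite -cpowV // !invfM invrK.
  set psi := _ * poch _ _; rewrite (_ : _ / h - psi = psi * (h^-1 * (1 - h))); last first.
    by move: psi => x; field.
  rewrite normcM mulrC ler_wpM2r ?normc_ge0 // normcM normcV normc_distC.
  rewrite mulrC ler_pdivrMr ?normc_gt0 //.
  have := normc_ge0 h; nra.
apply: eq_rational_approx (rational_approxM K_bounded K_away aE
  (rational_approx_poch c m)) => t Kt.
rewrite (@GammaE _ _ m) ?addrA //; first by rewrite invfM invrK.
have [h _] := hK t Kt; move: h.
by rewrite !ReD -(rmorph_nat (real_complex R)) /=; lra.
Qed.

End GammaApproximation.

(** * Lagrange interpolation and residues at several simple poles *)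

Section Lagrange.
Variables (F : fieldType) (n : nat) (c : 'I_n -> F).
Hypothesis c_inj : injective c.

(** The derivative at [c l] of the monic polynomial with roots [c k]. *)
Definition node_weight (l : 'I_n) : F := \prod_(k < n | k != l) (c l - c k).

Lemma node_weight_neq0 l : node_weight l != 0.
Proof.
by apply/prodf_neq0 => k kl; rewrite subr_eq0; apply: contra kl => /eqP/c_inj ->.
Qed.

Let basis (l : 'I_n) : {poly F} := \prod_(k < n | k != l) ('X - (c k)%:P).

Let size_basis l : size (basis l) = n.
Proof.
rewrite /basis -big_filter size_prod_XsubC size_filter -sum1_count sum1_card cardC1 card_ord.
by case: n l => [[]|].
Qed.

Let lead_basis l : (basis l)`_n.-1 = 1.
Proof.
have /monicP : basis l \is monic by exact: monic_prod_XsubC.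
by rewrite lead_coefE size_basis.
Qed.

Lemma lagrange_interpolation (P : {poly F}) : (size P <= n)%N ->
  P = \sum_(l < n) (P.[c l] / node_weight l) *: \prod_(k < n | k != l) ('X - (c k)%:P).
Proof.
move=> sP; set S := \sum_(l < n) _.
have hS l : S.[c l] = P.[c l].
  rewrite /S horner_sum (bigD1 l) //= [X in _ + X]big1 ?addr0 => [|i il].
    rewrite hornerZ horner_prod; under eq_bigr do rewrite hornerXsubC.
    by rewrite -/(node_weight l) divfK // node_weight_neq0.
  rewrite hornerZ horner_prod (bigD1 l) 1?eq_sym //= hornerXsubC subrr mul0r mulr0.
  by [].
apply/eqP; rewrite -subr_eq0; apply/eqP.
apply: (@roots_geq_poly_eq0 _ _ [seq c l | l <- enum 'I_n]).
- apply/allP => x /mapP[l _ ->].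
  by rewrite /root hornerD hornerN hS subrr.
- by rewrite map_inj_uniq ?enum_uniq.
rewrite size_map size_enum_ord (leq_trans (size_polyD _ _)) // geq_max sP size_polyN /=.
apply: (leq_trans (size_sum _ _ _)); apply/bigmax_leqP => l _.
by rewrite (leq_trans (size_scale_leq _ _)) // size_basis.
Qed.

(* The sum is the coefficient of degree n.-1 of the Lagrange interpolant of P. *)
Lemma lagrange_top_coef (P : {poly F}) : (size P < n)%N ->
  \sum_(l < n) P.[c l] / node_weight l = 0.
Proof.
move=> sP; have := congr1 (fun Q : {poly F} => Q`_n.-1) (lagrange_interpolation (ltnW sP)).
rewrite nth_default; last by rewrite -ltnS prednK // (leq_ltn_trans _ sP).
rewrite coef_sum => E; rewrite [RHS]E; apply: eq_bigr => l _.
by rewrite coefZ lead_basis mulr1.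
Qed.

(** The interpolation formula for the constant 1, divided by the nodal polynomial. *)
Lemma inv_prod_nodes (t : F) : (0 < n)%N -> (forall l, t != c l) ->
  (\prod_(l < n) (t - c l))^-1 = \sum_(l < n) (node_weight l)^-1 * (t - c l)^-1.
Proof.
move=> n0 tc.
have t0 l : t - c l != 0 by rewrite subr_eq0.
have p0 : \prod_(l < n) (t - c l) != 0 by apply/prodf_neq0 => l _.
have E : 1 = \sum_(l < n) (node_weight l)^-1 * \prod_(k < n | k != l) (t - c k).
  have s1 : (size (1%:P : {poly F}) <= n)%N by rewrite size_poly1.
  have := congr1 (horner^~ t) (lagrange_interpolation s1).
  rewrite hornerC horner_sum => E; rewrite [LHS]E.
  apply: eq_bigr => l _; rewrite hornerZ hornerC horner_prod div1r; congr (_ * _).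
  by apply: eq_bigr => k _; rewrite hornerXsubC.
apply: (mulfI p0); rewrite divff // mulr_sumr [LHS]E; apply: eq_bigr => l _.
rewrite [in RHS](bigD1 l) //=.
by rewrite mulrCA; congr (_ * _); rewrite mulrAC divff // mul1r.
Qed.

End Lagrange.

(** Partial fractions in the nodes reduce the sum of residues to the Cauchy formula at each node. *)
Lemma contour_integral_nodes (R : realType) (g : R -> R[i]) (nodes others : set R[i])
    (n : nat) (c : 'I_n -> R[i]) (f : R[i] -> R[i]) :
  encloses_exactly g nodes others -> injective c -> (forall l, nodes (c l)) -> (0 < n)%N ->
  (forall l, rational_approx (contour_node g (c l)) others f) ->
  contour_integral g (fun t => f t / \prod_(l < n) (t - c l)) =
  two_pi_i R * \sum_(l < n) f (c l) / node_weight c l.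
Proof.
move=> g_encl c_inj nc n0 hf.
have [gc off _ _] := g_encl.
have m01 : measurable (`[0, 1]%classic : set (measurableTypeR R)) by exact: measurable_itv.
have H l := cauchy_formula g_encl (nc l) (hf l).
pose h l u := f (g u) / (g u - c l) * cderive g u.
have key (s : seq 'I_n) :
    cintegrable `[0, 1] (fun u => \sum_(l <- s) (node_weight c l)^-1 * h l u) /\
    cintegral `[0, 1] (fun u => \sum_(l <- s) (node_weight c l)^-1 * h l u) =
    \sum_(l <- s) (node_weight c l)^-1 * (two_pi_i R * f (c l)).
  elim: s => [|l s [IH1 IH2]].
    rewrite big_nil; have z : cintegrable `[0, 1] (fun=> 0 : R[i]).
      by apply: ccont_cintegrable => u _; exact: ccont_cst.
    split; first by apply: eq_cintegrable z => // u _; rewrite big_nil.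
    rewrite (@eq_cintegral _ _ _ (fun u => 0 * 0)) => [|u _]; last by rewrite big_nil mul0r.
    by rewrite cintegralZ // mul0r.
  have il := cintegrableZ m01 (node_weight c l)^-1 (H l).1.
  split.
    by apply: eq_cintegrable (cintegrableD m01 il IH1) => // u _; rewrite big_cons.
  rewrite big_cons -IH2 -(H l).2 -cintegralZ //; last exact: (H l).1.
  rewrite -cintegralD //.
  by apply: eq_cintegral => u _; rewrite big_cons.
have E : contour_integral g (fun t => f t / \prod_(l < n) (t - c l)) =
    cintegral `[0, 1] (fun u => \sum_(l < n) (node_weight c l)^-1 * h l u).
  apply: eq_cintegral => u /=; rewrite in_itv /= => hu.
  rewrite inv_prod_nodes // => [|l]; last first.
    by apply/eqP => gl; apply: (off u hu); left; rewrite gl.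
  rewrite mulr_sumr mulr_suml; apply: eq_bigr => l _.
  by rewrite /h; ring.
rewrite E (key _).2 mulr_sumr; apply: eq_bigr => l _.
by ring.
Qed.

(** * Orthogonality of the contour forms *)

Section AForms.
Variables (R : realType) (p : nat) (hp : (0 < p)%N) (e : 'I_p -> R).
Local Notation C := (R[i]).
Local Notation mu := (@lebesgue_measure R).
Local Notation D := (`]0%R, +oo[%classic : set R).
Hypothesis e_nonresonant : forall i h, i != h -> e i - e h \isn't a Num.int.

Definition step_node (l : nat) : R := e (chi hp l) + (l %/ p)%:R.

(** A coincidence of nodes from different components would make a difference of exponents an
    integer; nonresonance is what makes all poles simple. *)
Lemma step_node_inj : injective step_node.
Proof.
move=> l k; rewrite /step_node => E.
have [h|h] := eqVneq (chi hp l) (chi hp k).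
  move: E; rewrite h => /addrI/eqP; rewrite eqr_nat => /eqP E.
  by rewrite (divn_eq l p) (divn_eq k p) E; congr (_ + _)%N; have /(congr1 val) := h.
have := e_nonresonant h; rewrite (_ : e _ - e _ = (k %/ p)%:R - (l %/ p)%:R).
  by rewrite rpredB // natr_int.
by move: E; lra.
Qed.

Lemma step_node_set (N : nat) (l : 'I_N.+1) :
  node_set e (@step_line p N.+1) (step_node l)%:C.
Proof.
exists (chi hp l), (l %/ p)%N => //.
by rewrite ltn_step_line /= -divn_eq.
Qed.

Lemma prod_step_nodes (N : nat) (t : C) :
  \prod_(i < p) \prod_(u < step_line N.+1 i) (t - (e i + u%:R)%:C) =
  \prod_(l < N.+1) (t - (step_node l)%:C).
Proof. exact: (big_step_line _ _ hp (fun i u => t - (e i + u%:R)%:C)). Qed.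

Lemma pochv_step_nodes_shift (N : nat) (t : C) :
  pochv (fun i => t + 1 - (e i)%:C - (@step_line p N.+1 i)%:R) (@step_line p N.+1) =
  \prod_(l < N.+1) (t - (step_node l)%:C).
Proof.
rewrite -prod_step_nodes /pochv; apply: eq_bigr => i _.
(* With n the component of the multi-index, (t + 1 - e - n)_n runs through the factors t - e - u
   from u = n - 1 down to u = 0. *)
rewrite /poch (reindex_inj rev_ord_inj) /=; apply: eq_bigr => u _.
have -> : (e i + u%:R)%:C = (e i)%:C + u%:R by rewrite rmorphD /= rmorph_nat.
by rewrite natrB // -[u.+1%:R]natr1; ring.
Qed.

Lemma pochv_step_nodes_opp (N : nat) (t : C) :
  pochv (fun i => (e i)%:C - t) (@step_line p N.+1) =
  (-1) ^+ N.+1 * \prod_(l < N.+1) (t - (step_node l)%:C).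
Proof.
transitivity (\prod_(l < N.+1) - (t - (step_node l)%:C)).
  rewrite -(big_step_line _ _ hp (fun i u => - (t - (e i + u%:R)%:C))) /pochv.
  apply: eq_bigr => i _; rewrite /poch; apply: eq_bigr => u _.
  have -> : (e i + u%:R)%:C = (e i)%:C + u%:R by rewrite rmorphD /= rmorph_nat.
  by ring.
by rewrite prodrN card_ord.
Qed.

Variables (N : nat) (Sigma : R -> C) (others : set C) (S : C -> C) (kappa : C).
Hypothesis S_encl : encloses_exactly Sigma (node_set e (@step_line p N.+1)) others.
Hypothesis S_approx : forall l : 'I_N.+1,
  rational_approx (contour_node Sigma (step_node l)%:C) others S.

Let c (l : 'I_N.+1) : C := (step_node l)%:C.

Lemma contour_power_form (x : R) : 0 < x ->
  kappa * contour_integral Sigma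
    (fun t => S t / \prod_(l < N.+1) (t - (step_node l)%:C) * cpow x t) =
  \sum_(l < N.+1) (kappa * two_pi_i R * (S (c l) / node_weight c l)) *
    (x `^ step_node l)%:C.
Proof.
move=> x0.
have c_inj : injective c by move=> l k /complexI/step_node_inj; exact: val_inj.
rewrite (eq_contour_integral (f2 := fun t =>
    (S t * cpow x t) / \prod_(l < N.+1) (t - c l))) => [|t _]; last by rewrite mulrAC.
rewrite (contour_integral_nodes S_encl c_inj) //; last 2 first.
- exact: step_node_set.
- move=> l; have nl := step_node_set l.
  have Kb := contour_node_bounded S_encl (c l).
  have Ka := fun d => @contour_node_away _ _ _ _ S_encl (c l) d nl.
  exact: (rational_approxM Kb Ka (S_approx l) (rational_approx_cpow others Kb x0)).
rewrite !mulr_sumr; apply: eq_bigr => l _.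
by rewrite /c cpow_real; ring.
Qed.

Lemma contour_form_orthogonal (q k : nat) (w : 'I_q -> R -> R) (m : 'I_q -> R -> R)
    (dom : R -> Prop) (j : 'I_q) (T : {poly C}) (Af : R -> C) :
  (forall j s, dom s -> mu.-integrable D (EFin \o (fun x => x `^ (s - 1) * w j x))) ->
  (forall j s, dom s -> \int[mu]_(x in D) (x `^ (s - 1) * w j x) = m j s) ->
  (forall l : 'I_N.+1, dom (step_node l + k%:R + 1)) ->
  (forall x, 0 < x -> Af x = kappa * contour_integral Sigma
    (fun t => S t / \prod_(l < N.+1) (t - (step_node l)%:C) * cpow x t)) ->
  (size T <= N)%N ->
  (forall l : 'I_N.+1, S (c l) * (m j (step_node l + k%:R + 1))%:C = T.[c l]) ->
  cintegral D (fun x => (x ^+ k)%:C * Af x * (w j x)%:C) = 0.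
Proof.
move=> w_int w_mom hdom AfE sT ST.
rewrite (@eq_cintegral _ _ _ (fun x => (x ^+ k)%:C *
    (\sum_(l < N.+1) (kappa * two_pi_i R * (S (c l) / node_weight c l)) *
    (x `^ step_node l)%:C) * (w j x)%:C)); last first.
  by move=> x /=; rewrite in_itv /= andbT => x0; rewrite AfE // contour_power_form.
rewrite (cintegral_powers_weight w_int w_mom) //.
have c_inj : injective c by move=> l l' /complexI/step_node_inj; exact: val_inj.
transitivity (kappa * two_pi_i R * \sum_(l < N.+1) T.[c l] / node_weight c l).
  by rewrite mulr_sumr; apply: eq_bigr => l _; rewrite -ST; ring.
by rewrite lagrange_top_coef ?mulr0.
Qed.

End AForms.

(** * Cancellation of the Gamma factors at the nodes *)

Section GammaQuotient.
Variable R : realType.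

(* The arguments of the two Gamma quotients differ by integers. *)
Lemma rgamma_quotient_poly (q r k ell : nat) (a : 'I_q -> R) (b : 'I_r -> R)
    (nu delta : 'I_r -> nat) :
  (forall h, k + delta h <= nu h)%N ->
  exists2 T : {poly R},
    (size T <= (q * k + \sum_(h < r) (nu h - k - delta h) + ell).+1)%N &
    forall c : R, (forall i, 0 < c + a i + 1) -> (forall h, 0 < c + b h + 1) ->
      (\prod_(h < r) rgamma (c + b h + 1 + (nu h)%:R) / \prod_(i < q) rgamma (c + a i + 1)) *
      ((c + k%:R + 1) ^+ ell *
        (\prod_(i < q) rgamma (c + k%:R + 1 + a i) /
         \prod_(h < r) rgamma (c + k%:R + 1 + (b h + (delta h)%:R)))) = T.[c].
Proof.
move=> knu.
(* The a-quotients are rising factorials of length k, the b-quotients rising factorials of length nu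
   h - k - delta h; the latter is a genuine length by hypothesis. *)
pose Ta i := \prod_(l < k) ('X + (a i + 1 + l%:R)%:P) : {poly R}.
pose Tb h := \prod_(l < nu h - k - delta h)
   ('X + (k%:R + 1 + (b h + (delta h)%:R) + l%:R)%:P) : {poly R}.
have size_lin (n : nat) (f : 'I_n -> R) : size (\prod_(l < n) ('X + (f l)%:P)) = n.+1.
  rewrite (eq_bigr (fun l => 'X - (- f l)%:P)) => [|l _]; last by rewrite polyCN opprK.
  by rewrite size_prod_XsubC /index_enum -enumT size_enum_ord.
have size_prod_le (n : nat) (F : 'I_n -> {poly R}) (d : 'I_n -> nat) :
    (forall i, size (F i) <= (d i).+1)%N -> (size (\prod_(i < n) F i)%R <= (\sum_(i < n) d i).+1)%N.
  move=> hF; elim/big_rec2: _ => [|i y x _ h]; first by rewrite size_poly1.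
  rewrite (leq_trans (size_polyMleq _ _)) //.
  by have := hF i; lia.
exists (\prod_(i < q) Ta i * \prod_(h < r) Tb h * ('X + (k%:R + 1)%:P) ^+ ell).
  have s1 : (size (\prod_(i < q) Ta i)%R <= (q * k).+1)%N.
    rewrite (leq_trans (size_prod_le _ _ (fun=> k) _)) //; last by rewrite sum_nat_const card_ord.
    by move=> i; rewrite /Ta size_lin.
  have s2 : (size (\prod_(h < r) Tb h)%R <= (\sum_(h < r) (nu h - k - delta h)).+1)%N.
    by apply: size_prod_le => h; rewrite /Tb size_lin.
  have s3 : (size (('X + (k%:R + 1)%:P) ^+ ell : {poly R})%R <= ell.+1)%N.
    by rewrite (leq_trans (size_poly_exp_leq _ _)) // size_XaddC mul1n.
  rewrite (leq_trans (size_polyMleq _ _)) //.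
  by have := size_polyMleq (\prod_(i < q) Ta i) (\prod_(h < r) Tb h); lia.
move=> c ca cb.
have TaE i : rgamma (c + k%:R + 1 + a i) = (Ta i).[c] * rgamma (c + a i + 1).
  rewrite (_ : c + k%:R + 1 + a i = (c + a i + 1) + k%:R); last by ring.
  rewrite rgamma_shift // /Ta horner_prod; congr (_ * _); apply: eq_bigr => l _.
  by rewrite hornerD hornerX hornerC; ring.
have TbE h : rgamma (c + b h + 1 + (nu h)%:R) =
    (Tb h).[c] * rgamma (c + k%:R + 1 + (b h + (delta h)%:R)).
  have -> : c + b h + 1 + (nu h)%:R =
      (c + k%:R + 1 + (b h + (delta h)%:R)) + (nu h - k - delta h)%:R.
    have /(congr1 (fun n : nat => n%:R : R)) : (nu h = k + delta h + (nu h - k - delta h))%N.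
      by have := knu h; lia.
    by rewrite !natrD => ->; ring.
  rewrite rgamma_shift; last first.
    rewrite (_ : _ + _ = (c + b h + 1) + (k%:R + (delta h)%:R)); last by ring.
    by rewrite ltr_wpDr // addr_ge0.
  rewrite /Tb horner_prod; congr (_ * _); apply: eq_bigr => l _.
  by rewrite hornerD hornerX hornerC; ring.
under eq_bigr do rewrite TbE.
under [X in _ * (_ * (X / _)) = _]eq_bigr do rewrite TaE.
rewrite !big_split /= !hornerM !horner_prod horner_exp hornerD hornerX hornerC addrA.
have n1 : \prod_(i < q) rgamma (c + a i + 1) != 0.
  by apply/prodf_neq0 => i _; rewrite gt_eqF // rgamma_gt0.
have n2 : \prod_(h < r) rgamma (c + k%:R + 1 + (b h + (delta h)%:R)) != 0.
  apply/prodf_neq0 => h _; rewrite gt_eqF // rgamma_gt0 //.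
  rewrite (_ : _ + _ = (c + b h + 1) + (k%:R + (delta h)%:R)); last by ring.
  by rewrite ltr_wpDr // addr_ge0.
by field; rewrite n1 n2.
Qed.

End GammaQuotient.

(** * Mellin transforms of convolutions *)

Section AffineChange.
Variable R : realType.
Local Notation mu := (@lebesgue_measure R).
Local Notation mR := (measurableTypeR R).

Let affine (c d : R) : mR -> mR := fun x => c * x + d.

Let measurable_affine c d : measurable_fun setT (affine c d).
Proof. by apply: measurable_funD => //; exact: measurable_funM. Qed.

(** The pushforward of Lebesgue measure under the affine map, scaled by c, gives half-open intervals
    their length, hence is Lebesgue measure. *)
Lemma ge0_integral_affine (c d : R) (F : R -> \bar R) : 0 < c ->
  measurable_fun (setT : set mR) F -> (forall x, 0 <= F x)%E ->
  (\int[mu]_x F x = c%:E * \int[mu]_x F (c * x + d)%R)%E.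
Proof.
move=> c0 mF F0; have ma := measurable_affine c d.
transitivity (c%:E * \int[mu]_(x in affine c d @^-1` setT) (F \o affine c d) x)%E; last first.
  by rewrite preimage_setT.
rewrite -(ge0_integral_pushforward ma) //.
rewrite -[c]/((NngNum (ltW c0))%:num) -ge0_integral_mscale //.
apply: eq_measure_integral => A mA _.
apply: lebesgue_measure_unique => //= _ [[a b]] _ <-.
rewrite /mscale /pushforward /=.
have E : affine c d @^-1` `]a, b] = `](a - d) / c, (b - d) / c]%classic.
  apply/seteqP; split=> x; rewrite /affine /= !in_itv /= ltr_pdivrMr // ler_pdivlMr //;
    by rewrite ltrBlDr lerBrDr (mulrC x).
rewrite -[X in _ = (_ * lebesgue_measure X)%E]/(affine c d @^-1` `]a, b]) E.
rewrite !lebesgue_measure_itv /= !lte_fin ltr_pM2r ?invr_gt0 // ltrD2r.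
case: ifP => _; last by rewrite mule0.
rewrite -!EFinB -EFinM; congr EFin; field.
by rewrite gt_eqF.
Qed.

End AffineChange.

Section MellinConvolution.
Variable R : realType.
Local Notation mu := (@lebesgue_measure R).
Local Notation D := (`]0%R, +oo[%classic : set R).
Local Notation mR := (measurableTypeR R).
Implicit Types (f g : R -> R) (s : R).

(** Vanishing on the closed negative half-line lets all integrals run over the whole line, where
    Tonelli's theorem and affine substitutions apply directly. *)
Definition weight f : Prop :=
  [/\ measurable_fun (setT : set mR) f, forall x, 0 <= f x & forall x, x <= 0 -> f x = 0].

(** With values in the extended reals an infinite integral stays visible, whereas [mconv] and
    [Rintegral] turn it into 0. *)
Definition emellin f s : \bar R := (\int[mu]_x (x `^ (s - 1) * f x)%:E)%E.

Definition econv f g (x : R) : \bar R := (\int[mu]_t (f t * g (x / t) / t)%:E)%E.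

Lemma half_line_integral (F : R -> \bar R) : (forall x, x <= 0 -> F x = 0%E) ->
  (\int[mu]_(x in D) F x = \int[mu]_x F x)%E.
Proof.
move=> F0; rewrite integral_mkcond; apply: eq_integral => x _; rewrite patchE.
case: ifPn => // /negP h; apply/esym/F0; rewrite leNgt; apply/negP => x0; apply: h.
by rewrite inE /= in_itv /= x0.
Qed.

Lemma mconvE f g x : weight f -> mconv f g x = fine (econv f g x).
Proof.
case=> _ _ f0; rewrite /mconv /Rintegral half_line_integral // => t t0.
by rewrite f0 // !mul0r.
Qed.

Lemma weight_integrable f s (F : R) : weight f -> emellin f s = F%:E ->
  mu.-integrable D (EFin \o (fun x => x `^ (s - 1) * f x)) /\
  \int[mu]_(x in D) (x `^ (s - 1) * f x) = F.
Proof.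
move=> [mf f0 fn0] E.
have mD := @measurable_half_line R.
have h0 x : x <= 0 -> (x `^ (s - 1) * f x)%:E = 0%E by move=> /fn0 ->; rewrite mulr0.
split; last by rewrite /Rintegral half_line_integral // -/(emellin f s) E.
apply/integrableP; split.
  apply/measurable_EFinP; apply: (@measurable_funS _ _ _ _ setT) => //.
  by apply: measurable_funM => //; exact: measurable_powR.
rewrite (_ : (\int[mu]_(x in D) _)%E = emellin f s); first by rewrite E ltry.
rewrite /emellin -half_line_integral //; apply: eq_integral => x _.
by rewrite /= ger0_norm // mulr_ge0 ?powR_ge0.
Qed.

(** Division by t is written as a power with exponent -1, which is measurable on the whole line. The
    two agree for t > 0, and f vanishes elsewhere. *)
Let kernel f g : mR * mR -> \bar R := fun z => (f z.2 * g (z.1 * z.2 `^ (-1)) * z.2 `^ (-1))%:E.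

Let measurable_kernel f g : weight f -> weight g -> measurable_fun setT (kernel f g).
Proof.
move=> [mf _ _] [mg _ _]; apply/measurable_EFinP.
have mi : measurable_fun (setT : set (mR * mR)) (fun z : mR * mR => z.2 `^ (-1) : mR).
  by apply: (measurableT_comp (f := fun x : mR => x `^ (-1) : mR)) => //; exact: measurable_powR.
apply: measurable_funM => //; apply: measurable_funM.
  exact: (measurableT_comp mf).
by apply: (measurableT_comp mg); exact: measurable_funM.
Qed.

Let kernelE f g x t : weight f -> (f t * g (x / t) / t)%:E = kernel f g (x, t).
Proof.
move=> [_ _ f0]; rewrite /kernel /=; have [t0|t0] := leP t 0.
  by rewrite f0 // !mul0r.
by rewrite powR_inv1 // ltW.
Qed.

Let kernel_ge0 f g z : weight f -> weight g -> (0 <= kernel f g z)%E.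
Proof. by move=> [_ f0 _] [_ g0 _]; rewrite lee_fin !mulr_ge0 ?powR_ge0. Qed.

Lemma econv_ge0 f g x : weight f -> weight g -> (0 <= econv f g x)%E.
Proof.
by move=> wf wg; apply: integral_ge0 => t _; rewrite kernelE //; exact: kernel_ge0.
Qed.

Lemma measurable_econv f g : weight f -> weight g ->
  measurable_fun (setT : set mR) (econv f g).
Proof.
move=> wf wg; have := measurable_fun_fubini_tonelli_F (m2 := mu) (kernel f g)
  (measurable_kernel wf wg) (fun z => kernel_ge0 z wf wg).
apply: eq_measurable_fun => x _.
by rewrite /fubini_F; apply: eq_integral => t _; rewrite kernelE.
Qed.

Lemma econv_le0 f g x : weight f -> weight g -> x <= 0 -> econv f g x = 0%E.
Proof.
move=> [_ _ f0] [_ _ g0] x0; rewrite /econv integral0_eq // => t _.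
have [t0|t0] := leP t 0; first by rewrite f0 // !mul0r.
by rewrite g0 ?mulr0 ?mul0r // mulr_le0_ge0 // invr_ge0 ltW.
Qed.

Lemma weight_mconv f g : weight f -> weight g -> weight (mconv f g).
Proof.
move=> wf wg; split.
- apply: (eq_measurable_fun (fine \o econv f g)) => [x _|]; first by rewrite mconvE.
  by apply: measurableT_comp; [exact: fine_measurable|exact: measurable_econv].
- by move=> x; rewrite mconvE // fine_ge0 // econv_ge0.
- by move=> x x0; rewrite mconvE // econv_le0.
Qed.

(** Tonelli's theorem and the substitution x = t y, under which x ^ (s - 1) splits. *)
Lemma emellin_econv f g s : weight f -> weight g ->
  (\int[mu]_x ((x `^ (s - 1))%:E * econv f g x) = emellin f s * emellin g s)%E.
Proof.
move=> wf wg; have [mf f0 fn0] := wf; have [mg g0 gn0] := wg.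
pose H (z : mR * mR) : \bar R := ((z.1 `^ (s - 1))%:E * kernel f g z)%E.
have mp : measurable_fun (setT : set mR) (fun x : mR => x `^ (s - 1)).
  exact: measurable_powR.
have mH : measurable_fun setT H.
  apply: emeasurable_funM; last exact: measurable_kernel.
  by apply/measurable_EFinP; exact: (measurableT_comp mp).
have H0 z : (0 <= H z)%E.
  by rewrite mule_ge0 ?lee_fin ?powR_ge0 //; exact: kernel_ge0.
transitivity (\int[mu]_t \int[mu]_x H (x, t))%E.
  rewrite -(fubini_tonelli (m1 := mu) (m2 := mu) H mH H0).
  apply: eq_integral => x _; rewrite -ge0_integralZl //.
  - by apply: eq_integral => t _; rewrite kernelE.
  - apply: (eq_measurable_fun (fun t => kernel f g (x, t))).
      by move=> t _; rewrite kernelE.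
    by apply: measurable_fun_pair2; exact: measurable_kernel.
  - by move=> t _; rewrite kernelE //; exact: kernel_ge0.
  - by rewrite lee_fin powR_ge0.
transitivity (\int[mu]_t ((t `^ (s - 1) * f t)%:E * emellin g s))%E; last first.
  rewrite ge0_integralZr //.
  - by apply/measurable_EFinP; exact: measurable_funM.
  - by move=> t _; rewrite lee_fin mulr_ge0 ?powR_ge0.
  - by apply: integral_ge0 => x _; rewrite lee_fin mulr_ge0 ?powR_ge0.
apply: eq_integral => t _; have [t0|t0] := leP t 0.
  rewrite fn0 // mulr0 mul0e integral0_eq // => x _.
  by rewrite /H /kernel /= fn0 // !mul0r mule0.
rewrite (@ge0_integral_affine R t 0 (fun x => H (x, t))) //; last first.
  exact: measurable_fun_pair1.
rewrite /emellin -!ge0_integralZl //; first last.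
- by rewrite lee_fin ltW.
- by apply: (measurableT_comp mH); apply: measurable_fun_pair => //;
    apply: measurable_funD => //; exact: measurable_funM.
- by rewrite lee_fin mulr_ge0 ?powR_ge0.
- by move=> x _; rewrite lee_fin mulr_ge0 ?powR_ge0.
- by apply/measurable_EFinP; exact: measurable_funM.
apply: eq_integral => x _; rewrite /H /kernel /= addr0 -!EFinM; congr EFin.
rewrite powR_inv1 ?(ltW t0) // (mulrC t x) mulfK ?gt_eqF //.
have [x0|x0] := leP x 0; first by rewrite gn0 // !(mulr0, mul0r).
rewrite powRM ?(ltW x0) ?(ltW t0) //.
by field; rewrite gt_eqF.
Qed.

(** A finite Mellin integral forces the extended convolution to be finite almost everywhere, so
    passing to [mconv] changes it on a null set only. *)
Lemma emellin_mconv f g s (F G : R) : weight f -> weight g ->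
  emellin f s = F%:E -> emellin g s = G%:E -> emellin (mconv f g) s = (F * G)%:E.
Proof.
move=> wf wg fF gG; have E := emellin_econv s wf wg; rewrite fF gG -EFinM in E.
have mE : measurable_fun (setT : set mR) (fun x => (x `^ (s - 1))%:E * econv f g x)%E.
  by apply: emeasurable_funM; [apply/measurable_EFinP; exact: measurable_powR|
    exact: measurable_econv].
have nE x : (0 <= (x `^ (s - 1))%:E * econv f g x)%E.
  by rewrite mule_ge0 ?lee_fin ?powR_ge0 ?econv_ge0.
have iE : mu.-integrable setT (fun x => (x `^ (s - 1))%:E * econv f g x)%E.
  apply/integrableP; split => //.
  under eq_integral do rewrite gee0_abs //.
  by rewrite E ltry.
rewrite -E; apply: ge0_ae_eq_integral => //.
- by apply/measurable_EFinP; apply: measurable_funM;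
    [exact: measurable_powR|have [] := weight_mconv wf wg].
- by move=> x _; rewrite lee_fin mulr_ge0 ?powR_ge0 //; have [_ + _] := weight_mconv wf wg; apply.
have := integrable_ae measurableT iE; apply: filterS => x /(_ I) + _.
rewrite EFinM mconvE //; have [x0|x0] := leP x 0.
  by rewrite econv_le0 // mule0 /= mulr0.
move=> h; congr (_ * _)%E; rewrite fineK //.
move: h; have p0 := powR_gt0 (s - 1) x0; have := econv_ge0 x wf wg.
case: (econv f g x) => //= _.
by rewrite mulry gtr0_sg // mul1e.
Qed.

Lemma emellin_mconvs (fs : seq ((R -> R) * R)) s : fs != [::] ->
  (forall x, List.In x fs -> weight x.1 /\ emellin x.1 s = x.2%:E) ->
  weight (mconvs [seq x.1 | x <- fs]) /\
  emellin (mconvs [seq x.1 | x <- fs]) s = (\prod_(x <- fs) x.2)%:E.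
Proof.
elim: fs => // x [|y fs] IH _ hfs.
  by have [|h1 h2] := hfs x; [left|rewrite big_seq1].
have [|z zfs|h1 h2] := IH _ _; first by [].
  by apply: hfs; right.
have [|k1 k2] := hfs x; first by left.
rewrite big_cons; split; first exact: weight_mconv.
exact: emellin_mconv.
Qed.

End MellinConvolution.

(** * Mellin transforms of the Beta and Gamma densities *)

Section BetaGammaMellin.
Variable R : realType.
Local Notation mu := (@lebesgue_measure R).
Local Notation D := (`]0%R, +oo[%classic : set R).
Local Notation mR := (measurableTypeR R).

Lemma weight_gamma_fun (a : R) : weight (gamma_fun a).
Proof.
split=> [|x|x x0]; rewrite /gamma_fun.
- apply: measurable_fun_ifT => //; first exact: measurable_fun_ltr.
  apply: measurable_funM; first exact: measurable_powR.
  by apply: measurableT_comp; [exact: measurable_expR|exact: oppr_measurable].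
- by case: ifP => // _; rewrite mulr_ge0 ?powR_ge0 ?expR_ge0.
- by rewrite ltNge x0.
Qed.

Lemma emellin_gamma_fun (a s : R) : 0 < s + a ->
  emellin (gamma_fun a) s = (rgamma (s + a))%:E.
Proof.
move=> sa.
have ig : mu.-integrable D (EFin \o gam (s + a - 1)).
  by apply: integrable_gam; rewrite ltrBrDl subrr.
rewrite /emellin -half_line_integral => [|x x0]; last first.
  by rewrite /gamma_fun ltNge x0 mulr0.
rewrite rgammaE /Rintegral fineK; last first.
  by apply: integrable_fin_num ig => //; exact: measurable_half_line.
apply: eq_integral => x /set_mem /=; rewrite in_itv /= andbT => x0.
by rewrite /gamma_fun x0 /gam mulrA -powRD ?(gt_eqF x0) ?implybT // addrAC.
Qed.

Let bt (u v x : R) : R := if 0 < x < 1 then x `^ (u - 1) * (1 - x) `^ (v - 1) else 0.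

Let weight_bt u v : weight (bt u v).
Proof.
split=> [|x|x x0]; rewrite /bt.
- apply: measurable_fun_ifT => //.
    by apply: measurable_and; exact: measurable_fun_ltr.
  apply: measurable_funM; first exact: measurable_powR.
  apply: (measurableT_comp (f := fun x : mR => x `^ (v - 1) : mR)); first exact: measurable_powR.
  exact: measurable_funB.
- by case: ifP => // _; rewrite mulr_ge0 ?powR_ge0.
- by rewrite ltNge x0.
Qed.

(* Tonelli for the double integral Gamma (u) Gamma (v), in the variables x + z = y
   and x = y t. *)
Lemma beta_integral (u v : R) : 0 < u -> 0 < v ->
  ((rgamma u)%:E * (rgamma v)%:E = \int[mu]_x (bt u v x)%:E * (rgamma (u + v))%:E)%E.
Proof.
move=> u0 v0.
pose gm (s x : R) : R := gamma_fun (s - 1) x.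
have wg s : weight (gm s) by exact: weight_gamma_fun.
have Ig s : 0 < s -> (\int[mu]_x (gm s x)%:E = (rgamma s)%:E)%E.
  move=> s0; have := @emellin_gamma_fun (s - 1) 1; rewrite addrC subrK => /(_ s0) <-.
  by apply: eq_integral => x _; rewrite subrr powRr0 mul1r.
have mg s : measurable_fun (setT : set mR) (gm s) by have [] := wg s.
have mG s : measurable_fun (setT : set mR) (fun x => (gm s x)%:E) by exact/measurable_EFinP.
have g0 s x : 0 <= gm s x by have [_ + _] := wg s; apply.
have G0 s x : (0 <= (gm s x)%:E)%E by rewrite lee_fin.
have I0 s : (0 <= \int[mu]_x (gm s x)%:E)%E by exact: integral_ge0.
have gn s x : x <= 0 -> gm s x = 0 by have [_ _ +] := wg s; apply.
pose H (z : mR * mR) : \bar R := (gm u z.1 * gm v (z.2 - z.1))%:E.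
have mH : measurable_fun setT H.
  apply/measurable_EFinP; apply: measurable_funM; first exact: (measurableT_comp (mg u)).
  by apply: (measurableT_comp (mg v)); exact: measurable_funB.
have H0 z : (0 <= H z)%E by rewrite lee_fin mulr_ge0.
rewrite -(Ig u u0) -(Ig v v0) -(Ig (u + v) (addr_gt0 u0 v0)).
transitivity (\int[mu]_x \int[mu]_y H (x, y))%E.
  rewrite -(ge0_integralZr mu measurableT (mG u) (fun x _ => G0 u x) (I0 v)).
  apply: eq_integral => x _.
  rewrite -(ge0_integralZl mu measurableT (mG v) (fun y _ => G0 v y) (G0 u x)).
  rewrite (@ge0_integral_affine R 1 (- x) (fun y => ((gm u x)%:E * (gm v y)%:E)%E)) //.
  - by rewrite mul1e; apply: eq_integral => y _; rewrite mul1r /H /= EFinM.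
  - by apply: emeasurable_funM.
  - by move=> y; rewrite -EFinM lee_fin mulr_ge0.
rewrite (fubini_tonelli (m1 := mu) (m2 := mu) H mH H0).
have [mb b0 bn] := weight_bt u v.
rewrite -ge0_integralZl //; last by apply: integral_ge0 => x _; rewrite lee_fin.
apply: eq_integral => y _; have [y0|y0] := leP y 0.
  rewrite gn // mule0 integral0_eq // => x _; rewrite /H /=.
  have [x0|x0] := leP x 0; first by rewrite gn // mul0r.
  by rewrite [gm v _]gn ?mulr0 // subr_le0 (le_trans y0) // ltW.
rewrite (@ge0_integral_affine R y 0 (fun x => H (x, y))) //; last exact: measurable_fun_pair1.
rewrite -ge0_integralZl //; first last.
- by rewrite lee_fin ltW.
- by apply: (measurableT_comp mH); apply: measurable_fun_pair => //;
    apply: measurable_funD => //; exact: measurable_funM.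
rewrite -ge0_integralZr //; first last.
- by move=> x _; rewrite lee_fin.
- exact/measurable_EFinP.
apply: eq_integral => t _; rewrite /H /= addr0 -!EFinM; congr EFin.
rewrite /bt; case: ifPn => [/andP[t0 t1]|].
  have yt : y - y * t = y * (1 - t) by ring.
  have t10 : 0 < 1 - t by rewrite subr_gt0.
  rewrite yt /gm /gamma_fun !mulr_gt0 // y0 !powRM ?ltW //.
  have -> : y `^ (u + v - 1) = y * y `^ (u - 1) * y `^ (v - 1).
    rewrite -{2}(powRr1 (ltW y0)) -!powRD ?(gt_eqF y0) ?implybT //.
    by congr (_ `^ _); ring.
  have -> : expR (- y) = expR (- (y * t)) * expR (- (y * (1 - t))).
    by rewrite -expRD; congr expR; ring.
  by ring.
rewrite negb_and -!leNgt mul0r => /orP[t0|t1].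
  by rewrite gn ?mul0r ?mulr0 // mulr_ge0_le0 // ltW.
rewrite [gm v _]gn ?mulr0 // subr_le0 -{1}(mulr1 y) ler_pM2l //.
Qed.

Lemma weight_beta_fun (a b : R) : a < b -> weight (Defs.beta_fun a b).
Proof.
move=> ab; have [mb b0 bn] := weight_bt (a + 1) (b - a).
have ba : 0 < b - a by rewrite subr_gt0.
have E x : Defs.beta_fun a b x = bt (a + 1) (b - a) x * (rgamma (b - a))^-1.
  rewrite /Defs.beta_fun /bt Gamma_real //=; case: ifP => _; last by rewrite mul0r.
  by rewrite addrK.
split=> [|x|x x0].
- rewrite (_ : Defs.beta_fun a b = fun x => bt (a + 1) (b - a) x * (rgamma (b - a))^-1).
    exact: measurable_funM.
  by apply/funext => x.
- by rewrite E mulr_ge0 // invr_ge0 ltW // rgamma_gt0.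
- by rewrite E bn // mul0r.
Qed.

Lemma emellin_beta_fun (a b s : R) : a < b -> 0 < s + a ->
  emellin (Defs.beta_fun a b) s = (rgamma (s + a) / rgamma (s + b))%:E.
Proof.
move=> ab sa; have ba : 0 < b - a by rewrite subr_gt0.
have sb : 0 < s + b by rewrite (lt_trans sa) // ltrD2l.
have [mb b0 bn] := weight_bt (s + a) (b - a).
have := beta_integral sa ba; rewrite (_ : s + a + (b - a) = s + b); last by ring.
set B := (\int[mu]_x _)%E => E.
have g1 := rgamma_gt0 sb; have g2 := rgamma_gt0 ba.
(* The identity [E] has a finite left side and a positive factor on the right, so B cannot be
   infinite and can be solved for. *)
have BE : B = (rgamma (s + a) * rgamma (b - a) / rgamma (s + b))%:E.
  have B0 : (0 <= B)%E by apply: integral_ge0 => x _; rewrite lee_fin.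
  move: E B0; case: B => [r| |] //=.
    by rewrite -!EFinM => -[->] _; rewrite mulfK // gt_eqF.
  by rewrite mulyr gtr0_sg // mul1e.
have -> : emellin (Defs.beta_fun a b) s = (B * (rgamma (b - a))^-1%:E)%E.
  rewrite /B -ge0_integralZr //; first last.
  - by rewrite lee_fin invr_ge0 ltW.
  - by move=> x _; rewrite lee_fin.
  - exact/measurable_EFinP.
  apply: eq_integral => x _; rewrite -EFinM; congr EFin.
  rewrite /Defs.beta_fun /bt Gamma_real //=; case: ifP => [/andP[x0 _]|_]; last by rewrite mulr0 mul0r.
  rewrite !mulrA -powRD ?(gt_eqF x0) ?implybT //.
  by congr (_ `^ _ * _ / _); ring.
rewrite BE -EFinM; congr EFin.
by move: (rgamma _) (rgamma _) (rgamma _) g1 g2 => x y z; move=> x0 z0; field; rewrite !gt_eqF.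
Qed.

End BetaGammaMellin.

(** * The Euler operator on convolutions *)

Section ConvolutionDerivative.
Variable R : realType.
Local Notation mu := (@lebesgue_measure R).
Local Notation D := (`]0%R, +oo[%classic : set R).
Local Notation mR := (measurableTypeR R).
Implicit Types f g : R -> R.

(* Yields the majorant for differentiating a convolution under the integral sign. *)
Definition slow_growth g : Prop := exists2 C : R, 0 <= C &
  forall x y, 0 < x -> x <= y <= 4 * x -> g y <= C * g x.

(** The exponential decreases, and 1 <= y / x <= 4 bounds the ratio of the powers by 4 ^ |a|,
    whatever the sign of a. *)
Lemma slow_growth_gamma_fun (a : R) : slow_growth (gamma_fun a).
Proof.
exists (4 `^ `|a|) => [|x y x0 /andP[xy y4]]; first exact: powR_ge0.
have y0 : 0 < y by rewrite (lt_le_trans x0).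
rewrite /gamma_fun x0 y0 mulrA ler_pM ?powR_ge0 ?expR_ge0 //; last first.
  by rewrite ler_expR lerN2.
have yE : y = (y / x) * x by rewrite divfK // gt_eqF.
have c1 : 1 <= y / x by rewrite ler_pdivlMr // mul1r.
have c4 : y / x <= 4 by rewrite ler_pdivrMr.
have c0 : 0 <= y / x by exact: (le_trans ler01).
rewrite {1}yE (powRM _ c0 (ltW x0)); apply: ler_wpM2r; first exact: powR_ge0.
apply: (@le_trans _ _ ((y / x) `^ `|a|)); first by rewrite ler_powR // ler_norm.
by rewrite ge0_ler_powR // nnegrE.
Qed.

(** The growth condition is invariant under scaling, so it applies to g (x / t) with the same
    constant for every t and can be integrated. *)
Lemma econv_growth f g (C x y : R) : weight f -> weight g -> 0 <= C ->
  (forall x y : R, 0 < x -> x <= y <= 4 * x -> g y <= C * g x) ->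
  0 < x -> x <= y <= 4 * x -> (econv f g y <= C%:E * econv f g x)%E.
Proof.
move=> wf wg C0 gC x0 /andP[xy y4]; have [mf f0 fn0] := wf; have [mg g0 gn0] := wg.
have mk z : measurable_fun (setT : set mR) (fun t => (f t * g (z / t) / t)%:E).
  apply: (eq_measurable_fun (fun t => (f t * g (z * t `^ (-1)) * t `^ (-1))%:E)).
    move=> t _; have [t0|t0] := leP t 0; first by rewrite fn0 // !mul0r.
    by rewrite powR_inv1 // ltW.
  have mi : measurable_fun (setT : set mR) (fun t : mR => t `^ (-1) : mR) by exact: measurable_powR.
  apply/measurable_EFinP; apply: measurable_funM => //; apply: measurable_funM => //.
  by apply: (measurableT_comp mg); exact: measurable_funM.
have k0 z t : (0 <= (f t * g (z / t) / t)%:E)%E.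
  rewrite lee_fin; have [t0|t0] := leP t 0; first by rewrite fn0 // !mul0r.
  by rewrite !mulr_ge0 // invr_ge0 ltW.
rewrite /econv -(ge0_integralZl mu measurableT (mk x) (fun t _ => k0 x t)) ?lee_fin //.
apply: ge0_le_integral => //; first by apply: measurable_funeM.
move=> t _; rewrite -EFinM lee_fin; have [t0|t0] := leP t 0.
  by rewrite fn0 // !mul0r mulr0.
rewrite mulrA ler_wpM2r ?invr_ge0 ?(ltW t0) // mulrCA ler_wpM2l //.
apply: gC; first by rewrite divr_gt0.
by rewrite ler_pM2r ?invr_gt0 // xy mulrA ler_pM2r ?invr_gt0.
Qed.

(* The convolution is finite almost everywhere since its Mellin transform is, and slow
   growth carries finiteness from some point of (x / 4, x] to x. *)
Lemma econv_fin f g (s F G x : R) : weight f -> weight g -> slow_growth g ->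
  emellin f s = F%:E -> emellin g s = G%:E -> 0 < x -> econv f g x \is a fin_num.
Proof.
move=> wf wg [C C0 gC] fF gG x0.
have E := emellin_econv s wf wg; rewrite fF gG -EFinM in E.
have mE : measurable_fun (setT : set mR) (fun x => (x `^ (s - 1))%:E * econv f g x)%E.
  by apply: emeasurable_funM; [apply/measurable_EFinP; exact: measurable_powR|
    exact: measurable_econv].
have iE : mu.-integrable setT (fun x => (x `^ (s - 1))%:E * econv f g x)%E.
  apply/integrableP; split => //.
  under eq_integral do rewrite gee0_abs ?mule_ge0 ?lee_fin ?powR_ge0 ?econv_ge0 //.
  by rewrite E ltry.
have [A [mA A0 HA]] := integrable_ae measurableT iE.
have [[y [yA xy]]|nex] := pselect (exists y, ~ A y /\ x / 4 < y <= x).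
  have y0 : 0 < y by move: xy => /andP[h _]; rewrite (lt_trans _ h) // divr_gt0.
  have fy : econv f g y \is a fin_num.
    have h : ((y `^ (s - 1))%:E * econv f g y)%E \is a fin_num.
      by apply: contrapT => h; apply: yA; apply: HA => /= /(_ I).
    move: h; have := econv_ge0 y wf wg; case: (econv f g y) => //= _.
    by rewrite mulry gtr0_sg ?powR_gt0 // mul1e.
  have h := @econv_growth f g C y x wf wg C0 gC y0 _.
  rewrite ge0_fin_numE ?econv_ge0 //; apply: le_lt_trans (h _) _.
    by move: xy => /andP[h1 ->]; rewrite mulrC -ler_pdivrMr // ltW.
  by rewrite -(fineK fy) -EFinM ltry.
exfalso.
have sub : `](x / 4), x]%classic `<=` A.
  move=> y /=; rewrite in_itv /= => hy; apply: contrapT => nA.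
  by apply: nex; exists y.
have m1 : measurable (`](x / 4), x]%classic : set mR) by exact: measurable_itv.
have := le_measure mu (mem_set m1) (mem_set mA) sub.
have A0' : mu A = 0%E by exact: A0.
have x4 : x / 4 < x by rewrite ltr_pdivrMr //; lra.
have I1 : mu `](x / 4), x]%classic = (x - x / 4)%:E.
  by rewrite lebesgue_measure_itv /= lte_fin x4.
move=> h; have : ((x - x / 4)%:E <= 0)%E by rewrite -A0' -I1.
by rewrite lee_fin; lra.
Qed.

Lemma slow_growth_mconv f g (s F G : R) : weight f -> weight g -> slow_growth g ->
  emellin f s = F%:E -> emellin g s = G%:E -> slow_growth (mconv f g).
Proof.
move=> wf wg gg fF gG; have [C C0 gC] := gg; exists C => // x y x0 xy.
have y0 : 0 < y by move: xy => /andP[h _]; rewrite (lt_le_trans x0).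
have fx := econv_fin wf wg gg fF gG x0; have fy := econv_fin wf wg gg fF gG y0.
rewrite !mconvE // -lee_fin EFinM !fineK //.
exact: econv_growth.
Qed.

Lemma econv_integrable f g x : weight f -> weight g -> econv f g x \is a fin_num ->
  mu.-integrable D (EFin \o (fun t => f t * g (x / t) / t)).
Proof.
move=> wf wg fx; have [mf f0 fn0] := wf; have [mg g0 gn0] := wg.
have mD := @measurable_half_line R.
have n0 t : t <= 0 -> (f t * g (x / t) / t)%:E = 0%E by move=> /fn0 ->; rewrite !mul0r.
apply/integrableP; split.
  apply/measurable_EFinP.
  apply: (eq_measurable_fun (fun t => f t * g (x * t `^ (-1)) * t `^ (-1))).
    by move=> t /set_mem /=; rewrite in_itv /= andbT => t0; rewrite powR_inv1 // ltW.
  have mi : measurable_fun (setT : set mR) (fun t : mR => t `^ (-1) : mR) by exact: measurable_powR.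
  apply: (@measurable_funS _ _ _ _ setT) => //.
  apply: measurable_funM => //; apply: measurable_funM => //.
  by apply: (measurableT_comp mg); exact: measurable_funM.
rewrite (_ : (\int[mu]_(t in D) _)%E = econv f g x).
  by rewrite -ge0_fin_numE ?econv_ge0.
rewrite /econv -half_line_integral //; apply: eq_integral => t /set_mem /=.
rewrite in_itv /= andbT => t0; rewrite ger0_norm //.
by rewrite !mulr_ge0 // invr_ge0 ltW.
Qed.

(** The hypothesis is x g1' = a g1 - g2. Since x d/dx commutes with the scalings x -> x / t, the
    relation passes to the convolution once the derivative may be taken under the integral. *)
Lemma is_derive_mconv f g1 g2 (a s F G1 G2 x : R) :
  weight f -> weight g1 -> weight g2 -> slow_growth g1 -> slow_growth g2 ->
  emellin f s = F%:E -> emellin g1 s = G1%:E -> emellin g2 s = G2%:E ->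
  (forall y : R, 0 < y -> is_derive y (1 : R) g1 ((a * g1 y - g2 y) / y)) ->
  0 < x -> is_derive x (1 : R) (mconv f g1) ((a * mconv f g1 x - mconv f g2 x) / x).
Proof.
move=> wf w1 w2 sg1 sg2 fF gG1 gG2 dg x0.
have mD := @measurable_half_line R.
have [mf f0 fn0] := wf; have [mg1 g10 gn1] := w1; have [mg2 g20 gn2] := w2.
have [C1 C10 gC1] := sg1; have [C2 C20 gC2] := sg2.
pose k g (y t : R) := f t * g (y / t) / t.
have i1 (y : R) : 0 < y -> mu.-integrable D (EFin \o k g1 y).
  by move=> y0; apply: econv_integrable => //; exact: (econv_fin wf w1 sg1 fF gG1).
have i2 (y : R) : 0 < y -> mu.-integrable D (EFin \o k g2 y).
  by move=> y0; apply: econv_integrable => //; exact: (econv_fin wf w2 sg2 fF gG2).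
have dk (y t : R) : 0 < y -> D t -> is_derive y (1 : R) (k g1 ^~ t) ((a * k g1 y t - k g2 y t) / y).
  move=> y0; rewrite /= in_itv /= andbT => t0.
  have d1 : is_derive y (1 : R) (fun z : R => z / t) t^-1.
    by apply: is_derive_eq; rewrite /GRing.scale /=; ring.
  have d2 := @is_derive1_comp R g1 (fun z => z / t) y _ _ (dg (y / t) (divr_gt0 y0 t0)) d1.
  rewrite (_ : k g1 ^~ t = (f t / t) *: (g1 \o (fun z => z / t))); last first.
    by apply/funext => z; rewrite /k !fctE /GRing.scale /=; ring.
  apply: is_derive_eq; rewrite /GRing.scale /= /k.
  by field; rewrite !gt_eqF.
(* This interval lies between x / 2 and 4 (x / 2), which is where the factor 4 of [slow_growth]
   comes from. *)
pose I : set R := `](x / 2), (2 * x)[%classic.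
have I0 (y : R) : I y -> 0 < y.
  by rewrite /I /= in_itv /= => /andP[h _]; rewrite (lt_trans _ h) // divr_gt0.
have Ix : I x by rewrite /I /= in_itv /=; apply/andP; split; lra.
have x20 : 0 < x / 2 by rewrite divr_gt0.
(* The majorant bounds 1 / y by 2 / x on [I] and both kernels by their values at x / 2. *)
pose G (t : R) := 2 / x * (`|a| * C1 * k g1 (x / 2) t + C2 * k g2 (x / 2) t).
have k0 g (y t : R) : (forall z, 0 <= g z) -> 0 <= k g y t.
  move=> g0; rewrite /k; have [t0|t0] := leP t 0; first by rewrite fn0 // !mul0r.
  by rewrite !mulr_ge0 // invr_ge0 ltW.
have G0 (t : R) : 0 <= G t.
  rewrite /G mulr_ge0 ?divr_ge0 ?(ltW x0) // addr_ge0 // mulr_ge0 ?k0 //.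
  by rewrite mulr_ge0.
have iG : mu.-integrable D (EFin \o G).
  have j := integrableZl mD (2 / x) (integrableD mD
    (integrableZl mD (`|a| * C1) (i1 _ x20)) (integrableZl mD C2 (i2 _ x20))).
  by apply: (eq_integrable mD _ _ _ j) => t _.
have intf (y : R) : I y -> mu.-integrable D (EFin \o k g1 y) by move=> /I0; exact: i1.
have derf (y t : R) : I y -> D t -> derivable (k g1 ^~ t) y 1.
  by move=> /I0 y0 Dt; have [] := dk y t y0 Dt.
have dE (y t : R) : 0 < y -> D t -> derive1 (k g1 ^~ t) y = (a * k g1 y t - k g2 y t) / y.
  by move=> y0 Dt; rewrite derive1E; have h := dk y t y0 Dt; exact: derive_val.
have kC g (C y t : R) : (forall z, 0 <= g z) ->
    (forall x y : R, 0 < x -> x <= y <= 4 * x -> g y <= C * g x) -> I y -> D t ->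
    k g y t <= C * k g (x / 2) t.
  move=> g0 gC; rewrite /I /= !in_itv /= andbT => /andP[y1 y2] t0.
  rewrite /k mulrA ler_wpM2r ?invr_ge0 ?(ltW t0) // mulrCA ler_wpM2l //.
  apply: gC; first by rewrite divr_gt0.
  rewrite ler_pM2r ?invr_gt0 // (ltW y1) mulrA ler_pM2r ?invr_gt0 //=.
  by lra.
have Gub (y t : R) : I y -> D t -> `|derive1 (k g1 ^~ t) y| <= G t.
  move=> Iy Dt; have y0 := I0 y Iy; rewrite dE // normrM mulrC normfV (gtr0_norm y0).
  have yx : y^-1 <= 2 / x.
    rewrite -[2 / x]invrK lef_pV2 ?posrE ?invr_gt0 ?divr_gt0 // invf_div.
    by move: Iy; rewrite /I /= in_itv /= => /andP[/ltW].
  rewrite /G ler_pM ?invr_ge0 ?(ltW y0) //.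
  rewrite (le_trans (ler_normB _ _)) // lerD //.
    by rewrite normrM (ger0_norm (k0 _ _ _ g10)) -mulrA ler_wpM2l // kC.
  by rewrite (ger0_norm (k0 _ _ _ g20)) kC.
have cE := derivable_under_integral mD Ix intf derf G0 iG Gub.
have dE' := differentiation_under_integral mD Ix intf derf G0 iG Gub.
have mE (g : R -> R) y : mconv f g y = \int[mu]_(t in D) k g y t by [].
have -> : mconv f g1 = fun y => \int[mu]_(t in D) k g1 y t by apply/funext => y; rewrite mE.
apply: DeriveDef => //.
rewrite -derive1E dE' mE.
transitivity (\int[mu]_(t in D) ((a * k g1 x t - k g2 x t) * x^-1)).
  by apply: eq_Rintegral => t /set_mem Dt; rewrite -(dE x t x0 Dt).
have j1 : mu.-integrable D (EFin \o (fun t => a * k g1 x t)).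
  by apply: (eq_integrable mD _ _ _ (integrableZl mD a (i1 _ x0))) => t _.
rewrite RintegralZr //; last first.
  by apply: (eq_integrable mD _ _ _ (integrableB mD j1 (i2 _ x0))) => t _.
rewrite RintegralB //; last exact: i2.
by rewrite RintegralZl //; exact: i1.
Qed.

Lemma is_derive_gamma_fun (a x : R) : 0 < x ->
  is_derive x (1 : R) (gamma_fun a) ((a * gamma_fun a x - gamma_fun (a + 1) x) / x).
Proof.
move=> x0; apply: (near_eq_is_derive (f := gam a)).
- by near=> y; rewrite /gamma_fun ifT //; near: y; exact: lt_nbhsr.
apply: is_derive_eq; first exact: is_derive_gam.
rewrite /gamma_fun x0 /gam powRB ?powRD ?(gt_eqF x0) ?implybT // powRr1 ?ltW //.
by field; rewrite gt_eqF.
Unshelve. all: by end_near. Qed.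

(** One Gamma factor is kept innermost, where the derivative acts; differentiating then only mixes
    the parameters a and a + 1. *)
Definition gamma_conv (fs : seq (R -> R)) (a : R) : R -> R := foldr (@mconv R) (gamma_fun a) fs.

Lemma mconvs_gamma_conv fs (a : R) : mconvs (rcons fs (gamma_fun a)) = gamma_conv fs a.
Proof.
elim: fs => [|f fs IH] //=.
by rewrite -/(gamma_conv fs a) -IH; case: fs {IH}.
Qed.

(** The induction is for all a at once, because the derivative for a involves the convolution for a
    + 1. *)
Lemma gamma_conv_props fs (s : R) :
  (forall f, List.In f fs -> weight f /\ exists F : R, emellin f s = F%:E) ->
  forall a, 0 < s + a ->
  [/\ weight (gamma_conv fs a), slow_growth (gamma_conv fs a),
    exists F : R, emellin (gamma_conv fs a) s = F%:E &
    forall x : R, 0 < x -> is_derive x (1 : R) (gamma_conv fs a)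
      ((a * gamma_conv fs a x - gamma_conv fs (a + 1) x) / x)].
Proof.
elim: fs => [|f fs IH] hfs a sa.
  split; [exact: weight_gamma_fun|exact: slow_growth_gamma_fun| |].
    by exists (rgamma (s + a)); exact: emellin_gamma_fun.
  by move=> x; exact: is_derive_gamma_fun.
have [wf [F fF]] := hfs f (or_introl erefl).
have hfs' h : List.In h fs -> weight h /\ exists F : R, emellin h s = F%:E.
  by move=> hh; apply: hfs; right.
have [w1 s1 [G1 e1] d1] := IH hfs' a sa.
have sa1 : 0 < s + (a + 1) by rewrite addrA addr_gt0.
have [w2 s2 [G2 e2] _] := IH hfs' (a + 1) sa1.
split.
- exact: weight_mconv.
- exact: (slow_growth_mconv wf w1 s1 fF e1).
- by exists (F * G1); exact: emellin_mconv.
- by move=> x x0; exact: (is_derive_mconv wf w1 w2 s1 s2 fF e1 e2 d1 x0).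
Qed.

(* - x d/dx maps W_k to W_(k+1) - (a + k) W_k, while the Mellin transform of W_k is
   (s + a)_k times that of W_0. *)
Lemma iter_theta (W : nat -> R -> R) (a : R) (v0 : R -> R) (l : nat) :
  (forall k (x : R), 0 < x -> is_derive x (1 : R) (W k) (((a + k%:R) * W k x - W k.+1 x) / x)) ->
  (forall x : R, 0 < x -> v0 x = W 0%N x) ->
  exists L : seq (R * nat),
    (forall x, 0 < x -> iter l (fun (f : R -> R) x => - x * derive1 f x) v0 x =
       \sum_(z <- L) z.1 * W z.2 x) /\
    (forall s, \sum_(z <- L) z.1 * \prod_(i < z.2) (s + a + i%:R) = s ^+ l).
Proof.
move=> dW hv; elim: l => [|l [L [IH1 IH2]]].
  exists [:: (1, 0%N)]; split=> [x x0|s]; rewrite big_seq1 /=; first by rewrite mul1r hv.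
  by rewrite big_ord0 mulr1.
(* Each W_k yields a multiple of W_k and a copy of W_(k+1); on the Mellin side this is s (s + a)_k =
   (s + a)_(k+1) - (a + k) (s + a)_k. *)
exists ([seq (- ((a + z.2%:R) * z.1), z.2) | z <- L] ++ [seq (z.1, z.2.+1) | z <- L]).
split=> [x x0|s]; rewrite big_cat !big_map /= -big_split /=.
  have dL : is_derive x (1 : R) (fun y => \sum_(z <- L) z.1 * W z.2 y)
      (\sum_(z <- L) z.1 * (((a + z.2%:R) * W z.2 x - W z.2.+1 x) / x)).
    elim: (L) => [|z L' IH].
      rewrite big_nil (_ : (fun y => _) = cst 0); first exact: is_derive_cst.
      by apply/funext => y; rewrite big_nil.
    rewrite big_cons (_ : (fun y => _) =
      z.1 *: W z.2 + (fun y => \sum_(z <- L') z.1 * W z.2 y)); last first.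
      by apply/funext => y; rewrite big_cons.
    by apply: is_deriveD; apply: is_deriveZ; exact: dW.
  have dv : is_derive x (1 : R) (iter l (fun (f : R -> R) x => - x * derive1 f x) v0)
      (\sum_(z <- L) z.1 * (((a + z.2%:R) * W z.2 x - W z.2.+1 x) / x)).
    apply: near_eq_is_derive dL.
    by near=> y; rewrite IH1 //; near: y; exact: lt_nbhsr.
  rewrite derive1E derive_val mulr_sumr; apply: eq_bigr => z _.
  by field; rewrite gt_eqF.
rewrite exprS -IH2 mulr_sumr; apply: eq_bigr => z _.
by rewrite big_ord_recr /=; ring.
Unshelve. all: by end_near. Qed.

End ConvolutionDerivative.

(** * Forms with Gamma moments *)

(** With u = n %/ p, the factor of index u in the component [chi hp n] is e + 1 - (e + u + 1) + u =
    0; it is present because n < N. *)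
Lemma pochv_step_node_eq0 (R : realType) (p N n : nat) (hp : (0 < p)%N) (e : 'I_p -> R) :
  (n < N)%N ->
  pochv (fun i => (e i)%:C + (1 - (e (chi hp n) + (n %/ p)%:R + 1)%:C)) (@step_line p N) = 0.
Proof.
move=> nN; apply/eqP/prodf_eq0; exists (chi hp n) => //.
have lt : (n %/ p < step_line N (chi hp n))%N by rewrite ltn_step_line /= -divn_eq.
apply/prodf_eq0; exists (Ordinal lt) => //=.
by rewrite !rmorphD /= rmorph_nat rmorph1; apply/eqP; ring.
Qed.

Lemma sum_step_line (d N : nat) (hd : (0 < d)%N) : (\sum_(i < d) step_line N i = N)%N.
Proof.
transitivity (\sum_(i < d) \sum_(k < step_line N i) 1)%N.
  by apply: eq_bigr => i _; rewrite sum1_card card_ord.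
by rewrite (big_step_line _ _ hd (fun _ _ => 1%N)) sum1_card card_ord.
Qed.

Section GammaMomentForms.
Variables (R : realType) (p q r : nat) (hp : (0 < p)%N) (hq : (0 < q)%N).
Local Notation C := (R[i]).
Local Notation mu := (@lebesgue_measure R).
Local Notation D := (`]0%R, +oo[%classic : set R).
Variables (e : 'I_p -> R) (a : 'I_q -> R) (b : 'I_r -> R).
Variables (delta : 'I_q -> 'I_r -> nat) (ell : 'I_q -> nat) (w : 'I_q -> R -> R).

(** A common shape for both families: [delta] records which b_h is raised by one in the j-th weight,
    and [ell] the power of s produced by iterating -x d/dx. *)
Definition gamma_moment (j : 'I_q) (s : R) : R :=
  s ^+ ell j * (\prod_(i < q) rgamma (s + a i) / \prod_(h < r) rgamma (s + (b h + (delta j h)%:R))).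

Hypothesis e_nonresonant : forall i h, i != h -> e i - e h \isn't a Num.int.
Hypothesis e_a : forall i rho, -1 < e i + a rho.
Hypothesis a_b : forall h, exists i, a i < b h.

Let dom (s : R) : Prop := forall i, 0 < s + a i.

Hypothesis w_int : forall j s, dom s ->
  mu.-integrable D (EFin \o (fun x => x `^ (s - 1) * w j x)).
Hypothesis w_mom : forall j s, dom s ->
  \int[mu]_(x in D) (x `^ (s - 1) * w j x) = gamma_moment j s.

Lemma exponent_domain i (k : nat) : dom (e i + k%:R + 1).
Proof. by move=> rho; have := e_a i rho; have := ler0n R k; lra. Qed.

(** Here [nu] is the shift of b in the integrand, and [kappa] and [eps] are constants without
    influence on the vanishing. S is approximated on every admissible K because the set in question
    varies with the node. The last hypothesis is the degree bound for T. *)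
Lemma gamma_pairing_A_eq0 (N n : nat) (Sigma : R -> C) (others : set C) (S : C -> C)
    (kappa eps : C) (nu : 'I_r -> nat) (A : 'I_p -> {poly C}) :
  encloses_exactly Sigma (node_set e (@step_line p N.+1)) others ->
  (forall K, (exists M : R, forall t, K t -> normc t <= M) ->
     (forall d, others d -> exists2 eps : R, 0 < eps & forall t, K t -> eps <= normc (t - d)) ->
     rational_approx K others S) ->
  (forall c : R, (forall i, 0 < c + a i + 1) -> (forall h, 0 < c + b h + 1) ->
     S c%:C = eps * (\prod_(h < r) rgamma (c + b h + 1 + (nu h)%:R) /
               \prod_(i < q) rgamma (c + a i + 1))%:C) ->
  (forall i, (size (A i) <= step_line N.+1 i)%N) ->
  (forall x, 0 < x -> power_form e A x = kappa * contour_integral Sigma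
     (fun t => S t / \prod_(l < N.+1) (t - (step_node hp e l)%:C) * cpow x t)) ->
  (forall h, n %/ q + delta (chi hq n) h <= nu h)%N ->
  (q * (n %/ q) + \sum_(h < r) (nu h - n %/ q - delta (chi hq n) h) + ell (chi hq n) < N)%N ->
  pairing (moment_matrix hp hq e gamma_moment) (flat N hp A) 'X^n = 0.
Proof.
move=> encl S_approx SE sA AE hnu hdeg.
rewrite (pairing_A_integral hp hq exponent_domain w_int w_mom _ sA).
have [T sT TE] := rgamma_quotient_poly (ell (chi hq n)) a b hnu.
have X Sa := @contour_form_orthogonal R p hp e e_nonresonant N Sigma others S kappa encl Sa q (n %/ q) w
  gamma_moment dom (chi hq n) (eps *: map_poly (real_complex R) T) (power_form e A) w_int w_mom.
apply: X => //.
- move=> l; have nl := step_node_set hp e l.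
  apply: S_approx; first exact: (contour_node_bounded encl).
  by move=> d; exact: (@contour_node_away _ _ _ _ encl _ d nl).
- by move=> l; rewrite /step_node -(addrA (e _)) -natrD; exact: exponent_domain.
- by rewrite (leq_trans (size_scale_leq _ _)) // size_map_poly (leq_trans sT).
move=> l; set c := step_node hp e l.
have ca i : 0 < c + a i + 1.
  by rewrite addrAC; exact: exponent_domain.
have cb h : 0 < c + b h + 1.
  by have [i ai] := a_b h; apply: lt_trans (ca i) _; rewrite ltrD2r ltrD2l.
by rewrite hornerZ horner_map /= -TE // SE // -mulrA -rmorphM.
Qed.

End GammaMomentForms.

Lemma In_map (T U : Type) (f : T -> U) (s : seq T) (y : U) :
  List.In y [seq f x | x <- s] -> exists x, y = f x.
Proof.
by elim: s => //= x s IH [<-|/IH]; [exists x|].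
Qed.

Lemma In_cat (T : Type) (s1 s2 : seq T) (y : T) :
  List.In y (s1 ++ s2) -> List.In y s1 \/ List.In y s2.
Proof.
elim: s1 => [|x s1 IH] /=; first by right.
by case=> [->|/IH[]]; [left; left|left; right|right].
Qed.

(** * Moments of the convolution weights and of their derivatives *)

Section WeightMoments.
Variables (R : realType) (I J : Type) (a1 b1 : I -> R) (a2 : J -> R).
Local Notation mu := (@lebesgue_measure R).
Local Notation D := (`]0%R, +oo[%classic : set R).

(** The index types are arbitrary and the factors listed, so that the Jacobi weights are the case
    without Gamma factors and a single Gamma factor can receive an index of its own. *)
Definition beta_gamma_weight (sI : seq I) (sJ : seq J) : R -> R :=
  mconvs ([seq Defs.beta_fun (a1 i) (b1 i) | i <- sI] ++ [seq gamma_fun (a2 j) | j <- sJ]).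

Definition beta_gamma_mellin (sI : seq I) (sJ : seq J) (s : R) : R :=
  (\prod_(i <- sI) rgamma (s + a1 i) * \prod_(j <- sJ) rgamma (s + a2 j)) /
  \prod_(i <- sI) rgamma (s + b1 i).

Variable s : R.
Hypothesis a1b1 : forall i, a1 i < b1 i.
Hypothesis sa1 : forall i, 0 < s + a1 i.
Hypothesis sa2 : forall j, 0 < s + a2 j.

Lemma emellin_beta_gamma_weight sI sJ : (0 < size sI + size sJ)%N ->
  weight (beta_gamma_weight sI sJ) /\
  emellin (beta_gamma_weight sI sJ) s = (beta_gamma_mellin sI sJ s)%:E.
Proof.
move=> s0.
pose fs := [seq (Defs.beta_fun (a1 i) (b1 i), rgamma (s + a1 i) / rgamma (s + b1 i)) | i <- sI] ++
  [seq (gamma_fun (a2 j), rgamma (s + a2 j)) | j <- sJ].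
have fs1 : [seq x.1 | x <- fs] =
    [seq Defs.beta_fun (a1 i) (b1 i) | i <- sI] ++ [seq gamma_fun (a2 j) | j <- sJ].
  by rewrite map_cat -!map_comp.
have fs2 : \prod_(x <- fs) x.2 = beta_gamma_mellin sI sJ s.
  rewrite /fs big_cat !big_map /= prodf_div /beta_gamma_mellin.
  by rewrite mulrAC.
rewrite /beta_gamma_weight -fs1 -fs2; apply: emellin_mconvs.
  by rewrite -size_eq0 size_cat !size_map -lt0n.
move=> x xfs; case: (In_cat xfs) => {}xfs; have [i ->] := In_map xfs => /=.
  by split; [exact: weight_beta_fun|exact: emellin_beta_fun].
by split; [exact: weight_gamma_fun|exact: emellin_gamma_fun].
Qed.

Lemma beta_gamma_weight_moment sI sJ : (0 < size sI + size sJ)%N ->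
  mu.-integrable D (EFin \o (fun x => x `^ (s - 1) * beta_gamma_weight sI sJ x)) /\
  \int[mu]_(x in D) (x `^ (s - 1) * beta_gamma_weight sI sJ x) = beta_gamma_mellin sI sJ s.
Proof.
by move=> s0; have [h1 h2] := emellin_beta_gamma_weight s0; exact: weight_integrable.
Qed.

End WeightMoments.

Section ThetaMoments.
Variables (R : realType) (I J : Type) (a1 b1 : I -> R) (a2 : J -> R).
Local Notation mu := (@lebesgue_measure R).
Local Notation D := (`]0%R, +oo[%classic : set R).
Variable s : R.
Hypothesis a1b1 : forall i, a1 i < b1 i.
Hypothesis sa1 : forall i, 0 < s + a1 i.
Hypothesis sa2 : forall j, 0 < s + a2 j.

(** Raising the parameter of the last Gamma factor by k multiplies the Mellin transform by (s +
    a)_k; [iter_theta] expresses v through these convolutions, with coefficients that sum up to s ^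
    l. *)
Lemma theta_moment (l : nat) (sI : seq I) (sJ : seq J) : (0 < size sJ)%N ->
  let v := iter l (fun (f : R -> R) x => - x * derive1 f x) (beta_gamma_weight a1 b1 a2 sI sJ) in
  mu.-integrable D (EFin \o (fun x => x `^ (s - 1) * v x)) /\
  \int[mu]_(x in D) (x `^ (s - 1) * v x) = s ^+ l * beta_gamma_mellin a1 b1 a2 sI sJ s.
Proof.
case/lastP: sJ => // sJ j0 _ v.
pose a := a2 j0.
pose fs := [seq Defs.beta_fun (a1 i) (b1 i) | i <- sI] ++ [seq gamma_fun (a2 j) | j <- sJ].
pose W (k : nat) := gamma_conv fs (a + k%:R).
(* [None] indexes the distinguished Gamma factor with its raised parameter; the other factors are
   unchanged. *)
pose ak (k : nat) (j : option J) := if j is Some j' then a2 j' else a + k%:R.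
have sk k : 0 < s + (a + k%:R) by rewrite addrA ltr_wpDr // /a sa2.
have sak k j : 0 < s + ak k j by case: j => [j|] //=.
pose sJ' := rcons [seq Some j | j <- sJ] None.
have WE k : W k = beta_gamma_weight a1 b1 (ak k) sI sJ'.
  rewrite /W -mconvs_gamma_conv /beta_gamma_weight /sJ' map_rcons -map_comp -rcons_cat.
  by [].
have W0 : beta_gamma_weight a1 b1 a2 sI (rcons sJ j0) = W 0%N.
  by rewrite /W -mconvs_gamma_conv /beta_gamma_weight map_rcons addr0 rcons_cat.
have sJ'0 : (0 < size sI + size sJ')%N by rewrite size_rcons addnS.
have Wm k := beta_gamma_weight_moment a1b1 sa1 (sak k) sJ'0.
have ME k : beta_gamma_mellin a1 b1 (ak k) sI sJ' s =
    \prod_(i < k) (s + a + i%:R) * beta_gamma_mellin a1 b1 a2 sI (rcons sJ j0) s.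
  rewrite /beta_gamma_mellin /sJ' -!cats1 !big_cat !big_seq1 big_map /= addrA rgamma_shift ?sa2 //.
  by rewrite -/a; ring.
have hfs f : List.In f fs -> weight f /\ exists F : R, emellin f s = F%:E.
  move=> ffs; case: (In_cat ffs) => {}ffs; have [i ->] := In_map ffs.
    split; first exact: weight_beta_fun.
    by exists (rgamma (s + a1 i) / rgamma (s + b1 i)); exact: emellin_beta_fun.
  split; first exact: weight_gamma_fun.
  by exists (rgamma (s + a2 i)); exact: emellin_gamma_fun.
have dW (k : nat) (x : R) : 0 < x ->
    is_derive x (1 : R) (W k) (((a + k%:R) * W k x - W k.+1 x) / x).
  move=> x0; have [_ _ _ dw] := gamma_conv_props hfs (sk k).
  by rewrite /W -natr1 addrA; exact: dw.
have [L [vE sE]] := iter_theta (v0 := beta_gamma_weight a1 b1 a2 sI (rcons sJ j0)) l dW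
  (fun x _ => congr1 (fun f : R -> R => f x) W0).
have mD := @measurable_half_line R.
have [i1 i2] := @Rintegral_sum R D (R * nat) L (fun z => z.1)
  (fun z x => x `^ (s - 1) * W z.2 x) mD (fun z => eq_rect_r
    (fun f => mu.-integrable D (EFin \o (fun x => x `^ (s - 1) * f x))) (Wm z.2).1 (WE z.2)).
have vE' x : D x -> x `^ (s - 1) * v x = \sum_(z <- L) z.1 * (x `^ (s - 1) * W z.2 x).
  rewrite /= in_itv /= andbT => x0; rewrite /v vE // mulr_sumr.
  by apply: eq_bigr => z _; rewrite mulrCA.
split.
  by apply: (eq_integrable mD _ _ _ i1) => x /set_mem Dx; rewrite /= vE'.
transitivity (\int[mu]_(x in D) (\sum_(z <- L) z.1 * (x `^ (s - 1) * W z.2 x))).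
  by apply: eq_Rintegral => x /set_mem Dx; rewrite vE'.
rewrite i2 -sE mulr_suml; apply: eq_bigr => z _.
by rewrite WE (Wm z.2).2 ME mulrA.
Qed.

End ThetaMoments.

Section BetaSupport.
Variable R : realType.
Local Notation mu := (@lebesgue_measure R).
Local Notation D := (`]0%R, +oo[%classic : set R).

(** If 1 <= x and t > 0, then 1 <= t or 1 <= x / t, so one factor of the integrand is 0. *)
Lemma mconvs_beta_eq0 (I : Type) (a b : I -> R) (sI : seq I) (x : R) : 1 <= x ->
  mconvs [seq Defs.beta_fun (a i) (b i) | i <- sI] x = 0.
Proof.
have beta0 i (y : R) : 1 <= y -> Defs.beta_fun (a i) (b i) y = 0.
  by move=> y1; rewrite /Defs.beta_fun [y < 1]ltNge y1 andbF.
elim: sI x => [|i [|i' sI] IH] x x1 //; first exact: beta0.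
rewrite [mconvs _]/= -/(mconvs [seq Defs.beta_fun (a i) (b i) | i <- i' :: sI]) /mconv.
rewrite (@eq_Rintegral _ _ _ mu D (cst 0)); first by rewrite Rintegral_cst // mul0r.
move=> t /set_mem /=; rewrite in_itv /= andbT => t0.
have [t1|t1] := leP 1 t; first by rewrite beta0 // !mul0r.
rewrite [X in _ * X / _]IH ?mulr0 ?mul0r //.
by rewrite ler_pdivlMr // mul1r (le_trans (ltW t1)).
Qed.

Lemma cintegral_unit_interval (f : R -> R[i]) : (forall x, 1 <= x -> f x = 0) ->
  cintegral `]0, 1[ f = cintegral D f.
Proof.
move=> f1; rewrite /cintegral /Rintegral.
by congr (fine _ +i* fine _); rewrite integral_mkcond [RHS]integral_mkcond;
  apply: eq_integral => x _; rewrite !patchE !mem_setE !in_itv /= andbT;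
  have [x1|x1] := ltP x 1; rewrite ?andbT ?andbF ?(f1 x x1) //=; case: ifP.
Qed.

End BetaSupport.

(** * The Jacobi forms *)

Lemma leq_step_line (d N n : nat) (i : 'I_d) : (n <= N)%N -> (step_line n i <= step_line N i)%N.
Proof.
have hd : (0 < d)%N by case: d i => [[]|].
by elim: N => [|N IH]; [rewrite leqn0 => /eqP ->|
  rewrite leq_eqVlt => /predU1P[-> //|/IH h]; rewrite (step_lineS N hd) (leq_trans h) ?leq_addr].
Qed.

Lemma step_line_bounds (d n : nat) (i : 'I_d) : (n %/ d <= step_line n i <= (n %/ d).+1)%N.
Proof. by rewrite /step_line; case: (_ < _)%N; rewrite ?addn1 ?addn0 leqnn leqnSn. Qed.

Section ComplexGamma.
Variable R : realType.
Local Notation C := (R[i]).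

Lemma Gammav_real (d : nat) (f : 'I_d -> R) : (forall i, 0 < f i) ->
  Gammav (fun i => (f i)%:C) = (\prod_(i < d) rgamma (f i))%:C.
Proof. by move=> f0; rewrite rmorph_prod; apply: eq_bigr => i _; rewrite Gamma_real. Qed.

Section Approximation.
Variables (K others : set C).
Hypothesis K_bounded : exists M : R, forall t, K t -> normc t <= M.
Hypothesis K_away : forall d, others d ->
  exists2 e : R, 0 < e & forall t, K t -> e <= normc (t - d).

Lemma rational_approx_Gammav (d : nat) (c : 'I_d -> C) : (forall i (k : nat), others (- c i - k%:R)) ->
  rational_approx K others (fun t => Gammav (fun i => t + c i)).
Proof.
by move=> oc; apply: rational_approx_prod => // i _; apply: rational_approx_Gamma.
Qed.

Lemma rational_approx_GammavV (d : nat) (c : 'I_d -> C) :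
  rational_approx K others (fun t => (Gammav (fun i => t + c i))^-1).
Proof.
apply: eq_rational_approx (rational_approx_prod K_bounded K_away (index_enum 'I_d)
  (P := xpredT) (fun i _ => rational_approx_GammaV K_bounded K_away (c i))) => t _.
by rewrite /Gammav prodfV.
Qed.

Lemma rational_approx_pochv (d : nat) (c : 'I_d -> C) (nu : 'I_d -> nat) :
  rational_approx K others (fun t => pochv (fun i => t + c i) nu).
Proof.
by apply: rational_approx_prod => // i _; apply: rational_approx_poch.
Qed.

End Approximation.
End ComplexGamma.

Section Jacobi.
Variables (R : realType) (p q : nat) (hp : (0 < p)%N) (hq : (0 < q)%N).
Local Notation C := (R[i]).
Local Notation mu := (@lebesgue_measure R).
Local Notation D := (`]0%R, +oo[%classic : set R).
Variables (a b : 'I_q -> R) (alpha : 'I_p -> R).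
Variables (Sigma : nat -> R -> C) (A : nat -> 'I_p -> {poly C}) (B : nat -> 'I_q -> {poly C}).
Hypothesis a_b : forall j, a j < b j.
Hypothesis alpha_a : forall i rho, -1 < alpha i + a rho.
Hypothesis alpha_nonresonant : forall i h, i != h -> alpha i - alpha h \isn't a Num.int.
Hypothesis jA : is_jacobi_A a b alpha Sigma A.
Hypothesis jB : is_jacobi_B a b alpha B.

Let delta (j h : 'I_q) : nat := h == j.
Let moment := gamma_moment a b delta (fun=> 0%N).

Lemma jacobi_moment (j : 'I_q) (s : R) : (forall i, 0 < s + a i) ->
  mu.-integrable D (EFin \o (fun x => x `^ (s - 1) * jacobi_w a b j x)) /\
  \int[mu]_(x in D) (x `^ (s - 1) * jacobi_w a b j x) = moment j s.
Proof.
move=> sa.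
have wE : jacobi_w a b j = beta_gamma_weight a (add_unit b j) (fun v : void => 0) (enum 'I_q) [::].
  by rewrite /beta_gamma_weight cats0.
have aj i : a i < add_unit b j i by rewrite (lt_le_trans (a_b i)) // lerDl.
have := beta_gamma_weight_moment (sI := enum 'I_q) (sJ := [::]) aj sa
  (a2 := fun v : void => 0) (fun v : void => match v with end).
rewrite wE size_enum_ord addn0 => /(_ hq)[h1 h2]; split=> //.
by rewrite h2 /moment /gamma_moment expr0 mul1r /beta_gamma_mellin big_nil mulr1 !big_enum.
Qed.

Let w_int j s (sa : forall i, 0 < s + a i) := (jacobi_moment j sa).1.
Let w_mom j s (sa : forall i, 0 < s + a i) := (jacobi_moment j sa).2.
Let dom := exponent_domain alpha_a.
Let M := moment_matrix hp hq alpha moment.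

Lemma jacobi_A_orthogonal N n : (n < N)%N -> pairing M (flat N hp (A N)) 'X^n = 0.
Proof.
move=> nN; have [encl sA AE] := jA N.
pose S (t : C) := pochv (fun j => t + (1 + (b j)%:C)) (@step_line q N) *
  (Gammav (fun j => t + ((b j)%:C + 1)) / Gammav (fun j => t + ((a j)%:C + 1))).
have X ab := @gamma_pairing_A_eq0 R p q q hp hq alpha a b delta (fun=> 0%N) (jacobi_w a b)
  alpha_nonresonant alpha_a ab w_int w_mom N n (Sigma N) (Gamma_pole_set b) S
  ((-1) ^+ N.+1 / two_pi_i R) 1 (@step_line q N) (A N) encl.
apply: X => //.
- by move=> h; exists h.
- move=> K Kb Ka; apply: rational_approxM => //; first exact: rational_approx_pochv.
  apply: rational_approxM => //; last exact: rational_approx_GammavV.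
  apply: rational_approx_Gammav => // i k; exists i, k.
  by rewrite !rmorphB rmorphN rmorph_nat rmorph1; ring.
- move=> c ca cb; rewrite mul1r /S.
  have bE j : c%:C + ((b j)%:C + 1) = (c + b j + 1)%:C by rewrite !rmorphD rmorph1 addrA.
  have aE j : c%:C + ((a j)%:C + 1) = (c + a j + 1)%:C by rewrite !rmorphD rmorph1 addrA.
  have EN : pochv (fun j => c%:C + (1 + (b j)%:C)) (@step_line q N) *
      Gammav (fun j => c%:C + ((b j)%:C + 1)) =
      (\prod_(h < q) rgamma (c + b h + 1 + (step_line N h)%:R))%:C.
    rewrite rmorph_prod -big_split; apply: eq_bigr => h _ /=.
    by rewrite (addrC 1) bE poch_real Gamma_real // rgamma_shift // rmorphM.
  have ED : Gammav (fun j => c%:C + ((a j)%:C + 1)) = (\prod_(h < q) rgamma (c + a h + 1))%:C.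
    by rewrite -Gammav_real //; apply: eq_bigr => h _; rewrite aE.
  by rewrite mulrA EN ED -fmorphV -rmorphM.
- move=> x x0; rewrite -AE // /jacobi_Ahat; congr (_ * _); apply: eq_contour_integral => t _.
  rewrite pochv_step_nodes_shift; congr (_ * _); rewrite /S mulrAC.
  by congr (_ * (_ / _) / _); apply: eq_bigr => j _; rewrite [in RHS]addrA.
- move=> h; have /andP[+ _] := step_line_bounds n h.
  have := leq_step_line h nN; rewrite (step_lineS n hq) /delta; lia.
(* The degree of T is bounded by N - 1: the entries of the step line add up to N, and the raised b_j
   of the weight saves one factor. *)
have E : (\sum_(h < q) (step_line N h - n %/ q - delta (chi hq n) h) + q * (n %/ q) + 1 = N)%N.
  rewrite -[RHS](sum_step_line N hq) -[q in (q * _)%N]card_ord -sum_nat_const -big_split /=.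
  rewrite -[1%N in LHS](_ : \sum_(h < q) delta (chi hq n) h = 1)%N; last first.
    by rewrite (bigD1 (chi hq n)) //= big1 /delta ?eqxx // => i /negPf ->.
  rewrite -big_split /=; apply: eq_bigr => h _.
  have /andP[+ _] := step_line_bounds n h.
  have := leq_step_line h nN; rewrite (step_lineS n hq) /delta; lia.
by rewrite addn0 -{2}E addn1 addnC.
Qed.

Lemma jacobi_B_orthogonal N n : (n < N)%N -> pairing M 'X^n (flat N hq (B N)) = 0.
Proof.
move=> nN; have [sB BE] := jB N.
rewrite /M (pairing_B_mellin hp hq dom w_int w_mom _ sB) BE; last exact: dom.
by rewrite /jacobi_Bmellin pochv_step_node_eq0 // mulr0 oppr0.
Qed.

(** The integral over (0, 1) equals the one over the half-line because the weight vanishes from 1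
    on. *)
Lemma jacobi_gE N : jacobi_g hq a b alpha Sigma N = pairing M (flat N hp (A N)) 'X^N.
Proof.
have [_ sA AE] := jA N.
rewrite /M (pairing_A_integral hp hq dom w_int w_mom _ sA) /jacobi_g cintegral_unit_interval.
  apply: eq_cintegral => x /=; rewrite in_itv /= andbT => x0.
  by rewrite AE // step_line_chi.
move=> x x1; rewrite /jacobi_w /jacobi_w0 mconvs_beta_eq0 // mulr0 //.
Qed.

Lemma jacobi_PE N M' : jacobi_P hq a b alpha Sigma A B N M' =
  (jacobi_h hq B N * jacobi_g hq a b alpha Sigma M')^-1 *
  \sum_(i < p) \sum_(j < q) \sum_(u < size (A M' i)) \sum_(v < size (B N j))
    (A M' i)`_u * (B N j)`_v * (moment j (alpha i + u%:R + v%:R + 2))%:C.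
Proof.
congr (_ * _); apply: eq_bigr => i _; apply: eq_bigr => j _; apply: eq_bigr => u _.
apply: eq_bigr => v _; congr (_ * _).
have d rho : 0 < alpha i + u%:R + v%:R + 2 + a rho.
  by have := dom i (u + v + 1) rho; rewrite !natrD; lra.
rewrite !Gammav_real //; last first.
  by move=> k; rewrite (lt_le_trans (d k)) // lerD2l (le_trans (ltW (a_b k))) // lerDl.
by rewrite -fmorphV -rmorphM /moment /gamma_moment expr0 mul1r.
Qed.

Lemma jacobi_recurrence : (forall N, jacobi_h hq B N != 0) ->
  (forall N, jacobi_g hq a b alpha Sigma N != 0) ->
  let BJ := jacobi_Bn hq a b B in
  let AJ := jacobi_An hq a b alpha Sigma in
  let bJ := jacobi_b hq a b alpha Sigma A B in
  forall N : nat,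
    [/\ forall x : R, 0 < x ->
          x%:C * BJ N x =
          \sum_(k <- int_range p q | 0 <= N%:Z + k) bJ N k * BJ (absz (N%:Z + k)) x,
        forall x : R, 0 < x ->
          x%:C * AJ N x =
          \sum_(k <- int_range q p | 0 <= N%:Z + k)
            bJ (absz (N%:Z + k)) (- k) * AJ (absz (N%:Z + k)) x &
        bJ N q%:Z = 1].
Proof.
move=> h0 g0 BJ AJ bJ N.
have sA n i : (size (A n i) <= step_line n.+1 i)%N by have [] := jA n.
have sB n j : (size (B n j) <= step_line n.+1 j)%N by have [] := jB n.
have AE n x (x0 : 0 < x) : jacobi_Ahat a b alpha (Sigma n) n x = power_form alpha (A n) x.
  by have [_ _ ->] := jA n.
exact: (@step_line_recurrence R p q hp hq alpha (jacobi_w a b) moment A B sA sB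
  jacobi_A_orthogonal jacobi_B_orthogonal (jacobi_h hq B) (jacobi_g hq a b alpha Sigma)
  (jacobi_P hq a b alpha Sigma A B) (fun n => jacobi_Ahat a b alpha (Sigma n) n)
  (jacobi_b hq a b alpha Sigma A B) (fun n => erefl) jacobi_gE h0 g0 jacobi_PE
  (fun n k => erefl) AE N).
Qed.

End Jacobi.

(** * The Laguerre forms *)

Section Laguerre.
Variables (R : realType) (p r s : nat) (hp : (0 < p)%N) (hs : (0 < s)%N) (hq : (0 < r + s)%N).
Local Notation C := (R[i]).
Local Notation mu := (@lebesgue_measure R).
Local Notation D := (`]0%R, +oo[%classic : set R).
Variables (a : 'I_(r + s) -> R) (b : 'I_r -> R) (beta : 'I_p -> R).
Variables (Sigma : nat -> R -> C) (A : nat -> 'I_p -> {poly C})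
  (B : nat -> 'I_(r + s) -> {poly C}).
Hypothesis a_b : forall h, a (lshift s h) < b h.
Hypothesis beta_a : forall i rho, -1 < beta i + a rho.
Hypothesis beta_nonresonant : forall i h, i != h -> beta i - beta h \isn't a Num.int.
Hypothesis lA : is_laguerre_A a b beta Sigma A.
Hypothesis lB : is_laguerre_B a b beta B.

Let delta (rho : 'I_(r + s)) (h : 'I_r) : nat :=
  match fintype.split rho with inl h' => h == h' | inr _ => 0%N end.
Let ell (rho : 'I_(r + s)) : nat :=
  match fintype.split rho with inl _ => 0%N | inr l => l end.
Let moment := gamma_moment a b delta ell.

Lemma split_lshift (h : 'I_r) : fintype.split (lshift s h) = inl h.
Proof. exact: (unsplitK (inl h)). Qed.

Lemma split_rshift (l : 'I_s) : fintype.split (rshift r l) = inr l.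
Proof. exact: (unsplitK (inr l)). Qed.

Lemma laguerre_moment (rho : 'I_(r + s)) (z : R) : (forall i, 0 < z + a i) ->
  mu.-integrable D (EFin \o (fun x => x `^ (z - 1) * laguerre_U a b rho x)) /\
  \int[mu]_(x in D) (x `^ (z - 1) * laguerre_U a b rho x) = moment rho z.
Proof.
move=> za.
pose al h := a (lshift s h); pose ar l := a (rshift r l).
have zal h : 0 < z + al h by exact: za.
have zar l : 0 < z + ar l by exact: za.
have Ms (b' : 'I_r -> R) : beta_gamma_mellin al b' ar (enum 'I_r) (enum 'I_s) z =
    \prod_i rgamma (z + a i) / \prod_h rgamma (z + b' h).
  by rewrite /beta_gamma_mellin !big_enum big_split_ord.
rewrite /laguerre_U /moment /gamma_moment /delta /ell.
case: fintype.split => [h|l].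
  have ab h' : al h' < add_unit b h h' by rewrite (lt_le_trans (a_b h')) // lerDl.
  have := beta_gamma_weight_moment (sI := enum 'I_r) (sJ := enum 'I_s) ab zal zar.
  by rewrite !size_enum_ord => /(_ hq); rewrite Ms expr0 mul1r.
have := theta_moment a_b zal zar l (enum 'I_r) (sJ := enum 'I_s).
rewrite size_enum_ord => /(_ hs); rewrite Ms => -[h1 h2]; split; first exact: h1.
by rewrite [LHS]h2; congr (_ * (_ / _)); apply: eq_bigr => h _; rewrite addr0.
Qed.

Let w_int rho z (za : forall i, 0 < z + a i) := (laguerre_moment rho za).1.
Let w_mom rho z (za : forall i, 0 < z + a i) := (laguerre_moment rho za).2.
Let dom := exponent_domain beta_a.
Let M := moment_matrix hp hq beta moment.

Lemma laguerre_delta_le N n (h : 'I_r) : (n < N)%N ->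
  (n %/ (r + s) + delta (chi hq n) h <= laguerre_n s N h)%N.
Proof.
move=> nN; have /andP[+ _] := step_line_bounds n (lshift s h).
have := leq_step_line (lshift s h) nN; rewrite (step_lineS n hq) /laguerre_n /delta.
case: (fintype.splitP (chi hq n)) => [h' E|l E]; last by lia.
by rewrite -!val_eqE /= in E *; rewrite E; lia.
Qed.

(** If chi_n is among the first r slots, the raised b_h saves one factor, as for Jacobi. If it is r
    + l, nothing is saved and s ^ l adds the degree l. But with k = n %/ (r + s), the last s entries
    of the step line of n + 1 <= N sum up to at least s k + l + 1, which exceeds s k + l. *)
Lemma laguerre_degree N n : (n < N)%N ->
  ((r + s) * (n %/ (r + s)) + \sum_(h < r) (laguerre_n s N h - n %/ (r + s) - delta (chi hq n) h)
   + ell (chi hq n) < N)%N.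
Proof.
move=> nN; set k := (n %/ (r + s))%N; pose rho := chi hq n.
have E1 : (\sum_(h < r) laguerre_n s N h = \sum_(h < r) (laguerre_n s N h - k - delta rho h) +
    r * k + \sum_(h < r) delta rho h)%N.
  rewrite -[r in (r * _)%N]card_ord -sum_nat_const -!big_split /=; apply: eq_bigr => h _.
  by have := laguerre_delta_le h nN; rewrite -/k -/rho; lia.
have E2 : (\sum_(h < r) laguerre_n s N h + \sum_(l < s) step_line N (rshift r l) = N)%N.
  by rewrite -[RHS](sum_step_line N hq) big_split_ord.
have E3 : (\sum_(l < s) step_line n.+1 (rshift r l) <= \sum_(l < s) step_line N (rshift r l))%N.
  by apply: leq_sum => l _; exact: leq_step_line.
have E4 : (\sum_(h < r) step_line n.+1 (lshift s h) + \sum_(l < s) step_line n.+1 (rshift r l) = n.+1)%N.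
  by rewrite -[RHS](sum_step_line n.+1 hq) big_split_ord.
have E5 : (s * k <= \sum_(l < s) step_line N (rshift r l))%N.
  rewrite -[s in (s * _)%N]card_ord -sum_nat_const; apply: leq_sum => l _.
  have /andP[h _] := step_line_bounds n (rshift r l).
  exact: leq_trans h (leq_step_line _ (ltnW nN)).
have nE : n = (k * (r + s) + rho)%N by rewrite {1}(divn_eq n (r + s)).
have [[E [Ed El]]|[l [E [Ed El]]]] : (rho < r)%N /\ (\sum_(h < r) delta rho h = 1)%N /\ ell rho = 0%N \/
    exists l : nat, rho = (r + l)%N :> nat /\ (\sum_(h < r) delta rho h = 0)%N /\ ell rho = l.
  rewrite /delta /ell; case: (fintype.splitP rho) => [h' E|l E]; [left|right; exists l].
    split=> //; split=> //.
    by rewrite (bigD1 h') //= big1 ?eqxx // => i /negPf ->.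
  by split=> //; split=> //; rewrite big1.
- rewrite -/rho El; rewrite Ed in E1; nia.
have E6 : (\sum_(h < r) step_line n.+1 (lshift s h) <= r * k.+1)%N.
  rewrite -[r in (r * _)%N]card_ord -sum_nat_const; apply: leq_sum => h _.
  rewrite (step_lineS n hq) -val_eqE /= -[(n %% _)%N]/(nat_of_ord rho) E.
  have /andP[_ +] := step_line_bounds n (lshift s h).
  by move: (ltn_ord h) => /=; rewrite -/k; lia.
rewrite -/rho El; rewrite Ed in E1; rewrite E in nE; nia.
Qed.

Lemma laguerre_A_orthogonal N n : (n < N)%N -> pairing M (flat N hp (A N)) 'X^n = 0.
Proof.
move=> nN; have [encl sA AE] := lA N.
(* The sign arises from writing the denominators (beta_i - t)_m through the factors t - c. *)
pose S (t : C) := (-1) ^+ N.+1 *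
  (Gammav (fun h => t + ((b h)%:C + (laguerre_n s N h)%:R + 1)) /
   Gammav (fun rho => t + ((a rho)%:C + 1))).
have X ab := @gamma_pairing_A_eq0 R p (r + s) r hp hq beta a b delta ell (laguerre_U a b)
  beta_nonresonant beta_a ab w_int w_mom N n (Sigma N)
  (Gamma_pole_set (fun h => b h + (laguerre_n s N h)%:R)) S
  ((two_pi_i R)^-1) ((-1) ^+ N.+1) (laguerre_n s N) (A N) encl.
apply: X => //.
- by move=> h; exists (lshift s h).
- move=> K Kb Ka; apply: rational_approxM => //; first exact: rational_approx_cst.
  apply: rational_approxM => //; last exact: rational_approx_GammavV.
  apply: rational_approx_Gammav => // i k; exists i, k.
  move: (laguerre_n s N i) => nu; rewrite !rmorphB rmorphN rmorphD !rmorph_nat rmorph1; ring.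
- move=> c ca cb; rewrite /S; congr (_ * _).
  rewrite rmorphM fmorphV /= -Gammav_real; last first.
    by move=> h; rewrite ltr_wpDr // ler0n.
  rewrite -Gammav_real //; congr (_ / _); apply: eq_bigr => h _; congr Gamma.
    move: (laguerre_n s N h) => nu; rewrite !rmorphD rmorph_nat rmorph1 /=; ring.
  by rewrite !rmorphD rmorph1 /=; ring.
- move=> x x0; rewrite -AE // /laguerre_Ahat; congr (_ * _); apply: eq_contour_integral => t _.
  rewrite pochv_step_nodes_opp /S.
  set Q := \prod_(l < _) _; rewrite invfM -exprVn invrN invr1.
  have -> : Gammav (fun h => t + (b h)%:C + (laguerre_n s N h)%:R + 1) =
      Gammav (fun h => t + ((b h)%:C + (laguerre_n s N h)%:R + 1)).
    by apply: eq_bigr => h _; rewrite !addrA.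
  have -> : Gammav (fun rho => t + (a rho)%:C + 1) = Gammav (fun rho => t + ((a rho)%:C + 1)).
    by apply: eq_bigr => h _; rewrite !addrA.
  by ring.
- by move=> h; exact: laguerre_delta_le.
- exact: laguerre_degree.
Qed.

Lemma laguerre_B_orthogonal N n : (n < N)%N -> pairing M 'X^n (flat N hq (B N)) = 0.
Proof.
move=> nN; have [sB BE] := lB N.
rewrite /M (pairing_B_mellin hp hq dom w_int w_mom _ sB) BE; last exact: dom.
by rewrite /laguerre_Bmellin pochv_step_node_eq0 // mulr0.
Qed.

Lemma laguerre_gE N : laguerre_g hq a b beta Sigma N = pairing M (flat N hp (A N)) 'X^N.
Proof.
have [_ sA AE] := lA N.
rewrite /M (pairing_A_integral hp hq dom w_int w_mom _ sA) /laguerre_g.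
apply: eq_cintegral => x /=; rewrite in_itv /= andbT => x0.
by rewrite AE // step_line_chi.
Qed.

Lemma laguerre_PE N M' : laguerre_P hq a b beta Sigma A B N M' =
  (laguerre_h hq B N * laguerre_g hq a b beta Sigma M')^-1 *
  \sum_(i < p) \sum_(rho < r + s) \sum_(u < size (A M' i)) \sum_(v < size (B N rho))
    (A M' i)`_u * (B N rho)`_v * (moment rho (beta i + u%:R + v%:R + 2))%:C.
Proof.
congr (_ * _); apply: eq_bigr => i _; rewrite exchange_big; apply: eq_bigr => u _ /=.
have d v rho : 0 < laguerre_zeta beta i u v + a rho.
  by have := dom i (u + v + 1) rho; rewrite /laguerre_zeta !natrD; lra.
have db v h (c : R) : 0 <= c -> 0 < laguerre_zeta beta i u v + (b h + c).
  by have := d v (lshift s h); have := a_b h; lra.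
rewrite big_split_ord mulrDr /=; congr (_ + _); rewrite mulr_sumr; apply: eq_bigr => h _;
  rewrite mulr_sumr; apply: eq_bigr => v _; rewrite -!mulrA; congr (_ * (_ * _));
  rewrite /moment /gamma_moment /delta /ell ?split_lshift ?split_rshift.
  rewrite !Gammav_real //; last by move=> k; exact: db.
  by rewrite -fmorphV -rmorphM expr0 mul1r.
rewrite !Gammav_real //; last by move=> k; rewrite -[b k]addr0; exact: db.
by rewrite -fmorphV -!rmorphM; congr ((_ * (_ / _))%:C); apply: eq_bigr => k _; rewrite addr0.
Qed.

Lemma laguerre_recurrence : (forall N, laguerre_h hq B N != 0) ->
  (forall N, laguerre_g hq a b beta Sigma N != 0) ->
  let BL := laguerre_Bn hq a b B in
  let AL := laguerre_An hq a b beta Sigma in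
  let bL := laguerre_b hq a b beta Sigma A B in
  forall N : nat,
    [/\ forall x : R, 0 < x ->
          x%:C * BL N x =
          \sum_(k <- int_range p (r + s) | 0 <= N%:Z + k) bL N k * BL (absz (N%:Z + k)) x,
        forall x : R, 0 < x ->
          x%:C * AL N x =
          \sum_(k <- int_range (r + s) p | 0 <= N%:Z + k)
            bL (absz (N%:Z + k)) (- k) * AL (absz (N%:Z + k)) x &
        bL N (r + s)%N%:Z = 1].
Proof.
move=> h0 g0 BL AL bL N.
have sA n i : (size (A n i) <= step_line n.+1 i)%N by have [] := lA n.
have sB n j : (size (B n j) <= step_line n.+1 j)%N by have [] := lB n.
have AE n x (x0 : 0 < x) : laguerre_Ahat a b beta (Sigma n) n x = power_form beta (A n) x.
  by have [_ _ ->] := lA n.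
exact: (@step_line_recurrence R p (r + s) hp hq beta (laguerre_U a b) moment A B sA sB
  laguerre_A_orthogonal laguerre_B_orthogonal (laguerre_h hq B) (laguerre_g hq a b beta Sigma)
  (laguerre_P hq a b beta Sigma A B) (fun n => laguerre_Ahat a b beta (Sigma n) n)
  (laguerre_b hq a b beta Sigma A B) (fun n => erefl) laguerre_gE h0 g0 laguerre_PE
  (fun n k => erefl) AE N).
Qed.

End Laguerre.

Theorem theorem6p2 (R : realType) :
  (* Jacobi *)
  (forall (p q : nat) (hp : (0 < p)%N) (hq : (0 < q)%N)
     (a b : 'I_q -> R) (alpha : 'I_p -> R)
     (Sigma : nat -> R -> R[i])
     (A : nat -> 'I_p -> {poly R[i]}) (B : nat -> 'I_q -> {poly R[i]}),
     (forall j, -1 < a j < b j) ->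
     (forall i rho, -1 < alpha i + a rho) ->
     (forall i h, i != h -> alpha i - alpha h \isn't a Num.int) ->
     (forall j h, j != h -> b j - b h \isn't a Num.int) ->
     (forall rho j, a rho - b j \isn't a Num.nat) ->
     is_jacobi_A a b alpha Sigma A ->
     is_jacobi_B a b alpha B ->
     step_line_normal `]0, 1[ alpha (jacobi_w a b) ->
     (forall N, jacobi_h hq B N != 0) ->
     (forall N, jacobi_g hq a b alpha Sigma N != 0) ->
     let BJ := jacobi_Bn hq a b B in
     let AJ := jacobi_An hq a b alpha Sigma in
     let bJ := jacobi_b hq a b alpha Sigma A B in
     forall N : nat,
       [/\ forall x : R, 0 < x ->
             x%:C * BJ N x =
             \sum_(k <- int_range p q | 0 <= N%:Z + k)
               bJ N k * BJ (absz (N%:Z + k)) x,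
           forall x : R, 0 < x ->
             x%:C * AJ N x =
             \sum_(k <- int_range q p | 0 <= N%:Z + k)
               bJ (absz (N%:Z + k)) (- k) * AJ (absz (N%:Z + k)) x &
           bJ N q%:Z = 1])
  /\
  (* Laguerre of the first kind *)
  (forall (p r s : nat) (hp : (0 < p)%N) (hs : (0 < s)%N)
     (hq : (0 < r + s)%N)
     (a : 'I_(r + s) -> R) (b : 'I_r -> R) (beta : 'I_p -> R)
     (Sigma : nat -> R -> R[i])
     (A : nat -> 'I_p -> {poly R[i]})
     (B : nat -> 'I_(r + s) -> {poly R[i]}),
     (forall rho, -1 < a rho) ->
     (forall h, -1 < b h) ->
     (forall h, a (lshift s h) < b h) ->
     (forall i rho, -1 < beta i + a rho) ->
     (forall i h, i != h -> beta i - beta h \isn't a Num.int) ->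
     (forall h j, h != j -> b h != b j) ->
     (forall h rho (v : nat), (1 <= v)%N -> b h + v%:R != a rho) ->
     is_laguerre_A a b beta Sigma A ->
     is_laguerre_B a b beta B ->
     step_line_normal `]0, +oo[ beta (laguerre_U a b) ->
     (forall N, laguerre_h hq B N != 0) ->
     (forall N, laguerre_g hq a b beta Sigma N != 0) ->
     let q := (r + s)%N in
     let BL := laguerre_Bn hq a b B in
     let AL := laguerre_An hq a b beta Sigma in
     let bL := laguerre_b hq a b beta Sigma A B in
     forall N : nat,
       [/\ forall x : R, 0 < x ->
             x%:C * BL N x =
             \sum_(k <- int_range p q | 0 <= N%:Z + k)
               bL N k * BL (absz (N%:Z + k)) x,
           forall x : R, 0 < x ->
             x%:C * AL N x =
             \sum_(k <- int_range q p | 0 <= N%:Z + k)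
               bL (absz (N%:Z + k)) (- k) * AL (absz (N%:Z + k)) x &
           bL N q%:Z = 1]).
Proof.
split.
- move=> p q hp hq a b alpha Sigma A B hab ha nr _ _ jA jB _ h0 g0.
  by apply: (jacobi_recurrence hp) => // j; have /andP[] := hab j.
- move=> p r s hp hs hq a b beta Sigma A B _ _ hab ha nr _ _ lA lB _ h0 g0.
  exact: (laguerre_recurrence hp hs).
Qed.
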